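(* Let $n\ge 1$ and $m$ be integers with $0\le m<n$, and let $\alpha$ be a real number with $\frac m2<\alpha<\frac n2$. Then the trace $\tau_m$, defined on $\mathcal S(\mathbb{R}^n)$ by $(\tau_m f)(x_1,\dots,x_{n-m})=f(x_1,\dots,x_{n-m},0,\dots,0)$, has a unique extension to a bounded operator $\tau_m:D_\alpha(\mathbb{R}^n)\to D_{\alpha-m/2}(\mathbb{R}^{n-m})$. Moreover, for any $f\in D_\alpha(\mathbb{R}^n)$, $$\|\tau_m f\|_{D_{\alpha-m/2}(\mathbb{R}^{n-m})}^2\le\frac{1}{2^m\pi^{m/2}}\,\frac{\Gamma\left(\frac{2\alpha-m}{2}\right)}{\Gamma(\alpha)}\,\|f\|_{D_\alpha(\mathbb{R}^n)}^2 .$$ The constant in this inequality is best possible, and there is equality only if $$\widehat f(k_1,k_2)=C\,\frac{\widehat g(k_1)}{(|k_1|^2+|k_2|^2)^{\alpha}}\quad\text{for almost every }(k_1,k_2)\in\mathbb{R}^{n-m}\times\mathbb{R}^m,$$ for some constant $C$ and some measurable function $\widehat g$ on $\mathbb{R}^{n-m}$ with $$\int_{\mathbb{R}^{n-m}}\frac{|\widehat g(k_1)|^2}{|k_1|^{2\alpha-m}}\,dk_1<\infty .$$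
   Context: Functions are complex valued. The Fourier transform is $\widehat f(k)=\int_{\mathbb{R}^d}f(x)e^{-2\pi i x\cdot k}\,dx$, extended to tempered distributions by $\widehat T(\phi)=T(\widehat\phi)$ for $\phi\in\mathcal S(\mathbb{R}^d)$. For $0\le 2\alpha<d$, $D_\alpha(\mathbb{R}^d)$ is the space of tempered distributions $f\in\mathcal S'(\mathbb{R}^d)$ whose Fourier transform is a function $\widehat f\in L^2(\mathbb{R}^d,|k|^{2\alpha}dk)$, i.e. $\widehat f$ acts on $\phi \in\mathcal S(\mathbb{R}^d)$ by $\int_{\mathbb{R}^d}\widehat f(k)\phi(k)\,dk$. It is a Hilbert space with norm $$\|f\|_{D_\alpha(\mathbb{R}^d)}=\left(\int_{\mathbb{R}^d}|\widehat f(k)|^2|2\pi k|^{2\alpha}\,dk\right)^{1/2},$$ and $\mathcal S(\mathbb{R}^d)$ is dense in it. *)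

(* Defs.v *)
From HB Require Import structures.
From mathcomp Require Import all_boot all_order all_algebra.
From mathcomp Require Import all_classical all_reals all_analysis.
From mathcomp Require Import measurable_realfun complex ring.

Set Implicit Arguments.
Unset Strict Implicit.
Unset Printing Implicit Defensive.

Import Order.TTheory GRing.Theory Num.Theory.
Import numFieldNormedType.Exports.

Local Open Scope classical_set_scope.
Local Open Scope ring_scope.

Definition measure_rV_display : measure_display -> measure_display.
Proof. exact. Qed.

(* The product sigma-algebra on row vectors, as the library has it on tuples;
   on 'rV[R]_n it is the Borel sigma-algebra. *)
Section measurable_rV.
Context {d} {T : measurableType d} (n : nat).

Let coord (i : 'I_n) (x : 'rV[T]_n) : T := x ord0 i.

Let rV_set0 : g_sigma_preimage coord set0.
Proof. exact: sigma_algebra0. Qed.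

Let rV_setC A : g_sigma_preimage coord A -> g_sigma_preimage coord (~` A).
Proof. exact: sigma_algebraC. Qed.

Let rV_bigcup (F : _^nat) : (forall i, g_sigma_preimage coord (F i)) ->
  g_sigma_preimage coord (\bigcup_i (F i)).
Proof. exact: sigma_algebra_bigcup. Qed.

HB.instance Definition _ := @isMeasurable.Build (measure_rV_display d)
  'rV[T]_n (g_sigma_preimage coord) rV_set0 rV_setC rV_bigcup.

End measurable_rV.

Lemma measurable_rV_coord d (T : measurableType d) n (i : 'I_n) :
  measurable_fun [set: 'rV[T]_n] (fun x : 'rV[T]_n => x ord0 i).
Proof.
move=> _ Y mY; rewrite setTI; apply: sub_sigma_algebra => /=.
rewrite -bigcup_seq/=; exists i => /=; first by rewrite mem_index_enum.
by exists Y => //; rewrite setTI.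
Qed.

Lemma measurable_rV_box d (T : measurableType d) n (A : 'I_n -> set T) :
  (forall i, measurable (A i)) ->
  measurable [set x : 'rV[T]_n | forall i, A i (x ord0 i)].
Proof.
move=> mA; rewrite [X in measurable X](_ : _ = \big[setI/setT]_(i < n)
    ((fun x : 'rV[T]_n => x ord0 i) @^-1` A i)).
  apply: bigsetI_measurable => i _; rewrite -[X in measurable X]setTI.
  exact: measurable_rV_coord.
apply/seteqP; split => x /=; rewrite -bigcap_seq.
  by move=> h i _; exact: h.
by move=> h i; apply: h; rewrite /= mem_index_enum.
Qed.

Lemma measurable_fun_rVP d1 d2 (T1 : measurableType d1)
    (T2 : measurableType d2) n (f : T1 -> 'rV[T2]_n) :
  (forall i, measurable_fun [set: T1] (fun t => f t ord0 i)) ->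
  measurable_fun [set: T1] f.
Proof.
move=> mf _ Y mY; rewrite setTI.
suff : g_sigma_preimage (fun (i : 'I_n) (t : T1) => f t ord0 i)
    `<=` measurable.
  apply.
  by rewrite (g_sigma_preimage_comp (fun i (x : 'rV[T2]_n) => x ord0 i)); exists Y; rewrite ?setTI.
apply: smallest_sub; first exact: sigma_algebra_measurable.
case: n => [|n] in f mf Y mY *; first by rewrite big_ord0.
rewrite -bigcup_mkord_ord; apply: bigcup_sub => i Ii.
by move=> A [B mB <-]; exact: mf.
Qed.

(* The library proves this only locally, and its canonical instance is shadowed
   by the one for pairs of subprobabilities. *)
Lemma sigma_finite_product d1 d2 (T1 : measurableType d1)
    (T2 : measurableType d2) (R : realType)
    (m1 : {sigma_finite_measure set T1 -> \bar R})
    (m2 : {sigma_finite_measure set T2 -> \bar R}) :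
  sigma_finite setT (m1 \x m2)%E.
Proof.
have /sigma_finiteP[F [TF ndF Foo]] := sigma_finiteT m1.
have /sigma_finiteP[G [TG ndG Goo]] := sigma_finiteT m2.
exists (fun n => F n `*` G n).
  rewrite -setXTT TF TG predeqE => -[x y]; split.
    move=> [/= [n _ Fnx] [k _ Gky]]; exists (maxn n k) => //; split.
    - by move: x Fnx; exact/subsetPset/ndF/leq_maxl.
    - by move: y Gky; exact/subsetPset/ndG/leq_maxr.
  by move=> [n _ []/= ? ?]; split; exists n.
move=> k; have [? ?] := Foo k; have [? ?] := Goo k.
split; first exact: measurableX.
by rewrite product_measure1E// lte_mul_pinfty// ge0_fin_numE.
Qed.

Section lebesgue_rV.
Context {R : realType}.
Local Open Scope ereal_scope.

Definition rV_cons n (p : measurableTypeR R * 'rV[R]_n) : 'rV[R]_n.+1 :=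
  row_mx (p.1)%:M p.2 : 'rV[R]_(1 + n).

Definition rV_uncons n (x : 'rV[R]_n.+1) : measurableTypeR R * 'rV[R]_n :=
  (x ord0 ord0, \row_j x ord0 (lift ord0 j)).

Lemma rV_cons0 n p : @rV_cons n p ord0 ord0 = p.1.
Proof.
transitivity (row_mx (p.1)%:M p.2 ord0 (lshift n ord0)).
  by congr (row_mx _ _ _ _); exact/val_inj.
by rewrite row_mxEl mxE.
Qed.

Lemma rV_consS n p j : @rV_cons n p ord0 (lift ord0 j) = p.2 ord0 j.
Proof.
transitivity (row_mx (p.1)%:M p.2 ord0 (rshift 1 j)).
  by congr (row_mx _ _ _ _); exact/val_inj.
by rewrite row_mxEr.
Qed.

Lemma rV_consK n : cancel (@rV_cons n) (@rV_uncons n).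
Proof.
move=> [t x]; rewrite /rV_uncons rV_cons0; congr pair.
by apply/rowP => j; rewrite mxE rV_consS.
Qed.

Lemma rV_unconsK n : cancel (@rV_uncons n) (@rV_cons n).
Proof.
move=> x; apply/rowP => i; case: (unliftP ord0 i) => [j ->|->].
  by rewrite rV_consS mxE.
by rewrite rV_cons0.
Qed.

Lemma measurable_rV_cons n : measurable_fun setT (@rV_cons n).
Proof.
apply: measurable_fun_rVP => i; case: (unliftP ord0 i) => [j ->|->].
  under eq_fun do rewrite rV_consS.
  apply: (measurableT_comp (@measurable_rV_coord _ R n j)).
  exact: measurable_snd.
under eq_fun do rewrite rV_cons0.
exact: measurable_fst.
Qed.

Lemma measurable_rV_uncons n : measurable_fun setT (@rV_uncons n).
Proof.
apply/measurable_fun_pairP; split.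
  exact: (@measurable_rV_coord _ R n.+1 ord0).
apply: measurable_fun_rVP => i /=.
under eq_fun do rewrite mxE.
exact: measurable_rV_coord.
Qed.

Section step.
Variables (n : nat) (mu : {sigma_finite_measure set 'rV[R]_n -> \bar R}).

Definition lebesgue_rV_step : set 'rV[R]_n.+1 -> \bar R :=
  pushforward (@lebesgue_measure R \x mu) (@rV_cons n).

HB.instance Definition _ := Measure.copy lebesgue_rV_step
  (measure_function_pushforward__canonical__measure_function_Measure
    (@lebesgue_measure R \x mu) (@measurable_rV_cons n)).

Let lebesgue_rV_step_sigma_finite : sigma_finite setT lebesgue_rV_step.
Proof.
have [F FT Ffin] : sigma_finite setT (@lebesgue_measure R \x mu).
  exact: sigma_finite_product.
exists (fun k => @rV_uncons n @^-1` F k).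
  by rewrite -preimage_bigcup -FT preimage_setT.
move=> k; have [mF Fy] := Ffin k; split.
  by rewrite -[X in measurable X]setTI; exact: measurable_rV_uncons.
rewrite /lebesgue_rV_step /pushforward -comp_preimage (_ : _ \o _ = id)//.
by apply/funext => p; exact: rV_consK.
Qed.

HB.instance Definition _ := Measure_isSigmaFinite.Build _ _ _
  lebesgue_rV_step lebesgue_rV_step_sigma_finite.

End step.

(* Lebesgue measure on R^n, built one coordinate at a time: the point mass on
   R^0, then the image of the product measure on R x R^n. *)
Fixpoint lebesgue_rV n : {sigma_finite_measure set 'rV[R]_n -> \bar R} :=
  match n with
  | 0 => \d_(0%R : 'rV[R]_0)
  | k.+1 => lebesgue_rV_step (lebesgue_rV k)
  end.

Lemma lebesgue_rV_box n (A : 'I_n -> set R) :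
  (forall i, measurable (A i)) ->
  lebesgue_rV n [set x | forall i, A i (x ord0 i)] =
  \prod_(i < n) lebesgue_measure (A i).
Proof.
elim: n A => [|n IH] A mA.
  rewrite big_ord0 /= diracE mem_set//.
  by case.
rewrite big_ord_recl -IH//= /lebesgue_rV_step /pushforward.
rewrite -product_measure1E//; first last.
- exact: (measurable_rV_box (fun i => mA (lift ord0 i))).
- exact: mA.
congr (product_measure1 _ _ _); apply/seteqP; split => -[t x] /=.
  move=> h; split => [|i]; first by have := h ord0; rewrite rV_cons0.
  by have := h (lift ord0 i); rewrite rV_consS.
move=> [h0 h] i; case: (unliftP ord0 i) => [j ->|->].
  by rewrite rV_consS.
by rewrite rV_cons0.
Qed.

End lebesgue_rV.

Section complex_valued.
Context {R : realType}.

Definition cmeasurable_fun d (T : measurableType d) (f : T -> R[i]) :=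
  measurable_fun setT (fun x => complex.Re (f x)) /\
  measurable_fun setT (fun x => complex.Im (f x)).

Definition cintegrable d (T : measurableType d)
    (mu : {measure set T -> \bar R}) (f : T -> R[i]) :=
  mu.-integrable setT (fun x => (complex.Re (f x))%:E) /\
  mu.-integrable setT (fun x => (complex.Im (f x))%:E).

Definition cintegral d (T : measurableType d)
    (mu : {measure set T -> \bar R}) (f : T -> R[i]) : R[i] :=
  Complex (\int[mu]_x complex.Re (f x)) (\int[mu]_x complex.Im (f x)).

Definition expi (t : R) : R[i] := Complex (cos t) (sin t).

(* Meaningful for s > 0, where the integrand is integrable. *)
Definition Gamma (s : R) : R :=
  \int[@lebesgue_measure R]_(t in `]0, +oo[) (t `^ (s - 1) * expR (- t)).

End complex_valued.

Section schwartz.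
Context {R : realType} {n : nat}.
Implicit Types (f : 'rV[R]_n -> R[i]) (x : 'rV[R]_n) (r s : seq 'I_n).

Definition dotp (x y : 'rV[R]_n) : R := \sum_(i < n) x ord0 i * y ord0 i.

(* The library norm on row vectors is the sup norm; |x| is the Euclidean
   norm. *)
Definition enorm x : R := Num.sqrt (\sum_(i < n) x ord0 i ^+ 2).

Definition cderivable f x (v : 'rV[R]_n) :=
  derivable (fun y => complex.Re (f y)) x v /\
  derivable (fun y => complex.Im (f y)) x v.

Definition partial (i : 'I_n) f : 'rV[R]_n -> R[i] := fun x =>
  Complex ('D_(delta_mx ord0 i) (fun y => complex.Re (f y)) x)
          ('D_(delta_mx ord0 i) (fun y => complex.Im (f y)) x).

(* Functions are complex valued but the variable is real, so that limits and
   derivatives are taken on the real and imaginary parts.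
   A multi-index is encoded as the list of the coordinates it involves, with
   repetition; its order is the size of the list. *)
Definition partials s f : 'rV[R]_n -> R[i] := foldr partial f s.

Definition monomial r x : R := \prod_(i <- r) x ord0 i.

Definition smooth f := forall s, [/\
  continuous (fun x => complex.Re (partials s f x)),
  continuous (fun x => complex.Im (partials s f x)) &
  forall i x, cderivable (partials s f) x (delta_mx ord0 i)].

Definition seminorm r s f : \bar R :=
  ereal_sup (range (fun x =>
    (Normc.normc ((monomial r x)%:C%C * partials s f x))%:E)).

Definition schwartz : set ('rV[R]_n -> R[i]) :=
  [set f | smooth f /\ forall r s, (seminorm r s f < +oo)%E].

Definition fourier f : 'rV[R]_n -> R[i] := fun k =>
  cintegral (lebesgue_rV n) (fun x => f x * expi (- (2 * pi * dotp x k))).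

End schwartz.

Section distributions.
Context {R : realType} {n : nat}.
Implicit Types (f g phi psi : 'rV[R]_n -> R[i]).

Definition functional : Type := ('rV[R]_n -> R[i]) -> R[i]^o.
HB.instance Definition _ := GRing.Lmodule.on functional.
HB.instance Definition _ := Choice.on functional.

(* A tempered distribution is a continuous linear form on the Schwartz space.
   It is represented by a functional on all functions that vanishes outside the
   Schwartz space, so that two distributions that agree on Schwartz functions
   are equal, and T (fourier phi) can be written directly. Continuity is
   continuity at 0 for the topology generated by the seminorms. *)
Definition tempered : set functional := [set T | [/\
  forall (a : R[i]) phi psi, schwartz phi -> schwartz psi ->
    T (fun x => a * phi x + psi x) = a * T phi + T psi,
  forall e : R, 0 < e -> exists (N : nat) (d : R), 0 < d /\
    forall phi, schwartz phi ->
      (forall r s : seq 'I_n, (size r <= N)%N -> (size s <= N)%N ->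
        (seminorm r s phi < d%:E)%E) ->
      Normc.normc (T phi) < e &
  forall phi, ~ schwartz phi -> T phi = 0]].

Definition dist_of g : functional := fun phi =>
  if `[< schwartz phi >] then cintegral (lebesgue_rV n) (fun x => g x * phi x)
  else 0.

(* The Fourier transform of T, phi |-> T (fourier phi), is the function g. *)
Definition is_fourier_of (T : functional) g :=
  cmeasurable_fun g /\
  forall phi, schwartz phi ->
    cintegrable (lebesgue_rV n) (fun k => g k * phi k) /\
    T (fourier phi) = cintegral (lebesgue_rV n) (fun k => g k * phi k).

(* Used for 0 <= 2 * alpha < n; the integrand is then |g(k)|^2 |k|^(2 alpha) for
   almost every k (x `^ 0 is 1, and 0 `^ a is 0 for a <> 0). *)
Definition dspace (alpha : R) : set functional := [set T |
  tempered T /\ exists2 g, is_fourier_of T g &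
    (\int[lebesgue_rV n]_k
      (Normc.normc (g k) ^+ 2 * enorm k `^ (2 * alpha))%:E < +oo)%E].

End distributions.
Arguments functional : clear implicits.

Section complex_linearity.
Context {R : realType}.
Implicit Types (a z w : R[i]).

Lemma ReaD a z w : complex.Re (a * z + w) =
  complex.Re a * complex.Re z - complex.Im a * complex.Im z + complex.Re w.
Proof. by case: a z w => [? ?] [? ?] [? ?]. Qed.

Lemma ImaD a z w : complex.Im (a * z + w) =
  complex.Re a * complex.Im z + complex.Im a * complex.Re z + complex.Im w.
Proof. by case: a z w => [? ?] [? ?] [? ?]. Qed.

Lemma normc_sqr z : Normc.normc z ^+ 2 = complex.Re z ^+ 2 + complex.Im z ^+ 2.
Proof. by case: z => u v /=; rewrite sqr_sqrtr// addr_ge0// sqr_ge0. Qed.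

Lemma normc_ge0 z : 0 <= Normc.normc z.
Proof. by case: z => ? ?; exact: sqrtr_ge0. Qed.

Lemma normc_sqr_le a z w : Normc.normc (a * z + w) ^+ 2 <=
  2 * Normc.normc a ^+ 2 * Normc.normc z ^+ 2 + 2 * Normc.normc w ^+ 2.
Proof.
rewrite !normc_sqr ReaD ImaD.
set A := complex.Re a; set B := complex.Im a.
set x := complex.Re z; set y := complex.Im z.
set u := complex.Re w; set v := complex.Im w.
rewrite -subr_ge0.
have -> : 2 * (A ^+ 2 + B ^+ 2) * (x ^+ 2 + y ^+ 2) + 2 * (u ^+ 2 + v ^+ 2) -
   ((A * x - B * y + u) ^+ 2 + (A * y + B * x + v) ^+ 2) =
   (A * x - B * y - u) ^+ 2 + (A * y + B * x - v) ^+ 2 by ring.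
by rewrite addr_ge0// sqr_ge0.
Qed.

Context d (T : measurableType d).
Implicit Types f g : T -> R[i].

Lemma cmeasurable_lin a f g : cmeasurable_fun f -> cmeasurable_fun g ->
  cmeasurable_fun (fun x => a * f x + g x).
Proof.
move=> [fr fi] [gr gi]; split.
  under eq_fun do rewrite ReaD.
  apply: measurable_funD => //; apply: measurable_funB;
    exact: measurable_funM.
under eq_fun do rewrite ImaD.
apply: measurable_funD => //; apply: measurable_funD; exact: measurable_funM.
Qed.

Lemma cmeasurable_normc f : cmeasurable_fun f ->
  measurable_fun setT (fun x => Normc.normc (f x) ^+ 2).
Proof.
move=> [fr fi]; under eq_fun do rewrite normc_sqr.
by apply: measurable_funD; exact: measurable_funX.
Qed.

Context (mu : {measure set T -> \bar R}).

Let integrable_comb (u v w : T -> R) (A B : R) :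
  mu.-integrable setT (EFin \o u) -> mu.-integrable setT (EFin \o v) ->
  mu.-integrable setT (EFin \o w) ->
  mu.-integrable setT (fun x => (A * u x + B * v x + w x)%:E) /\
  \int[mu]_x (A * u x + B * v x + w x) =
  A * \int[mu]_x u x + B * \int[mu]_x v x + \int[mu]_x w x.
Proof.
move=> iu iv iw.
have iAu : mu.-integrable setT (EFin \o (fun x => A * u x)).
  exact: (integrableZl measurableT A iu).
have iBv : mu.-integrable setT (EFin \o (fun x => B * v x)).
  exact: (integrableZl measurableT B iv).
have iAB : mu.-integrable setT (EFin \o (fun x => A * u x + B * v x)).
  exact: (integrableD measurableT iAu iBv).
split; first exact: (integrableD measurableT iAB iw).
by rewrite !RintegralD// !RintegralZl.
Qed.

Lemma cintegral_lin a f g : cintegrable mu f -> cintegrable mu g ->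
  cintegrable mu (fun x => a * f x + g x) /\
  cintegral mu (fun x => a * f x + g x) = a * cintegral mu f + cintegral mu g.
Proof.
move=> [fr fi] [gr gi].
have [ir er] := integrable_comb (complex.Re a) (- complex.Im a) fr fi gr.
have [ii ei] := integrable_comb (complex.Re a) (complex.Im a) fi fr gi.
split.
  split.
    under eq_fun do rewrite ReaD -mulNr.
    exact: ir.
  under eq_fun do rewrite ImaD.
  exact: ii.
rewrite /cintegral; case: a er ei {ir ii} => [A B] /= er ei.
congr Complex; rewrite /= ?ReaD ?ImaD/=.
  by rewrite -mulNr -er; apply: eq_Rintegral => x _; rewrite ReaD mulNr.
by rewrite -ei; apply: eq_Rintegral => x _; rewrite ImaD.
Qed.

Lemma cintegral_0 : cintegrable mu (fun=> 0) /\ cintegral mu (fun=> 0) = 0.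
Proof.
split; first by split; exact: integrable0.
by rewrite /cintegral !Rintegral_cst// !mul0r.
Qed.

End complex_linearity.

Section dspace_lmodule.
Context {R : realType} {n : nat}.
Implicit Types (T : functional R n) (a : R[i]).

Lemma tempered_lin a T1 T2 : tempered T1 -> tempered T2 ->
  tempered (a *: T1 + T2).
Proof.
move=> [l1 c1 z1] [l2 c2 z2]; split.
- move=> b phi psi Sphi Spsi; rewrite !fctE l1// l2//.
  rewrite /GRing.scale/=; ring.
- move=> e e0.
  have a0 : 0 < Normc.normc a + 1 by rewrite ltr_wpDl// normc_ge0.
  have e1 : 0 < e / 2 / (Normc.normc a + 1) by rewrite !divr_gt0.
  have e2 : 0 < e / 2 by rewrite divr_gt0.
  have [N1 [d1 [d10 H1]]] := c1 _ e1; have [N2 [d2 [d20 H2]]] := c2 _ e2.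
  exists (maxn N1 N2), (Num.min d1 d2); split; first by rewrite lt_min d10.
  move=> phi Sphi Hphi; rewrite !fctE.
  have {}H1 : Normc.normc (T1 phi) < e / 2 / (Normc.normc a + 1).
    apply: H1 => // r s rN sN.
    apply: (@lt_le_trans _ _ (Num.min d1 d2)%:E).
      by apply: Hphi; rewrite leq_max ?rN ?sN.
    by rewrite lee_fin ge_min lexx.
  have {}H2 : Normc.normc (T2 phi) < e / 2.
    apply: H2 => // r s rN sN.
    apply: (@lt_le_trans _ _ (Num.min d1 d2)%:E).
      by apply: Hphi; rewrite leq_max ?rN ?sN orbT.
    by rewrite lee_fin ge_min lexx orbT.
  apply: (le_lt_trans (le_normcD _ _)).
  rewrite (splitr e) ler_ltD// {H2} /GRing.scale/= Normc.normcM.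
  move: H1; rewrite ltr_pdivlMr// => /ltW; apply: le_trans.
  by rewrite mulrC ler_wpM2l// ?normc_ge0// lerDl.
- by move=> phi nS; rewrite !fctE z1// z2// scaler0 addr0.
Qed.

Lemma is_fourier_of_lin a T1 T2 g1 g2 : is_fourier_of T1 g1 ->
  is_fourier_of T2 g2 ->
  is_fourier_of (a *: T1 + T2) (fun k => a * g1 k + g2 k).
Proof.
move=> [m1 H1] [m2 H2]; split; first exact: cmeasurable_lin.
move=> phi Sphi; have [i1 e1] := H1 _ Sphi; have [i2 e2] := H2 _ Sphi.
have [i12 e12] := cintegral_lin a i1 i2.
have -> : (fun k => (a * g1 k + g2 k) * phi k) =
    (fun k => a * (g1 k * phi k) + g2 k * phi k).
  by apply/funext => k; rewrite mulrDl mulrA.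
by rewrite e12 !fctE e1 e2.
Qed.

Lemma measurable_enorm : measurable_fun setT (@enorm R n).
Proof.
apply: (@measurableT_comp _ _ _ _ _ _ (@Num.sqrt R)).
  apply: continuous_measurable_fun => x; exact: sqrt_continuous.
apply: measurable_sum => i; apply: measurable_funX.
exact: measurable_rV_coord.
Qed.

Lemma tempered0 : tempered (0 : functional R n).
Proof.
split => //.
- by move=> a phi psi _ _; rewrite mulr0 addr0.
- move=> e e0; exists 0%N, 1; split => // phi _ _.
  by rewrite Normc.normc0.
Qed.

Lemma dspace0 (alpha : R) : dspace alpha (0 : functional R n).
Proof.
split; first exact: tempered0.
exists (fun=> 0).
  split; first by split; exact: measurable_cst.
  move=> phi _.
  have -> : (fun k => 0 * phi k) = (fun=> 0).
    by apply/funext => k; rewrite mul0r.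
  have [i0 e0] := @cintegral_0 R _ _ (lebesgue_rV n).
  by rewrite e0.
rewrite integral0_eq// => k _.
by rewrite Normc.normc0 expr0n mul0r.
Qed.

Lemma dspace_lin (alpha : R) a T1 T2 : dspace alpha T1 -> dspace alpha T2 ->
  dspace alpha (a *: T1 + T2).
Proof.
move=> [t1 [g1 F1 L1]] [t2 [g2 F2 L2]]; split; first exact: tempered_lin.
exists (fun k => a * g1 k + g2 k); first exact: is_fourier_of_lin.
have [m1 _] := F1; have [m2 _] := F2.
pose w k : R := @enorm R n k `^ (2 * alpha).
have mw : measurable_fun setT w.
  apply: (@measurableT_comp _ _ _ _ _ _ ((@powR R)^~ (2 * alpha))).
    exact: measurable_powR.
  exact: measurable_enorm.
pose c := 2 * Normc.normc a ^+ 2.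
apply: (@le_lt_trans _ _ (\int[lebesgue_rV n]_k
  (c%:E * (Normc.normc (g1 k) ^+ 2 * w k)%:E +
   2%:E * (Normc.normc (g2 k) ^+ 2 * w k)%:E))%E).
  apply: ge0_le_integral => //.
  - by move=> k _; rewrite lee_fin mulr_ge0// ?exprn_ge0 ?normc_ge0 ?powR_ge0.
  - apply/measurable_EFinP; apply: measurable_funM => //.
    by apply: cmeasurable_normc; exact: cmeasurable_lin.
  - apply/measurable_EFinP; apply: measurable_funD.
      apply: measurable_funM => //; apply: measurable_funM => //.
      exact: cmeasurable_normc.
    apply: measurable_funM => //; apply: measurable_funM => //.
    exact: cmeasurable_normc.
  - move=> k _; rewrite -!EFinM -EFinD lee_fin.
    set p := Normc.normc _ ^+ 2; set q := Normc.normc _ ^+ 2.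
    set r := Normc.normc _ ^+ 2.
    have -> : c * (q * w k) + 2 * (r * w k) = (c * q + 2 * r) * w k by ring.
    by rewrite ler_wpM2r ?powR_ge0//; exact: normc_sqr_le.
have pos g k : (0 <= (Normc.normc (g k : R[i]) ^+ 2 * w k)%:E)%E.
  by rewrite lee_fin mulr_ge0// ?exprn_ge0 ?normc_ge0 ?powR_ge0.
have mg g : cmeasurable_fun g ->
    measurable_fun setT (fun k => (Normc.normc (g k) ^+ 2 * w k)%:E).
  move=> mg; apply/measurable_EFinP; apply: measurable_funM => //.
  exact: cmeasurable_normc.
have c0 : 0 <= c by rewrite mulr_ge0// exprn_ge0// normc_ge0.
rewrite ge0_integralD//.
- rewrite !ge0_integralZl//; [|exact: mg..].
  rewrite lte_add_pinfty// lte_mul_pinfty//.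
- by move=> k _; rewrite mule_ge0.
- by apply: measurable_funeM; exact: mg.
- by move=> k _; rewrite mule_ge0.
- by apply: measurable_funeM; exact: mg.
Qed.

End dspace_lmodule.

Section dspace_type.
Context {R : realType} {n : nat}.

Definition dspace_pred (alpha : R) : {pred functional R n} :=
  fun T => `[< dspace alpha T >].

Lemma dspace_submod_closed alpha : GRing.submod_closed (dspace_pred alpha).
Proof.
split; first exact/asboolP/dspace0.
by move=> a T1 T2 /asboolP D1 /asboolP D2; exact/asboolP/dspace_lin.
Qed.

HB.instance Definition _ alpha := GRing.isSubmodClosed.Build R[i]
  (functional R n) (dspace_pred alpha)
  (GRing.submod_closed_semi (dspace_submod_closed alpha)).

Record dspaceType (alpha : R) := DSpace {
  dspace_val :> functional R n;
  _ : dspace_val \in dspace_pred alpha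
}.

HB.instance Definition _ alpha := [isSub for @dspace_val alpha].
HB.instance Definition _ alpha := [Choice of dspaceType alpha by <:].
HB.instance Definition _ alpha :=
  [SubChoice_isSubLmodule of dspaceType alpha by <:].

(* The function representing the Fourier transform of T; it is determined up to
   a null set. *)
Definition fourier_fun (T : functional R n) : 'rV[R]_n -> R[i] :=
  xget (fun=> 0) [set g | is_fourier_of T g].

Definition dnorm alpha (f : dspaceType alpha) : R :=
  Num.sqrt (\int[lebesgue_rV n]_k
    (Normc.normc (fourier_fun f k) ^+ 2 * enorm ((2 * pi) *: k) `^ (2 * alpha))).

End dspace_type.
Arguments dspaceType : clear implicits.

Section trace.
Context {R : realType} {n m : nat} (le_mn : (m <= n)%N).

(* R^n identified with R^(n-m) x R^m. *)
Definition join_rV (x : 'rV[R]_(n - m)) (y : 'rV[R]_m) : 'rV[R]_n :=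
  castmx (erefl, subnK le_mn) (row_mx x y).

Definition trace (f : 'rV[R]_n -> R[i]) : 'rV[R]_(n - m) -> R[i] :=
  fun x => f (join_rV x 0).

(* dist_of phi is the distribution of a Schwartz function phi: the last clause
   says that the Schwartz functions lie in the domain of tau and that tau maps
   phi to trace phi. *)
Definition bounded_trace_extension {alpha beta : R}
    (tau : dspaceType R n alpha -> dspaceType R (n - m) beta) := [/\
  linear tau,
  exists M : R, forall f, dnorm (tau f) <= M * dnorm f &
  forall phi, schwartz phi -> exists2 f : dspaceType R n alpha,
    f = dist_of phi :> functional R n &
    tau f = dist_of (trace phi) :> functional R (n - m)].

End trace.

(* Main.v *)
(* In the Fourier variables k = (k1, k2) the trace is integration over k2: the
   Fourier transform of tau f is h(k1) = \int fhat(k1, k2) dk2, by Fourier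
   inversion when f is a Schwartz function. On the slice through k1, write
   g = fhat(k1, .) and take the inner product with weight |k|^(2 alpha). Then
   h(k1) is the inner product of g with |k|^(-2 alpha), whose squared norm is
   the beta integral
     \int |k|^(-2 alpha) dk2 = A |k1|^(m - 2 alpha),
     A = pi^(m/2) Gamma(alpha - m/2) / Gamma(alpha).
   Pythagoras gives
     \int |g|^2 |k|^(2 alpha) dk2
       = |h(k1)|^2 |k1|^(2 alpha - m) / A + \int |r|^2 |k|^(2 alpha) dk2,
   where r is the component of g orthogonal to |k|^(-2 alpha). Integrated over
   k1, this is the inequality with its constant; equality holds exactly when
   r = 0 almost everywhere, and such f exist. Two bounded extensions agree since
   the Schwartz functions are dense, and the function representing the Fourier
   transform of a distribution is unique almost everywhere since the indicators
   of boxes are dominated limits of Schwartz functions. *)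
Require Import Defs.
From mathcomp Require Import all_boot all_order all_algebra.
From mathcomp Require Import all_classical all_reals all_analysis.
From mathcomp Require Import measurable_realfun complex ring lra.

Set Implicit Arguments.
Unset Strict Implicit.
Unset Printing Implicit Defensive.

Import Order.TTheory GRing.Theory Num.Theory.
Import numFieldNormedType.Exports.

Local Open Scope classical_set_scope.
Local Open Scope ring_scope.

(** * Lebesgue measure on row vectors *)

(** The operator is not obtained by completion: it is defined on every element of the space by
    integrating its Fourier transform over the slices, and density serves uniqueness alone. So every
    function of finite weighted norm, on R^n and on R^(n-m), must define a tempered distribution.
    This is where [alpha < n / 2] enters: [|k|^(-2 alpha)] is then locally integrable, and Young's
    inequality bounds [|g|] times a decaying function by [|g|^2 |k|^(2 alpha)] plus an integrable
    term. The bound [m / 2 < alpha] makes the slice integral converge at infinity. Decay is measured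
    by the product of the [1 / (1 + x_i^2)] and not by a radial function, so that integrals over R^n
    factor into one-dimensional ones. The norms carry the weight [|2 pi k|], so lowering the
    exponent from [2 alpha] to [2 alpha - m] divides A by [(2 pi)^m], and [A / (2 pi)^m] is the
    constant of the theorem. The Pythagorean identity is kept exact to the end: the inequality, its
    sharpness and the equality case are three readings of it. *)

Lemma rV_cons_affine (R : realType) n (a t b : R) (x y : 'rV[R]_n) :
  a *: rV_cons (t, x) + rV_cons (b, y) = rV_cons (a * t + b, a *: x + y).
Proof.
apply/rowP => i.
transitivity (a * rV_cons (t, x) ord0 i + rV_cons (b, y) ord0 i).
  by rewrite [LHS]mxE [X in X + _]mxE.
case: (unliftP ord0 i) => [j ->|->]; last by rewrite !rV_cons0.
by rewrite !rV_consS !mxE.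
Qed.

Section lebesgue_rV_integral.
Context {R : realType}.
Local Open Scope ereal_scope.

(** Change of variables for the image measure, then Tonelli. Every induction on the dimension goes
    through this step. *)
Lemma ge0_integral_rV_cons n (f : 'rV[R]_n.+1 -> \bar R) :
  measurable_fun setT f -> (forall x, 0 <= f x) ->
  \int[lebesgue_rV n.+1]_x f x =
  \int[@lebesgue_measure R]_t \int[lebesgue_rV n]_x f (rV_cons (t, x)).
Proof.
move=> mf f0.
have := @ge0_integral_pushforward _ _ _ _ R _ (@measurable_rV_cons R n)
  (@lebesgue_measure R \x lebesgue_rV n) setT f measurableT mf (fun x _ => f0 x).
rewrite preimage_setT => ->.
rewrite fubini_tonelli1//; last by move=> z; exact: f0.
by apply: measurableT_comp => //; exact: measurable_rV_cons.
Qed.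

Lemma measurable_rV_consr n (t : R) :
  measurable_fun setT (fun x : 'rV[R]_n => rV_cons (t, x)).
Proof.
apply: (measurableT_comp (@measurable_rV_cons R n)).
exact: pair1_measurable.
Qed.

Lemma measurable_fun_rV0 d (T : measurableType d) (f : 'rV[R]_0 -> T) :
  measurable_fun setT f.
Proof.
rewrite (_ : f = cst (f 0%R)); first exact: measurable_cst.
by apply/funext => x /=; congr f; exact: thinmx0.
Qed.

(** This is [join_rV] with an arbitrary proof [e] of [p + q = n]: such an equality can be
    destructed, whereas in [n - m + m = n] the variable [n] occurs on both sides. *)
Definition rV_cat p q n (e : (p + q = n)%N) (x : 'rV[R]_p) (y : 'rV[R]_q) :
  'rV[R]_n := castmx (erefl, e) (row_mx x y).

Lemma rV_catE p q x y : rV_cat (erefl (p + q)%N) x y = row_mx x y.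
Proof. by rewrite /rV_cat castmx_id. Qed.

Lemma rV_cat_l p q n (e : (p + q = n)%N) x y (i : 'I_p) :
  rV_cat e x y ord0 (cast_ord e (lshift q i)) = x ord0 i.
Proof. by case: n / e; rewrite rV_catE cast_ord_id row_mxEl. Qed.

Lemma rV_cons_row_mx p q t (x : 'rV[R]_p) (y : 'rV[R]_q) :
  rV_cons (t, row_mx x y) = row_mx (rV_cons (t, x)) y.
Proof.
apply/rowP => i; case: (@split_ordP p.+1 q i) => j ->.
  rewrite (row_mxEl (rV_cons (t, x))); case: (unliftP ord0 j) => [k ->|->].
    rewrite rV_consS (_ : lshift q (lift ord0 k) = lift ord0 (lshift q k)).
      by rewrite rV_consS row_mxEl.
    exact/val_inj.
  rewrite rV_cons0 (_ : lshift q ord0 = ord0) ?rV_cons0//.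
  exact/val_inj.
rewrite (row_mxEr (rV_cons (t, x))) (_ : rshift p.+1 j = lift ord0 (rshift p j)).
  by rewrite rV_consS row_mxEr.
exact/val_inj.
Qed.

Lemma measurable_rV_cat p q n (e : (p + q = n)%N) :
  measurable_fun setT (fun z : 'rV[R]_p * 'rV[R]_q => rV_cat e z.1 z.2).
Proof.
case: n / e; apply: measurable_fun_rVP => i.
case: (split_ordP i) => j ->.
  under eq_fun do rewrite rV_catE row_mxEl.
  exact: (measurableT_comp (@measurable_rV_coord _ R p j)).
under eq_fun do rewrite rV_catE row_mxEr.
exact: (measurableT_comp (@measurable_rV_coord _ R q j)).
Qed.

Lemma ge0_integral_rV_cat p q n (e : (p + q = n)%N) (f : 'rV[R]_n -> \bar R) :
  measurable_fun setT f -> (forall x, 0 <= f x) ->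
  \int[lebesgue_rV n]_x f x =
  \int[lebesgue_rV p]_x \int[lebesgue_rV q]_y f (rV_cat e x y).
Proof.
case: n / e f => f.
under [X in _ -> _ -> _ = X]eq_integral do
  under eq_integral do rewrite rV_catE.
elim: p f => [|p IH] f mf f0.
  rewrite integral_dirac//; last exact: measurable_fun_rV0.
  rewrite diracT mul1e; apply: eq_integral => x _; congr f.
  apply/rowP => j; have -> : j = rshift 0 j by exact/val_inj.
  by rewrite row_mxEr; congr (x _ _); exact/val_inj.
rewrite [LHS]ge0_integral_rV_cons//.
rewrite [RHS]ge0_integral_rV_cons.
- apply: eq_integral => t _.
  rewrite (IH (fun z => f (rV_cons (t, z)))); last by move=> z; exact: f0.
    apply: eq_integral => x _; apply: eq_integral => y _.
    by rewrite rV_cons_row_mx.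
  by apply: measurableT_comp => //; exact: measurable_rV_consr.
- have m2 : measurable_fun setT
      (fun z : 'rV[R]_p.+1 * 'rV[R]_q => f (row_mx z.1 z.2)).
    apply: measurableT_comp => //.
    under eq_fun do rewrite -rV_catE; exact: measurable_rV_cat.
  have := @measurable_fun_fubini_tonelli_F _ _ _ _ R (lebesgue_rV q) _ m2 (fun z => f0 _).
  exact.
- by move=> x; apply: integral_ge0 => y _.
Qed.

(** Tonelli for an indicator. It carries null sets of R^n over to the product space in which the
    equality case is stated. *)
Lemma lebesgue_rV_cat p q n (e : (p + q = n)%N) (A : set 'rV[R]_n) :
  measurable A -> lebesgue_rV n A =
  (lebesgue_rV p \x lebesgue_rV q)%E
    ((fun z : 'rV[R]_p * 'rV[R]_q => rV_cat e z.1 z.2) @^-1` A).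
Proof.
move=> mA; rewrite -[in LHS](setIT A) -integral_indic//.
rewrite (ge0_integral_rV_cat e) ?setIT//; last first.
  exact/measurable_EFinP/measurable_indic.
have mB : measurable ((fun z : 'rV[R]_p * 'rV[R]_q => rV_cat e z.1 z.2) @^-1` A).
  by rewrite -[X in measurable X]setTI; exact: measurable_rV_cat.
rewrite -[X in _ = _ X]setIT -integral_indic// fubini_tonelli1//; last first.
  exact/measurable_EFinP/measurable_indic.
Qed.

(** By uniqueness of Lebesgue measure: [a] times its image under the affine map gives half-open
    intervals their length. *)
Lemma lebesgue_measure_affine (a b : R) (A : set R) : (0 < a)%R ->
  measurable A ->
  lebesgue_measure ((fun x => a * x + b)%R @^-1` A) =
  (a^-1)%:E * lebesgue_measure A.
Proof.
move=> a0 mA.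
pose phi (x : measurableTypeR R) : measurableTypeR R := (a * x + b)%R.
have mphi : measurable_fun setT phi.
  by apply: measurable_funD => //; exact: measurable_funM.
have ap : (0 <= a)%R by exact: ltW.
pose m0 := (measure_function_pushforward__canonical__measure_function_Measure
    (@lebesgue_measure R) mphi).
pose m := mscale (NngNum ap) m0.
have /(_ m)/(_ _ A mA) -> := @lebesgue_measure_unique R.
  by rewrite /m /mscale/= muleA -EFinM mulVf ?gt_eqF// mul1e.
move=> _ [[u v]] _ <-.
transitivity (a%:E * lebesgue_measure (phi @^-1` [set` `]u, v]])); last by [].
have -> : phi @^-1` [set` `]u, v]] = [set` `](((u - b) / a)%R : R), (((v - b) / a)%R : R)]].
  apply/seteqP; split => x; rewrite /phi /= !in_itv/=;
    by rewrite ltr_pdivrMr// ler_pdivlMr// ltrBlDr lerBrDr ![(x * _)%R]mulrC.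
rewrite !lebesgue_measure_itv/= !lte_fin.
rewrite ltr_pM2r ?invr_gt0// ltrD2r; case: ifPn => uv; last by rewrite mule0.
by rewrite -EFinB -EFinM; congr EFin; field; rewrite gt_eqF.
Qed.

Lemma ge0_integral_lebesgue_affine (a b : R) (f : R -> \bar R) : (0 < a)%R ->
  measurable_fun setT f -> (forall x, 0 <= f x) ->
  \int[@lebesgue_measure R]_x f (a * x + b)%R =
  (a^-1)%:E * \int[@lebesgue_measure R]_x f x.
Proof.
move=> a0 mf f0.
pose phi (x : measurableTypeR R) : measurableTypeR R := (a * x + b)%R.
have mphi : measurable_fun setT phi.
  by apply: measurable_funD => //; exact: measurable_funM.
have a1 : (0 <= a^-1)%R by rewrite invr_ge0 ltW.
have := @ge0_integral_pushforward _ _ _ _ R _ mphi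
  (@lebesgue_measure R) setT f measurableT mf (fun x _ => f0 x).
rewrite preimage_setT => <-.
rewrite -(@ge0_integral_mscale _ _ _ (@lebesgue_measure R) _ measurableT (NngNum a1))//.
by apply: eq_measure_integral => A mA _; exact: lebesgue_measure_affine.
Qed.

Lemma measurable_rV_affine n (a : R) (b : 'rV[R]_n) :
  measurable_fun setT (fun x : 'rV[R]_n => (a *: x + b)%R).
Proof.
apply: measurable_fun_rVP => i; under eq_fun do rewrite !mxE.
apply: measurable_funD => //; apply: measurable_funM => //.
exact: measurable_rV_coord.
Qed.

Lemma ge0_integral_rV_affine n (a : R) (b : 'rV[R]_n) (f : 'rV[R]_n -> \bar R) :
  (0 < a)%R -> measurable_fun setT f -> (forall x, 0 <= f x) ->
  \int[lebesgue_rV n]_x f (a *: x + b)%R =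
  (a^-1 ^+ n)%:E * \int[lebesgue_rV n]_x f x.
Proof.
move=> a0; elim: n b f => [|n IH] b f mf f0.
  rewrite !integral_dirac//; [|exact: measurable_fun_rV0..].
  by rewrite diracT !mul1e; congr f; exact: thinmx0.
have mfab : measurable_fun setT (fun x : 'rV[R]_n.+1 => f (a *: x + b)%R).
  by apply: measurableT_comp => //; exact: measurable_rV_affine.
rewrite [LHS]ge0_integral_rV_cons//.
have [b0 [b1 ->]] : exists b0 b1, b = rV_cons (b0, b1).
  by exists (rV_uncons b).1, (rV_uncons b).2; rewrite -surjective_pairing rV_unconsK.
transitivity (\int[@lebesgue_measure R]_t
    ((a^-1 ^+ n)%:E * \int[lebesgue_rV n]_x f (rV_cons ((a * t + b0)%R, x)))).
  apply: eq_integral => t _.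
  rewrite -(IH b1 (fun x => f (rV_cons ((a * t + b0)%R, x))))//.
    by apply: eq_integral => x _; rewrite rV_cons_affine.
  by apply: measurableT_comp => //; exact: measurable_rV_consr.
rewrite ge0_integralZl//.
- rewrite (@ge0_integral_lebesgue_affine a b0 (fun t => \int[lebesgue_rV n]_x f (rV_cons (t, x))))//.
  + by rewrite [in RHS]ge0_integral_rV_cons// muleA -EFinM -exprSr.
  + exact: (@measurable_fun_fubini_tonelli_F _ _ _ _ R (lebesgue_rV n) _
      (measurableT_comp mf (@measurable_rV_cons R n)) (fun z => f0 _)).
  + by move=> t; exact: integral_ge0.
- apply: (measurableT_comp (f := fun t : measurableTypeR R => \int[lebesgue_rV n]_x f (rV_cons (t, x)))
     (g := fun t : measurableTypeR R => (a * t + b0)%R : measurableTypeR R)).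
    exact: (@measurable_fun_fubini_tonelli_F _ _ _ _ R (lebesgue_rV n) _
      (measurableT_comp mf (@measurable_rV_cons R n)) (fun z => f0 _)).
  by apply: measurable_funD => //; exact: measurable_funM.
- by move=> t _; exact: integral_ge0.
- by rewrite lee_fin exprn_ge0// invr_ge0 ltW.
Qed.

Lemma ge0_integral_rV_prod n (u : 'I_n -> R -> R) :
  (forall i, measurable_fun setT (u i)) -> (forall i x, (0 <= u i x)%R) ->
  \int[lebesgue_rV n]_x (\prod_(i < n) u i (x ord0 i))%:E =
  \prod_(i < n) \int[@lebesgue_measure R]_t (u i t)%:E.
Proof.
elim: n u => [|n IH] u mu u0.
  rewrite integral_dirac//; last exact: measurable_fun_rV0.
  by rewrite diracT mul1e !big_ord0.
have mprod : measurable_fun setT (fun x : 'rV[R]_n.+1 => (\prod_(i < n.+1) u i (x ord0 i))%:E).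
  apply/measurable_EFinP; apply: measurable_prod => i _.
  apply: measurableT_comp => //; exact: measurable_rV_coord.
rewrite ge0_integral_rV_cons//; last by move=> x; rewrite lee_fin prodr_ge0.
have mprod' : measurable_fun setT (fun x : 'rV[R]_n => (\prod_(i < n) u (lift ord0 i) (x ord0 i))%:E).
  apply/measurable_EFinP; apply: measurable_prod => i _.
  apply: measurableT_comp => //; exact: measurable_rV_coord.
transitivity (\int[@lebesgue_measure R]_t
    ((\prod_(i < n) \int[@lebesgue_measure R]_t (u (lift ord0 i) t)%:E) * (u ord0 t)%:E)).
  apply: eq_integral => t _; rewrite muleC -(IH (fun i => u (lift ord0 i)))//.
  rewrite -ge0_integralZl//; last 2 first.
  - by move=> x _; rewrite lee_fin prodr_ge0.
  - by rewrite lee_fin.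
  apply: eq_integral => x _; rewrite big_ord_recl rV_cons0 EFinM.
  by under eq_bigr do rewrite rV_consS.
rewrite ge0_integralZl//.
- by rewrite big_ord_recl muleC.
- by apply: (measurableT_comp _ (mu ord0)).
- by move=> t _; rewrite lee_fin.
- by apply: prode_ge0 => i _; apply: integral_ge0 => x _; rewrite lee_fin.
Qed.

End lebesgue_rV_integral.

(** * Open sets, continuous functions and coordinate hyperplanes *)

Section borel_rV.
Context {R : realType} {n : nat}.

(** An open set is the union of the boxes with rational centre and half-side [1 / (k + 1)] that it
    contains, and there are countably many of them. *)
Lemma open_measurable_rV (A : set 'rV[R]_n) : open A -> measurable A.
Proof.
move=> oA.
pose box (p : 'rV[rat]_n * nat) := [set x : 'rV[R]_n | forall i : 'I_n,
  x ord0 i \in `](ratr (p.1 ord0 i) - p.2.+1%:R^-1), (ratr (p.1 ord0 i) + p.2.+1%:R^-1)[].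
pose F p := if `[< box p `<=` A >] then box p else set0.
have -> : A = \bigcup_p F p.
  apply/seteqP; split => [x Ax|x [p _]]; last first.
    by rewrite /F; case: asboolP => // h /h.
  have /nbhs_ballP[e /= e0 xeA] : nbhs x A by exact: open_nbhs_nbhs.
  (* Half-side below [e / 2]: the rational centre is within one half-side of [x], and each point of
     the box within one half-side of the centre. *)
  pose k := Num.truncn (2 / e); have k0 : 0 < k.+1%:R^-1 :> R by rewrite invr_gt0.
  have ke : k.+1%:R^-1 < e / 2.
    by rewrite -[ltRHS]invrK ltf_pV2 ?posrE ?invr_gt0 ?divr_gt0// invf_div truncnS_gt.
  have [q qx] : {q : 'rV[rat]_n | forall i, ratr (q ord0 i) \in
      `](x ord0 i - k.+1%:R^-1), (x ord0 i + k.+1%:R^-1)[}.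
    have H i : {q : rat | ratr q \in `](x ord0 i - k.+1%:R^-1), (x ord0 i + k.+1%:R^-1)[}.
      by apply/cid/rat_in_itvoo; rewrite ltrBlDr -addrA ltrDl addr_gt0.
    by exists (\row_i sval (H i)) => i; rewrite mxE; case: (H i).
  exists (q, k) => //; rewrite /F; case: asboolP => [_ i|[]].
    move: (qx i); rewrite !in_itv/= => /andP[h1 h2].
    by move: (ratr _) (k.+1%:R^-1) h1 h2 => r c h1 h2; apply/andP; split; lra.
  move=> y yb; apply: xeA; split => // i j; rewrite /ball/= (ord1 i).
  move: (qx j) (yb j); rewrite !in_itv/= => /andP[h1 h2] /andP[h3 h4].
  move: (ratr _) (k.+1%:R^-1) ke h1 h2 h3 h4 => r c ke h1 h2 h3 h4.
  by rewrite ltr_norml; apply/andP; split; lra.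
apply: countable_bigcupT_measurable => [|p]; first exact: countableP.
rewrite /F; case: asboolP => // _.
exact: (@measurable_rV_box _ R n (fun i => `](ratr (p.1 ord0 i) - p.2.+1%:R^-1), (ratr (p.1 ord0 i) + p.2.+1%:R^-1)[%classic)).
Qed.

Lemma continuous_measurable_rV (f : 'rV[R]_n -> R) :
  continuous f -> measurable_fun setT f.
Proof.
move=> /continuousP cf; apply: (measurability _ (RGenOpens.measurableE R)).
move=> _ [_ [a [b ->] <-]]; rewrite setTI; apply: open_measurable_rV.
exact/cf/interval_open.
Qed.

(** A coordinate hyperplane is a box with one side reduced to a point, and that side has measure
    0. *)
Lemma ae_coord_neq0 :
  {ae lebesgue_rV n, forall x : 'rV[R]_n, forall i, x ord0 i != 0}.
Proof.
apply: filter_forall => i.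
exists [set x : 'rV[R]_n | x ord0 i = 0]; split.
- by have := @measurable_rV_coord _ R n i measurableT [set 0] (measurable_set1 _); rewrite setTI.
- pose A j : set R := if j == i then [set 0] else setT.
  rewrite (_ : [set x | _] = [set x : 'rV[R]_n | forall j, A j (x ord0 j)]).
    rewrite lebesgue_rV_box.
      by rewrite (bigD1 i)//= /A eqxx lebesgue_measure_set1 mul0e.
    by move=> j; rewrite /A; case: ifP.
  apply/seteqP; split => x /= => [xi j|/(_ i)]; last by rewrite /A eqxx.
  by rewrite /A; case: ifPn => // /eqP ->.
- by move=> x /= /negP; rewrite negbK => /eqP.
Qed.

End borel_rV.

(** * One-dimensional integrals with a power singularity at the origin *)

Section integrals_1d.
Context {R : realType}.
Local Notation mu := (@lebesgue_measure R).

(** The fundamental theorem of calculus away from 0, where the power is differentiable, then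
    monotone convergence. *)
Lemma integral_powR_itv01 (s : R) : 0 < s ->
  (\int[mu]_(t in `]0%R, 1%R]) (t `^ (s - 1))%:E <= (s^-1)%:E)%E.
Proof.
move=> s0.
have mp : measurable_fun setT (fun t : R => (t `^ (s - 1))%:E).
  by apply/measurable_EFinP; exact: measurable_powR.
(* With [k.+2] the left endpoint is strictly below 1, even for [k = 0]. *)
pose F k : set (measurableTypeR R) := `[k.+2%:R^-1, 1]%classic.
have FE : `]0, 1]%classic = \bigcup_k F k.
  apply/seteqP; split => [t|t [k _]]; rewrite /F /= !in_itv/=.
    move=> /andP[t0 t1]; exists (Num.truncn t^-1) => //=; rewrite in_itv/= t1 andbT.
    rewrite -[leRHS]invrK lef_pV2 ?posrE ?invr_gt0//.
    by apply: (le_trans (ltW (truncnS_gt _))); rewrite ler_nat.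
  by move=> /andP[kt ->]; rewrite andbT (lt_le_trans _ kt)// invr_gt0.
have ndF : nondecreasing_seq F.
  move=> a b ab; apply/subsetPset => t; rewrite /F/= !in_itv/= => /andP[at1 ->].
  rewrite andbT (le_trans _ at1)// lef_pV2 ?posrE// ler_nat; exact: ab.
rewrite FE; have cvgF := @ge0_nondecreasing_set_cvg_integral _ _ R F _ mu ndF
  (fun i => measurable_itv _) (fun i => measurable_funTS mp) (fun i x _ => powR_ge0 x (s - 1)).
rewrite -(cvg_lim _ cvgF)//; apply: lime_le; first by apply/cvg_ex; eexists; exact: cvgF.
apply: nearW => k; rewrite /F.
have k1 : k.+2%:R^-1 < 1 :> R by rewrite invf_lt1// ltr1n.
have k0 : 0 < k.+2%:R^-1 :> R by rewrite invr_gt0.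
have dpos (r t : R) : 0 < t -> derivable (fun u => u `^ r) t 1.
  by move=> t0; apply: derivable_powR; rewrite in_itv/= andbT.
have cpos (r t : R) : 0 < t -> {for t, continuous (fun u => u `^ r)}.
  by move=> t0; apply/differentiable_continuous/derivable1_diffP/dpos.
rewrite (@continuous_FTC2 _ _ (fun t => t `^ s / s)).
- by rewrite powR1 mul1r -EFinB lee_fin gerBl divr_ge0// ?powR_ge0// ltW.
- exact: k1.
- apply: continuous_in_subspaceT => t; rewrite inE/= in_itv/= => /andP[kt _].
  by apply: cpos; rewrite (lt_le_trans k0).
- split => [t| |].
  + rewrite in_itv/= => /andP[kt _]; apply: derivableM => //.
    by apply: dpos; rewrite (lt_trans k0).
  + apply: cvg_at_right_filter; apply: cvgM; last exact: cvg_cst.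
    exact: cpos.
  + apply: cvg_at_left_filter; apply: cvgM; last exact: cvg_cst.
    exact: cpos.
- move=> t; rewrite in_itv/= => /andP[kt _]; have t0 : 0 < t by rewrite (lt_trans k0).
  rewrite derive1E deriveM//; last exact: dpos.
  have h := is_derive1_powR s t0.
  rewrite derive_cst scaler0 add0r derive_val /GRing.scale/= mulrA mulVf ?mul1r//.
  by rewrite gt_eqF.
Qed.

(** On []0, 1]] the power is integrable because [s < 1]; beyond 1 it is at most 1 and the second
    factor is integrable. The negative half-line follows by reflection. *)
Lemma integral_onem_powRN (s : R) : 0 <= s < 1 ->
  (\int[mu]_t (`|t| `^ (- s) * (1 + t ^+ 2)^-1)%:E < +oo)%E.
Proof.
move=> /andP[s0 s1].
have ss : 0 < 1 - s by rewrite subr_gt0.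
pose v (t : R) := `|t| `^ (- s).
have mv : measurable_fun setT v.
  by apply: (measurableT_comp (measurable_powR _)); exact: normr_measurable.
have mq : measurable_fun setT (fun t : R => (1 + t ^+ 2)^-1).
  by apply: continuous_measurable_fun; exact: continuous_oneDsqrV.
have q1 (t : R) : 0 < 1 + t ^+ 2 by rewrite ltr_pwDl// sqr_ge0.
pose I := (\int[mu]_(t in `[0%R, +oo[) (v t * (1 + t ^+ 2)^-1)%:E)%E.
have I_lty : (I < +oo)%E.
  rewrite /I -integral_itv_obnd_cbnd; last first.
    by apply/measurable_EFinP/measurable_funTS; exact: measurable_funM.
  have -> : `]0%R, +oo[%classic = `]0%R, 1%R]%classic `|` `]1%R, +oo[%classic :> set R.
    by rewrite -itv_bndbnd_setU// bnd_simp.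
  rewrite ge0_integral_setU//=; last 3 first.
  - by apply/measurable_EFinP/measurable_funTS; exact: measurable_funM.
  - by move=> t _; rewrite lee_fin mulr_ge0 ?powR_ge0// invr_ge0 ltW.
  - apply/disj_setPS => t [] /=; rewrite !in_itv/= andbT => /andP[_ t1].
    by rewrite ltNge t1.
  apply: lte_add_pinfty.
    apply: le_lt_trans (ltry _); apply: (le_trans _ (integral_powR_itv01 ss)).
    apply: ge0_le_integral => //.
    + by move=> t _; rewrite lee_fin mulr_ge0 ?powR_ge0// invr_ge0 ltW.
    + by apply/measurable_EFinP/measurable_funTS; exact: measurable_funM.
    + by apply/measurable_EFinP/measurable_funTS; exact: measurable_powR.
    + move=> t; rewrite /= in_itv/= => /andP[t0 _]; rewrite lee_fin /v gtr0_norm//.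
      rewrite (_ : 1 - s - 1 = - s); last by ring.
      by rewrite ler_piMr ?powR_ge0// invf_le1// lerDl sqr_ge0.
  apply: (@le_lt_trans _ _ (\int[mu]_(t in `[0%R, +oo[) ((1 + t ^+ 2)^-1)%:E)%E); last first.
    by have := @integral0y_oneDsqr R; rewrite /oneDsqr => ->; exact: ltry.
  apply: (@le_trans _ _ (\int[mu]_(t in `]1%R, +oo[) ((1 + t ^+ 2)^-1)%:E)%E).
    apply: ge0_le_integral => //.
    + by move=> t _; rewrite lee_fin mulr_ge0 ?powR_ge0// invr_ge0 ltW.
    + by apply/measurable_EFinP/measurable_funTS; exact: measurable_funM.
    + by apply/measurable_EFinP/measurable_funTS.
    + move=> t; rewrite /= in_itv/= andbT => t1; rewrite lee_fin ler_piMl ?invr_ge0 ?(ltW (q1 _))//.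
      have t0 : 0 < t by exact: lt_trans t1.
      rewrite /v gtr0_norm// powRN invf_le1 ?powR_gt0//.
      by rewrite -(powRr0 t) ler_powR// ltW.
  apply: ge0_subset_integral => //.
  + by apply/measurable_EFinP/measurable_funTS.
  + by move=> t _; rewrite lee_fin invr_ge0 ltW.
  + by move=> t /=; rewrite !in_itv/= !andbT => t1; rewrite (le_trans ler01)// ltW.
have mf : measurable_fun setT (fun t : R => (v t * (1 + t ^+ 2)^-1)%:E).
  by apply/measurable_EFinP; exact: measurable_funM.
have f0 (t : R) : (0 <= (v t * (1 + t ^+ 2)^-1)%:E)%E.
  by rewrite lee_fin mulr_ge0 ?powR_ge0// invr_ge0 ltW.
have -> : [set: R] = `[0%R, +oo[%classic `|` `]-oo, 0%R[%classic.
  apply/seteqP; split => // t _ /=; rewrite !in_itv/= andbT.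
  by case: (leP 0 t); [left|right].
rewrite ge0_integral_setU//=; last 3 first.
- exact: measurable_funTS.
- by move=> t _; exact: f0.
- by apply/disj_setPS => t [] /=; rewrite !in_itv/= andbT => t0; rewrite ltNge t0.
apply: lte_add_pinfty => //; apply: le_lt_trans I_lty.
rewrite /I ge0_integration_by_substitution0//.
under [leRHS]eq_integral do rewrite /v normrN sqrrN.
apply: ge0_subset_integral => //; first exact: measurable_funTS.
  by move=> t _; exact: f0.
by move=> t /=; rewrite !in_itv/= => /ltW.
Qed.

End integrals_1d.

(** * A product weight and its integral against a negative power of the norm *)

Section decay.
Context {R : realType} {n : nat}.
Implicit Types x k : 'rV[R]_n.

Definition decay x : R := \prod_(i < n) (1 + x ord0 i ^+ 2)^-1.

Lemma decay_gt0 x : 0 < decay x.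
Proof. by apply: prodr_gt0 => i _; rewrite invr_gt0 ltr_pwDl// sqr_ge0. Qed.

Lemma decay_le1 x : decay x <= 1.
Proof.
apply: prodr_ile1 => i _; rewrite invr_ge0 addr_ge0 ?sqr_ge0//=.
by rewrite invf_le1 ?lerDl ?sqr_ge0// ltr_pwDl// sqr_ge0.
Qed.

Lemma measurable_decay : measurable_fun setT decay.
Proof.
apply: measurable_prod => i _.
apply: (@measurableT_comp _ _ _ _ _ _ (fun t : R => (1 + t ^+ 2)^-1)).
  by apply: continuous_measurable_fun; exact: continuous_oneDsqrV.
exact: measurable_rV_coord.
Qed.

Lemma enorm_ge0 x : 0 <= enorm x.
Proof. exact: sqrtr_ge0. Qed.

Lemma enorm_sqr x : enorm x ^+ 2 = \sum_(i < n) x ord0 i ^+ 2.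
Proof. by rewrite sqr_sqrtr// sumr_ge0// => i _; exact: sqr_ge0. Qed.

Lemma le_coord_enorm x i : `|x ord0 i| <= enorm x.
Proof.
rewrite -(ler_pXn2r (ltn0Sn 1))// ?nnegrE ?enorm_ge0// enorm_sqr real_normK ?num_real//.
by rewrite (bigD1 i)//= lerDl sumr_ge0// => j _; exact: sqr_ge0.
Qed.

(** Since [|k|] dominates each [|k_i|], the power [|k|^(-s)] is at most the product of the
    [|k_i|^(-s/n)]. The integral of the product factors, and each factor is finite because
    [s / n < 1]. *)
Lemma lty_integral_enormN_decay (s : R) : 0 <= s -> s < n%:R ->
  (\int[lebesgue_rV n]_k (enorm k `^ (- s) * decay k)%:E < +oo)%E.
Proof.
move=> s0 sn; have n0 : 0 < n%:R :> R by exact: le_lt_trans sn.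
pose r := s / n%:R; have r0 : 0 <= r by rewrite divr_ge0// ltW.
have r1 : r < 1 by rewrite ltr_pdivrMr// mul1r.
pose u (i : 'I_n) t : R := `|t| `^ (- r) * (1 + t ^+ 2)^-1.
have mu_ i : measurable_fun setT (u i).
  apply: measurable_funM.
    by apply: (measurableT_comp (measurable_powR _)); exact: normr_measurable.
  by apply: continuous_measurable_fun; exact: continuous_oneDsqrV.
have u0 i t : 0 <= u i t by rewrite mulr_ge0 ?powR_ge0// invr_ge0 addr_ge0// sqr_ge0.
apply: (@le_lt_trans _ _ (\int[lebesgue_rV n]_k (\prod_(i < n) u i (k ord0 i))%:E)%E).
  apply: ae_ge0_le_integral => //.
  - by move=> k _; rewrite lee_fin mulr_ge0 ?powR_ge0 ?ltW ?decay_gt0.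
  - apply/measurable_EFinP/measurable_funM; last exact: measurable_decay.
    by apply: (measurableT_comp (measurable_powR _)); exact: measurable_enorm.
  - by move=> k _; rewrite lee_fin prodr_ge0.
  - apply/measurable_EFinP; apply: measurable_prod => i _.
    by apply: measurableT_comp => //; exact: measurable_rV_coord.
  (* The bound holds off the coordinate hyperplanes; on them the convention that a nonzero power of
     0 is 0 would spoil it. *)
  - apply: filterS ae_coord_neq0 => k k0 _; rewrite lee_fin big_split/= ler_wpM2r ?(ltW (decay_gt0 _))//.
    have -> : enorm k `^ (- s) = \prod_(i < n) enorm k `^ (- r).
      rewrite prodr_const card_ord -powR_mulrn ?powR_ge0// -powRrM mulNr divfK//.
      by rewrite gt_eqF.
    apply: ler_prod => i _; rewrite powR_ge0/= !powRN lef_pV2 ?posrE ?powR_gt0 ?normr_gt0//.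
      by apply: ge0_ler_powR => //; rewrite ?nnegrE ?enorm_ge0 ?le_coord_enorm.
    by rewrite (lt_le_trans _ (le_coord_enorm k i))// normr_gt0.
rewrite ge0_integral_rV_prod//.
rewrite -ge0_fin_numE; last first.
  by apply: prode_ge0 => i _; apply: integral_ge0 => t _; rewrite lee_fin.
apply: prode_fin_num => i _; rewrite ge0_fin_numE; last first.
  by apply: integral_ge0 => t _; rewrite lee_fin.
by apply: integral_onem_powRN; rewrite r0.
Qed.

End decay.

(** * Schwartz functions *)

Section directional.
Context {R : realType} {V : normedModType R}.
Implicit Types (f g : V -> R) (x v : V).

(** Both difference quotients are the same function of [h]. This brings the chain rule, the mean
    value theorem and differentiation under the integral over from one variable. *)
Lemma is_derive_line f x v (t d : R) :
  is_derive (x + t *: v) v f d <-> is_derive t 1 (fun s => f (x + s *: v)) d.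
Proof.
have E : (fun h : R => h^-1 *: ((f \o shift (x + t *: v)) (h *: v) - f (x + t *: v))) =
    (fun h : R => h^-1 *: (((fun s => f (x + s *: v)) \o shift t) (h *: 1) - f (x + t *: v))).
  apply/funext => h /=; congr (_ *: (f _ - _)).
  by rewrite addrCA -scalerDl /GRing.scale/= mulr1.
split=> -[D1 D2]; split; move: D1 D2; rewrite /derivable /derive/= E//.
Qed.

Lemma is_derive_line0 f x v (d : R) :
  is_derive x v f d <-> is_derive (0 : R) 1 (fun s => f (x + s *: v)) d.
Proof. by rewrite -is_derive_line scale0r addr0. Qed.

Lemma is_derive_comp1 (g : R -> R) f x v a d :
  is_derive (f x) 1 g a -> is_derive x v f d -> is_derive x v (g \o f) (a * d).
Proof.
move=> ga /is_derive_line0 fd; apply/is_derive_line0.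
apply: (@is_derive1_comp _ g (fun s => f (x + s *: v))) => //.
by rewrite scale0r addr0.
Qed.

End directional.

(** * Derivatives and moduli of complex-valued functions *)

Section complex_derivative.
Context {R : realType} {V : normedModType R}.
Implicit Types (f g : V -> R[i]) (x v : V).

Lemma ReM (z w : R[i]) : complex.Re (z * w) =
  complex.Re z * complex.Re w - complex.Im z * complex.Im w.
Proof. by case: z w => [? ?] [? ?]. Qed.

Lemma ImM (z w : R[i]) : complex.Im (z * w) =
  complex.Re z * complex.Im w + complex.Im z * complex.Re w.
Proof. by case: z w => [? ?] [? ?]. Qed.

Lemma ReD (z w : R[i]) : complex.Re (z + w) = complex.Re z + complex.Re w.
Proof. by case: z w => [? ?] [? ?]. Qed.

Lemma ImD (z w : R[i]) : complex.Im (z + w) = complex.Im z + complex.Im w.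
Proof. by case: z w => [? ?] [? ?]. Qed.

Definition is_cderive x v f (d : R[i]) :=
  is_derive x v (fun y => complex.Re (f y)) (complex.Re d) /\
  is_derive x v (fun y => complex.Im (f y)) (complex.Im d).

Lemma is_cderiveD x v f g df dg : is_cderive x v f df -> is_cderive x v g dg ->
  is_cderive x v (fun y => f y + g y) (df + dg).
Proof.
move=> [f1 f2] [g1 g2]; split.
  by under eq_fun do rewrite ReD; rewrite ReD; exact: is_deriveD.
by under eq_fun do rewrite ImD; rewrite ImD; exact: is_deriveD.
Qed.

Lemma is_cderiveM x v f g df dg : is_cderive x v f df -> is_cderive x v g dg ->
  is_cderive x v (fun y => f y * g y) (df * g x + f x * dg).
Proof.
move=> [f1 f2] [g1 g2]; split.
  under eq_fun do rewrite ReM.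
  apply: (is_derive_eq (is_deriveB (is_deriveM f1 g1) (is_deriveM f2 g2))).
  by rewrite ReD !ReM /GRing.scale/=; ring.
under eq_fun do rewrite ImM.
apply: (is_derive_eq (is_deriveD (is_deriveM f1 g2) (is_deriveM f2 g1))).
by rewrite ImD !ImM /GRing.scale/=; ring.
Qed.

Lemma is_cderive_cst x v c : is_cderive x v (fun=> c) 0.
Proof. by split; exact: is_derive_cst. Qed.

Lemma is_cderive_real x v (f : V -> R) d : is_derive x v f d ->
  is_cderive x v (fun y => (f y)%:C%C) d%:C%C.
Proof. by move=> fd; split => //=; exact: is_derive_cst. Qed.

Lemma is_cderive_expi x v (f : V -> R) d : is_derive x v f d ->
  is_cderive x v (fun y => expi (f y)) (Complex 0 d * expi (f x)).
Proof.
move=> fd; split.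
  apply: (is_derive_eq (is_derive_comp1 (is_derive_cos (f x)) fd)).
  by rewrite ReM/=; ring.
apply: (is_derive_eq (is_derive_comp1 (is_derive_sin (f x)) fd)).
by rewrite ImM/=; ring.
Qed.

Lemma normc_expi t : Normc.normc (expi t : R[i]) = 1.
Proof. by rewrite /expi/= cos2Dsin2 sqrtr1. Qed.

Lemma normcR (a : R) : Normc.normc (a%:C%C : R[i]) = `|a|.
Proof. by rewrite /= expr0n/= addr0 sqrtr_sqr. Qed.

Lemma normr_Re_normc (z : R[i]) : `|complex.Re z| <= Normc.normc z.
Proof.
rewrite -(ler_pXn2r (ltn0Sn 1))// ?nnegrE ?normc_ge0// normc_sqr.
by rewrite real_normK ?num_real// lerDl sqr_ge0.
Qed.

Lemma normr_Im_normc (z : R[i]) : `|complex.Im z| <= Normc.normc z.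
Proof.
rewrite -(ler_pXn2r (ltn0Sn 1))// ?nnegrE ?normc_ge0// normc_sqr.
by rewrite real_normK ?num_real// lerDr sqr_ge0.
Qed.

Lemma normc_le_ReIm (z : R[i]) :
  Normc.normc z <= `|complex.Re z| + `|complex.Im z|.
Proof.
rewrite -(ler_pXn2r (ltn0Sn 1)) ?nnegrE ?normc_ge0 ?addr_ge0// normc_sqr.
rewrite sqrrD !real_normK ?num_real//.
by rewrite lerD2r lerDl mulrn_wge0// mulr_ge0.
Qed.

End complex_derivative.

(** * Membership in the Schwartz space, stability and decay *)

Section schwartz_functions.
Context {R : realType} {n : nat}.
Implicit Types (f g : 'rV[R]_n -> R[i]) (x : 'rV[R]_n) (r s : seq 'I_n).

Definition ccontinuous f := continuous (fun x => complex.Re (f x)) /\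
  continuous (fun x => complex.Im (f x)).

Lemma ccontinuousM f g : ccontinuous f -> ccontinuous g ->
  ccontinuous (fun x => f x * g x).
Proof.
move=> [f1 f2] [g1 g2]; split => x.
  under eq_fun do rewrite ReM.
  exact: (continuousB (continuousM (f1 x) (g1 x)) (continuousM (f2 x) (g2 x))).
under eq_fun do rewrite ImM.
exact: (continuousD (continuousM (f1 x) (g2 x)) (continuousM (f2 x) (g1 x))).
Qed.

Lemma ccontinuousD f g : ccontinuous f -> ccontinuous g ->
  ccontinuous (fun x => f x + g x).
Proof.
move=> [f1 f2] [g1 g2]; split => x.
  by under eq_fun do rewrite ReD; exact: (continuousD (f1 x) (g1 x)).
by under eq_fun do rewrite ImD; exact: (continuousD (f2 x) (g2 x)).
Qed.

Lemma ccontinuous_cst (a : R[i]) : ccontinuous (fun=> a).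
Proof. by split; exact: cst_continuous. Qed.

Lemma ccontinuous_real (f : 'rV[R]_n -> R) : continuous f ->
  ccontinuous (fun x => (f x)%:C%C).
Proof. by move=> cf; split => //=; exact: cst_continuous. Qed.

Lemma ccontinuous_expi (f : 'rV[R]_n -> R) : continuous f ->
  ccontinuous (fun x => expi (f x)).
Proof.
move=> cf; split => x /=.
  exact: (@continuous_comp _ _ _ f cos x (cf x) (@continuous_cos _ _)).
exact: (@continuous_comp _ _ _ f sin x (cf x) (@continuous_sin _ _)).
Qed.

Lemma is_cderive_partial i f x d : is_cderive x (delta_mx ord0 i) f d ->
  cderivable f x (delta_mx ord0 i) /\ partial i f x = d.
Proof.
move=> [[f1 e1] [f2 e2]]; refine (conj (conj f1 f2) _).
by rewrite /partial e1 e2; case: d {e1 e2}.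
Qed.

Lemma cderivable_is_cderive i f x : cderivable f x (delta_mx ord0 i) ->
  is_cderive x (delta_mx ord0 i) f (partial i f x).
Proof. by move=> [f1 f2]; split; [exact: derivableP f1|exact: derivableP f2]. Qed.

Lemma seminorm_ltyP r s f : (seminorm r s f < +oo)%E <->
  exists M : R, forall x, `|monomial r x| * Normc.normc (partials s f x) <= M.
Proof.
split=> [fy|[M fM]].
  have f0 : (0 <= seminorm r s f)%E.
    by apply: le_trans (ereal_sup_ubound _); last exists 0 => //; rewrite lee_fin normc_ge0.
  exists (fine (seminorm r s f)) => x.
  rewrite -lee_fin fineK ?ge0_fin_numE//; apply: ereal_sup_ubound.
  by exists x => //; rewrite Normc.normcM normcR.
apply: (@le_lt_trans _ _ M%:E); last exact: ltry.
apply: ub_ereal_sup => _ [x _ <-]; rewrite lee_fin Normc.normcM normcR.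
exact: fM.
Qed.

(* Coinduction: a class of continuous functions that is stable under all
   partial derivatives and consists of rapidly decreasing functions consists of
   Schwartz functions. *)
Lemma schwartz_coind (C : set ('rV[R]_n -> R[i])) :
  (forall f, C f -> ccontinuous f) ->
  (forall f i, C f -> exists2 g, C g &
    forall x, is_cderive x (delta_mx ord0 i) f (g x)) ->
  (forall f r, C f ->
    exists M : R, forall x, `|monomial r x| * Normc.normc (f x) <= M) ->
  C `<=` schwartz.
Proof.
move=> C1 C2 C3 f Cf.
have Cs s : C (partials s f).
  elim: s => //= i s IH; have [g Cg Hg] := C2 _ i IH.
  rewrite (_ : partial i _ = g)//.
  by apply/funext => x; have [_ ->] := is_cderive_partial (Hg x).
split=> [s|r s]; last exact/seminorm_ltyP/C3.
have [c1 c2] := C1 _ (Cs s).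
split => // i x; have [g Cg Hg] := C2 _ i (Cs s).
by have [] := is_cderive_partial (Hg x).
Qed.

Lemma schwartz_partial i f : schwartz f -> schwartz (partial i f).
Proof.
move=> [sf nf]; have E s : partials s (partial i f) = partials (rcons s i) f.
  by rewrite /partials foldr_rcons.
split=> [s|r s]; first by rewrite E; exact: sf.
by have := nf r (rcons s i); rewrite /seminorm E.
Qed.

Lemma schwartz_partials s f : schwartz f -> schwartz (partials s f).
Proof. by move=> Sf; elim: s => //= i s; exact: schwartz_partial. Qed.

Lemma schwartz_ccontinuous f : schwartz f -> ccontinuous f.
Proof. by move=> [/(_ [::])[]]. Qed.

Lemma schwartz_cderive f i x : schwartz f ->
  is_cderive x (delta_mx ord0 i) f (partial i f x).
Proof.
by move=> [/(_ [::])[_ _ /(_ i x)] + _]; exact: cderivable_is_cderive.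
Qed.

Lemma schwartz_bounded f r : schwartz f ->
  exists M : R, forall x, `|monomial r x| * Normc.normc (f x) <= M.
Proof. by move=> [_ /(_ r [::])] /seminorm_ltyP. Qed.

Lemma is_derive_coord x (v : 'rV[R]_n) (i : 'I_n) :
  is_derive x v (fun y : 'rV[R]_n => y ord0 i) (v ord0 i).
Proof.
apply/is_derive_line0.
under eq_fun do rewrite mxE [X in _ + X]mxE.
apply: (is_derive_eq (is_deriveD (is_derive_cst (x ord0 i) (0:R) 1) (is_deriveM (is_derive_id (0:R) 1) (is_derive_cst (v ord0 i) (0:R) 1)))).
by rewrite add0r /GRing.scale/= mulr0 add0r mulr1.
Qed.

(** The products [x_i f] alone are not stable under derivatives, since the product rule also
    produces [f]. This closure is stable, so [schwartz_coind] applies to it as a whole. *)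
Inductive smul_closure : ('rV[R]_n -> R[i]) -> Prop :=
| Smul_base f : schwartz f -> smul_closure f
| Smul_coord i f : smul_closure f ->
    smul_closure (fun x => (x ord0 i)%:C%C * f x)
| Smul_lin (a : R[i]) f g : smul_closure f -> smul_closure g ->
    smul_closure (fun x => a * f x + g x).

Lemma smul_closure_schwartz : smul_closure `<=` schwartz.
Proof.
apply: schwartz_coind.
- move=> f; elim=> {f} [f /schwartz_ccontinuous//|i f _ cf|a f g _ cf _ cg].
    by apply: ccontinuousM => //; apply: ccontinuous_real; exact: coord_continuous.
  apply: ccontinuousD => //; apply: ccontinuousM => //.
  exact: ccontinuous_cst.
- move=> f i; elim=> {f} [f Sf|j f Cf [g Cg Hg]|a f g Cf [f' Cf' Hf] Cg [g' Cg' Hg]].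
  + exists (partial i f); first exact/Smul_base/schwartz_partial.
    by move=> x; exact: schwartz_cderive.
  + exists (fun x => (j == i)%:R * f x + (x ord0 j)%:C%C * g x).
      by apply: Smul_lin => //; exact: Smul_coord.
    move=> x; have := is_cderiveM (is_cderive_real (is_derive_coord x (delta_mx ord0 i) j)) (Hg x).
    by rewrite mxE eqxx/= rmorph_nat.
  + exists (fun x => a * f' x + g' x); first exact: Smul_lin.
    move=> x; apply: is_cderiveD => //.
    have := is_cderiveM (is_cderive_cst x (delta_mx ord0 i) a) (Hf x).
    by rewrite mul0r add0r.
- move=> f r Cf; elim: Cf r => {f} [f Sf r|j f _ IH r|a f g _ IHf _ IHg r].
  + exact: schwartz_bounded.
  (* The coordinate factor is absorbed by the monomial, which is why the induction keeps [r]
     general. *)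
  + have [M HM] := IH (j :: r); exists M => x.
    by have := HM x; rewrite /monomial big_cons Normc.normcM normcR normrM mulrA [`|x _ _| * _]mulrC.
  + have [M HM] := IHf r; have [N HN] := IHg r; exists (Normc.normc a * M + N) => x.
    apply: (@le_trans _ _ (Normc.normc a * (`|monomial r x| * Normc.normc (f x)) +
        `|monomial r x| * Normc.normc (g x))).
      rewrite mulrCA -mulrDr ler_wpM2l// -Normc.normcM; exact: le_normcD.
    by rewrite lerD// ler_wpM2l// normc_ge0.
Qed.

Lemma schwartz_lin a f g : schwartz f -> schwartz g ->
  schwartz (fun x => a * f x + g x).
Proof.
by move=> Sf Sg; apply/smul_closure_schwartz/Smul_lin; exact: Smul_base.
Qed.

Lemma schwartz_coord i f : schwartz f -> schwartz (fun x => (x ord0 i)%:C%C * f x).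
Proof. by move=> Sf; apply/smul_closure_schwartz/Smul_coord/Smul_base. Qed.

Lemma schwartz0 : schwartz (fun _ : 'rV[R]_n => 0 : R[i]).
Proof.
apply: (@schwartz_coind [set (fun=> 0)]) => // f.
- by move=> ->; exact: ccontinuous_cst.
- by move=> i ->; exists (fun=> 0) => // x; exact: is_cderive_cst.
- by move=> r ->; exists 0 => x; rewrite Normc.normc0 mulr0.
Qed.

Lemma schwartzZ a f : schwartz f -> schwartz (fun x => a * f x).
Proof.
move=> Sf; have := schwartz_lin a Sf schwartz0.
by under eq_fun do rewrite addr0.
Qed.

Lemma is_derive_dotp x v (k : 'rV[R]_n) :
  is_derive x v (fun y => dotp y k) (dotp v k).
Proof.
apply/is_derive_line0.
rewrite (_ : (fun s : R => _) = fun s : R => dotp x k + s * dotp v k).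
  apply: (is_derive_eq (is_deriveD (is_derive_cst (dotp x k) (0:R) 1) (is_deriveM (is_derive_id (0:R) 1) (is_derive_cst (dotp v k) (0:R) 1)))).
  by rewrite add0r /GRing.scale/= mulr0 add0r mulr1.
apply/funext => s; rewrite /dotp mulr_sumr -big_split/=; apply: eq_bigr => i _.
by rewrite !mxE mulrDl mulrA.
Qed.

Lemma continuous_sumr (I : finType) (u : I -> 'rV[R]_n -> R) :
  (forall i, continuous (u i)) -> continuous (fun x => \sum_(i : I) u i x).
Proof.
move=> cu; rewrite (_ : (fun x => _) = \sum_(i : I) u i); last first.
  by apply/funext => x; rewrite fct_sumE.
elim/big_ind : _ => //; first exact: cst_continuous.
by move=> f g cf cg x; exact: (continuousD (cf x) (cg x)).
Qed.

Lemma continuous_dotp (k : 'rV[R]_n) : continuous (fun y => dotp y k).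
Proof.
apply: continuous_sumr => i x.
apply: (@continuousM _ _ (fun y : 'rV[R]_n => y ord0 i) (cst (k ord0 i))).
  exact: coord_continuous.
exact: cst_continuous.
Qed.

(** For a fixed character, the products with Schwartz functions form a class stable under
    derivatives: the character reproduces itself up to a constant. *)
Lemma schwartz_expi (c : R) (k : 'rV[R]_n) f : schwartz f ->
  schwartz (fun x => f x * expi (c * dotp x k)).
Proof.
pose C := [set h : 'rV[R]_n -> R[i] | exists2 f, schwartz f & h = fun x => f x * expi (c * dotp x k)].
move=> Sf; apply: (@schwartz_coind C); last by exists f.
- move=> _ [h Sh ->]; apply: ccontinuousM; first exact: schwartz_ccontinuous.
  apply: ccontinuous_expi => x.
  exact: (@continuousM _ _ (cst c) (fun y => dotp y k) x (@cst_continuous _ _ c x) (@continuous_dotp k x)).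
- move=> _ i [h Sh ->].
  exists (fun x => (Complex 0 (c * k ord0 i) * h x + partial i h x) * expi (c * dotp x k)).
    by exists (fun x => Complex 0 (c * k ord0 i) * h x + partial i h x) => //; apply: schwartz_lin => //; exact: schwartz_partial.
  move=> x.
  have d1 : is_derive x (delta_mx ord0 i) (fun y => c * dotp y k) (c * k ord0 i).
    apply: (is_derive_eq (is_deriveZ c (is_derive_dotp x (delta_mx ord0 i) k))).
    rewrite /GRing.scale/= /dotp (bigD1 i)//= big1 ?addr0.
      by rewrite mxE !eqxx mul1r.
    by move=> j ji; rewrite mxE eqxx (negbTE ji) mul0r.
  have := is_cderiveM (schwartz_cderive i x Sh) (is_cderive_expi d1).
  by congr is_cderive; rewrite mulrDl addrC; congr (_ + _); rewrite mulrCA mulrA.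
- move=> _ r [h Sh ->]; have [M HM] := schwartz_bounded r Sh; exists M => x.
  by rewrite Normc.normcM normc_expi mulr1.
Qed.

Lemma monomial_nseq (i : 'I_n) m x : monomial (nseq m i) x = x ord0 i ^+ m.
Proof.
by elim: m => [|m IH]; rewrite /monomial ?big_nil ?expr0//= big_cons -[X in _ * X]/(monomial _ _) IH exprS.
Qed.

(** Let [M] be the largest of 1 and the [x_i^2]. Each factor [1 + x_i^2] is at most [2 M], and [M^n]
    is one of the terms on the right. *)
Lemma decayV_le x : (decay x)^-1 <= 2 ^+ n * (1 + \sum_(i < n) x ord0 i ^+ (2 * n)).
Proof.
have [j Hj] : exists M : R, [/\ 1 <= M, forall i, x ord0 i ^+ 2 <= M &
    M ^+ n <= 1 + \sum_(i < n) x ord0 i ^+ (2 * n)].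
  have s0 i : 0 <= x ord0 i ^+ (2 * n) by rewrite exprM exprn_ge0// sqr_ge0.
  case: (pselect (exists i, forall j, x ord0 j ^+ 2 <= x ord0 i ^+ 2 /\ 1 <= x ord0 i ^+ 2)).
    move=> [i Hi]; exists (x ord0 i ^+ 2); split; [exact: (Hi i).2|by move=> k; exact: (Hi k).1|].
    by rewrite -exprM (bigD1 i)//= addrCA lerDl addr_ge0// sumr_ge0.
  move=> H; exists 1; split => //; last by rewrite expr1n lerDl sumr_ge0.
  move=> i; rewrite leNgt; apply/negP => xi; apply: H.
  have [k Hk] : exists k, forall l, x ord0 l ^+ 2 <= x ord0 k ^+ 2.
    by exists [arg max_(k > i) (x ord0 k ^+ 2)]%O; case: arg_maxP => // k _ Hk l; exact: Hk.
  by exists k => l; split => //; rewrite (le_trans (ltW xi)).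
case: Hj => j1 Hj jn.
rewrite /decay -prodfV; apply: (@le_trans _ _ (\prod_(i < n) (2 * j))).
  apply: ler_prod => i _; rewrite invrK addr_ge0 ?sqr_ge0//= mulrDl !mul1r.
  by rewrite lerD.
by rewrite prodr_const card_ord exprMn ler_wpM2l// exprn_ge0.
Qed.

(** Bounds for 1 and the [x_i^(2n)] are enough to reach [decay]. The constant is explicit and linear
    in [d], which later turns seminorm bounds into continuity of distributions. *)
Lemma le_decay x (a d : R) : 0 <= a -> a <= d ->
  (forall i, `|monomial (nseq (2 * n) i) x| * a <= d) ->
  a <= (2 ^+ n * (1 + n%:R)) * d * decay x.
Proof.
move=> a0 ad Had; rewrite -ler_pdivrMr ?decay_gt0//.
apply: (@le_trans _ _ (a * (2 ^+ n * (1 + \sum_(i < n) x ord0 i ^+ (2 * n))))).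
  by rewrite ler_wpM2l// decayV_le.
rewrite mulrCA -mulrA ler_wpM2l ?exprn_ge0// mulrDr mulrDl mul1r mulr1 lerD//.
rewrite mulr_sumr mulr_natl -[X in _ *+ X](card_ord n) -sumr_const ler_sum// => i _.
rewrite mulrC; apply: le_trans (Had i); rewrite ler_wpM2r// monomial_nseq ler_norm//.
Qed.

Lemma schwartz_decay f : schwartz f ->
  exists2 M : R, 0 <= M & forall x, Normc.normc (f x) <= M * decay x.
Proof.
(* [None] stands for the constant monomial, [Some i] for [x_i^(2n)]. *)
move=> Sf; have /choice[M HM] (o : option 'I_n) : exists M : R, forall x,
    `|monomial (if o is Some i then nseq (2 * n) i else [::]) x| * Normc.normc (f x) <= M.
  exact: schwartz_bounded.
pose D := \sum_o `|M o|.
have MD o x : `|monomial (if o is Some i then nseq (2 * n) i else [::]) x| * Normc.normc (f x) <= D.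
  apply: (le_trans (HM o x)); apply: (le_trans (ler_norm _)).
  by rewrite /D (bigD1 o)//= lerDl sumr_ge0.
exists (2 ^+ n * (1 + n%:R) * D).
  by rewrite mulr_ge0// ?mulr_ge0 ?exprn_ge0 ?addr_ge0// sumr_ge0.
move=> x; apply: le_decay; first exact: normc_ge0.
  by have := MD None x; rewrite /monomial big_nil normr1 mul1r.
by move=> i; exact: (MD (Some i) x).
Qed.

End schwartz_functions.

(** * Lipschitz bounds from bounded partial derivatives *)

Section lipschitz.
Context {R : realType} {n : nat}.
Implicit Types (g : 'rV[R]_n -> R) (x y : 'rV[R]_n).

Lemma le_partial_step g (i : 'I_n) (d : 'rV[R]_n -> R) (M : R) x (t : R) :
  (forall x, is_derive x (delta_mx ord0 i) g (d x)) ->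
  (forall x, `|d x| <= M) ->
  `|g (x + t *: delta_mx ord0 i) - g x| <= M * `|t|.
Proof.
move=> gd dM; pose e : 'rV[R]_n := delta_mx ord0 i.
have H (a b : R) : a < b -> `|g (x + b *: e) - g (x + a *: e)| <= M * (b - a).
  move=> ab; have dF (s : R) : is_derive s 1 (fun s => g (x + s *: e)) (d (x + s *: e)).
    exact: (proj1 (is_derive_line g x e s _) (gd _)).
  have [|c _ ->] := @MVT _ (fun s => g (x + s *: e)) (fun s => d (x + s *: e)) a b ab (fun s _ => dF s).
    by apply: derivable_within_continuous => s _; have [] := dF s.
  by rewrite normrM (gtr0_norm (_ : 0 < b - a)) ?subr_gt0// ler_wpM2r// subr_ge0 ltW.
have := H 0 t; have := H t 0; rewrite !scale0r !addr0 sub0r subr0.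
case: (ltrgtP t 0) => [t0 /(_ isT) + _|t0 _ /(_ isT)|-> _ _].
- by rewrite distrC (ltr0_norm t0).
- by rewrite (gtr0_norm t0).
- by rewrite scale0r addr0 subrr !normr0 mulr0.
Qed.

(** The path from [x] to [y] moves one coordinate at a time, and each move is a mean value estimate
    along a line. No continuity of the partial derivatives enters. *)
Lemma lipschitz_partial g (d : 'I_n -> 'rV[R]_n -> R) (M : R) x y :
  (forall i x, is_derive x (delta_mx ord0 i) g (d i x)) ->
  (forall i x, `|d i x| <= M) ->
  `|g y - g x| <= M * \sum_(i < n) `|y ord0 i - x ord0 i|.
Proof.
move=> gd dM.
have H (s : seq 'I_n) (h : 'I_n -> R) :
    `|g (x + \sum_(i <- s) h i *: delta_mx ord0 i) - g x| <= M * \sum_(i <- s) `|h i|.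
  elim: s => [|i s IH]; first by rewrite !big_nil addr0 subrr normr0 mulr0.
  rewrite !big_cons mulrDr addrCA (addrC (h i *: _)).
  set z := x + _; rewrite -(subrKA (g z)) (le_trans (ler_normD _ _))// lerD//.
  exact: (le_partial_step z (h i) (gd i) (dM i)).
have := H (index_enum 'I_n) (fun i => (y - x) ord0 i).
rewrite -row_sum_delta (_ : x + (y - x) = y); last by rewrite addrC subrK.
move=> /le_trans; apply.
rewrite le_eqVlt; apply/orP; left; apply/eqP; congr (_ * _).
by apply: eq_bigr => i _; rewrite !mxE.
Qed.

(** This yields continuity of Fourier transforms, whose partial derivatives exist and are
    bounded. *)
Lemma continuous_partial g (d : 'I_n -> 'rV[R]_n -> R) (M : R) :
  (forall i x, is_derive x (delta_mx ord0 i) g (d i x)) ->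
  (forall i x, `|d i x| <= M) -> continuous g.
Proof.
move=> gd dM x; apply/(@cvgrPdist_lt _ _ _ (nbhs x) (nbhs_filter x)) => e e0.
pose N := `|M| + 1; have N0 : 0 < N by rewrite ltr_wpDl.
pose r := e / (N * n.+1%:R); have r0 : 0 < r by rewrite divr_gt0// mulr_gt0.
apply/nbhs_ballP; exists r => //= y [_ xy].
rewrite distrC; apply: (le_lt_trans (lipschitz_partial x y gd dM)).
apply: (@le_lt_trans _ _ (N * \sum_(i < n) r)).
  apply: (@le_trans _ _ (N * \sum_(i < n) `|y ord0 i - x ord0 i|)).
    by rewrite ler_wpM2r ?sumr_ge0// /N (le_trans (ler_norm M))// lerDl.
  rewrite ler_wpM2l ?(ltW N0)// ler_sum// => i _.
  by have := xy ord0 i; rewrite /ball/= distrC => /ltW.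
rewrite sumr_const card_ord -[r *+ n]mulr_natr mulrCA.
have -> : r * (N * n%:R) = e * (n%:R / n.+1%:R).
  by rewrite /r; field; rewrite !gt_eqF.
by rewrite gtr_pMr// ltr_pdivrMr// mul1r ltr_nat.
Qed.

Lemma partial0_cst g x y : (forall i x, is_derive x (delta_mx ord0 i) g 0) -> g y = g x.
Proof.
move=> g0; apply/eqP; rewrite -subr_eq0 -normr_le0.
have := @lipschitz_partial g (fun _ _ => 0) 0 x y g0.
by rewrite mul0r; apply => i z; rewrite normr0.
Qed.

End lipschitz.

(** * Polynomials times exponentials of polynomials *)

Section polynomial_functions.
Context {R : realType} {n : nat}.
Implicit Types (p q : 'rV[R]_n -> R).

Inductive polyfun : ('rV[R]_n -> R) -> Prop :=
| Polyfun_cst (c : R) : polyfun (fun=> c)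
| Polyfun_coord i : polyfun (fun x => x ord0 i)
| PolyfunD p q : polyfun p -> polyfun q -> polyfun (fun x => p x + q x)
| PolyfunM p q : polyfun p -> polyfun q -> polyfun (fun x => p x * q x).

Lemma polyfunX p m : polyfun p -> polyfun (fun x => p x ^+ m).
Proof.
move=> pp; elim: m => [|m IH].
  by under eq_fun do rewrite expr0; exact: Polyfun_cst.
by under eq_fun do rewrite exprS; exact: PolyfunM.
Qed.

Lemma polyfun_sum (I : Type) (s : seq I) (u : I -> 'rV[R]_n -> R) :
  (forall i, polyfun (u i)) -> polyfun (fun x => \sum_(i <- s) u i x).
Proof.
move=> pu; elim: s => [|i s IH].
  by under eq_fun do rewrite big_nil; exact: Polyfun_cst.
by under eq_fun do rewrite big_cons; exact: PolyfunD.
Qed.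

Lemma polyfun_monomial r : polyfun (@monomial R n r).
Proof.
elim: r => [|i r IH].
  rewrite (_ : monomial _ = fun=> 1); first exact: Polyfun_cst.
  by apply/funext => x; rewrite /monomial big_nil.
rewrite (_ : monomial _ = fun x => x ord0 i * monomial r x).
  by apply: PolyfunM => //; exact: Polyfun_coord.
by apply/funext => x; rewrite /monomial big_cons.
Qed.

Lemma polyfun_continuous p : polyfun p -> continuous p.
Proof.
elim=> {p} [c|i|p q _ cp _ cq|p q _ cp _ cq].
- exact: cst_continuous.
- exact: coord_continuous.
- by move=> x; exact: (continuousD (cp x) (cq x)).
- by move=> x; exact: (continuousM (cp x) (cq x)).
Qed.

Lemma polyfun_derive p i : polyfun p -> exists2 q, polyfun q &
  forall x, is_derive x (delta_mx ord0 i) p (q x).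
Proof.
elim=> {p} [c|j|p q _ [p' Pp dp] _ [q' Pq dq]|p q pp [p' Pp dp] pq [q' Pq dq]].
- by exists (fun=> 0); [exact: Polyfun_cst|move=> x; exact: is_derive_cst].
- exists (fun=> (j == i)%:R); first exact: Polyfun_cst.
  move=> x; have := is_derive_coord x (delta_mx ord0 i) j.
  by rewrite mxE eqxx.
- exists (fun x => p' x + q' x); first exact: PolyfunD.
  by move=> x; exact: is_deriveD.
- exists (fun x => p x * q' x + q x * p' x); first by apply: PolyfunD; exact: PolyfunM.
  by move=> x; exact: is_deriveM.
Qed.

Lemma polyfun_growth p : polyfun p -> exists (A : R) (N : nat),
  0 <= A /\ forall x, `|p x| <= A * (1 + enorm x ^+ 2) ^+ N.
Proof.
have e1 (x : 'rV[R]_n) : 1 <= 1 + enorm x ^+ 2 by rewrite lerDl sqr_ge0.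
have e0 (x : 'rV[R]_n) : 0 <= 1 + enorm x ^+ 2 by rewrite (le_trans ler01).
elim=> {p} [c|i|p q _ [A [N [A0 HA]]] _ [B [M [B0 HB]]]|p q _ [A [N [A0 HA]]] _ [B [M [B0 HB]]]].
- by exists `|c|, 0; split => // x; rewrite expr0 mulr1.
- exists 1, 1; split => // x; rewrite expr1 mul1r (le_trans (le_coord_enorm _ _))//.
  have := sqr_ge0 (enorm x - 2^-1); rewrite sqrrB => h.
  rewrite -subr_ge0; move: h; set e := enorm x; rewrite -mulr_natr => h.
  (* Completing the square shows [|x| <= 1 + |x|^2]. *)
  have -> : 1 + e ^+ 2 - e = (e ^+ 2 - e * 2^-1 * 2%:R + 2^-1 ^+ 2) + 3 / 4 by field.
  by rewrite addr_ge0.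
- exists (A + B), (N + M)%N; split; first exact: addr_ge0.
  move=> x; rewrite (le_trans (ler_normD _ _))// mulrDl lerD//.
    by rewrite (le_trans (HA x))// ler_wpM2l// ler_weXn2l// leq_addr.
  by rewrite (le_trans (HB x))// ler_wpM2l// ler_weXn2l// leq_addl.
- exists (A * B), (N + M)%N; split; first exact: mulr_ge0.
  by move=> x; rewrite normrM exprD mulrACA ler_pM.
Qed.

Lemma expX_le_expR (N : nat) (y : R) : 0 <= y -> y ^+ N <= N`!%:R * expR y.
Proof.
case: N => [|N] y0; first by rewrite expr0 mul1r; case/orP: (le_total 0 y) => _; rewrite -expR0 ler_expR.
rewrite mulrC -ler_pdivrMr ?ltr0n ?fact_gt0//.
by apply: le_trans (expR_ge1Dxn N y0); rewrite lerDr.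
Qed.

(** With [q] fixed, derivatives only change the polynomial factor, from [p] to [p' + p q']. This
    covers Gaussians as well as the bumps that approximate indicators of boxes. *)
Lemma schwartz_expR p q (K c : R) : polyfun p -> polyfun q -> 0 < K ->
  (forall x, q x <= c - K * enorm x ^+ 2) ->
  schwartz (fun x => (p x * expR (q x))%:C%C).
Proof.
move=> pp pq K0 Kq.
pose C := [set h : 'rV[R]_n -> R[i] | exists2 p, polyfun p & h = fun x => (p x * expR (q x))%:C%C].
apply: (@schwartz_coind _ _ C); last by exists p.
- move=> _ [{pp}p pp ->]; apply: ccontinuous_real => x.
  apply: (@continuousM _ _ p (fun x => expR (q x)) x); first exact: polyfun_continuous.
  by apply: continuous_comp; [exact: polyfun_continuous|exact: continuous_expR].
- move=> _ i [{pp}p pp ->].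
  have [p' pp' dp] := polyfun_derive i pp; have [q' pq' dq] := polyfun_derive i pq.
  exists (fun x => ((p' x + p x * q' x) * expR (q x))%:C%C).
    exists (fun x => p' x + p x * q' x) => //; apply: PolyfunD => //.
    exact: PolyfunM.
  move=> x; apply: is_cderive_real.
  have de := is_derive_comp1 (is_derive_expR (q x)) (dq x).
  apply: (is_derive_eq (is_deriveM (dp x) de)).
  by rewrite /GRing.scale/=; ring.
- move=> _ r [{pp}p pp ->].
  have [A [N [A0 HA]]] := polyfun_growth (PolyfunM (polyfun_monomial r) pp).
  (* With [y = K (1 + |x|^2)], the growth [(1 + |x|^2)^N] is [K^(-N) y^N], at most
     [K^(-N) N! exp y]; multiplied by [exp (c - K |x|^2)] this leaves [exp (K + c)]. *)
  exists (A * (K ^- N * N`!%:R * expR (K + c))) => x.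
  rewrite normcR normrM mulrA -normrM [X in _ * X]gtr0_norm ?expR_gt0//.
  apply: (@le_trans _ _ (A * (1 + enorm x ^+ 2) ^+ N * expR (c - K * enorm x ^+ 2))).
    by rewrite ler_pM ?expR_ge0// ler_expR.
  rewrite -!mulrA ler_wpM2l//.
  have y0 : 0 <= K * (1 + enorm x ^+ 2) by rewrite mulr_ge0 ?(ltW K0)// addr_ge0// sqr_ge0.
  rewrite ler_pdivlMl ?exprn_gt0// mulrA -exprMn.
  apply: (@le_trans _ _ (N`!%:R * expR (K * (1 + enorm x ^+ 2)) * expR (c - K * enorm x ^+ 2))).
    by rewrite ler_wpM2r ?expR_ge0// expX_le_expR.
  by rewrite -mulrA -expRD; apply: ler_wpM2l => //; rewrite ler_expR; lra.
Qed.

End polynomial_functions.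

(** * The Fourier transform on the Schwartz space *)

Section fourier_of_schwartz.
Context {R : realType} {n : nat}.
Local Notation mu := (@lebesgue_rV R n).
Implicit Types (f g : 'rV[R]_n -> R[i]) (x k : 'rV[R]_n).

Lemma lty_integral_decay : (\int[mu]_x (decay x)%:E < +oo)%E.
Proof.
rewrite (ge0_integral_rV_prod (u := fun _ t => (1 + t ^+ 2)^-1)).
- rewrite -ge0_fin_numE; last first.
    by apply: prode_ge0 => i _; apply: integral_ge0 => t _; rewrite lee_fin invr_ge0 addr_ge0// sqr_ge0.
  apply: prode_fin_num => i _; rewrite ge0_fin_numE; last first.
    by apply: integral_ge0 => t _; rewrite lee_fin invr_ge0 addr_ge0// sqr_ge0.
  apply: le_lt_trans (@integral_onem_powRN R 0 _); last by rewrite lexx ltr01.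
  rewrite le_eqVlt; apply/orP; left; apply/eqP.
  by apply: eq_integral => t _; rewrite oppr0 powRr0 mul1r.
- by move=> i; apply: continuous_measurable_fun; exact: continuous_oneDsqrV.
- by move=> i t; rewrite invr_ge0 addr_ge0// sqr_ge0.
Qed.

Lemma integrable_decay : mu.-integrable setT (EFin \o @decay R n).
Proof.
apply/integrableP; split; first by apply/measurable_EFinP; exact: measurable_decay.
under eq_integral do rewrite /= ger0_norm ?(ltW (decay_gt0 _))//.
exact: lty_integral_decay.
Qed.

Lemma integrable_le_decay (f : 'rV[R]_n -> R) M : measurable_fun setT f ->
  (forall x, `|f x| <= M * decay x) -> mu.-integrable setT (EFin \o f).
Proof.
move=> mf fM; apply: (@le_integrable _ _ _ mu setT measurableT _ (fun x => (M * decay x)%:E)).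
- exact/measurable_EFinP.
- by move=> x _; rewrite /= lee_fin (le_trans (fM x))// ler_norm.
- exact: (integrableZl measurableT M integrable_decay).
Qed.

Lemma Rintegral_le_decay (f : 'rV[R]_n -> R) M : measurable_fun setT f ->
  (forall x, `|f x| <= M * decay x) ->
  `|\int[mu]_x f x| <= M * \int[mu]_x decay x.
Proof.
move=> mf fM; have fi := integrable_le_decay mf fM.
apply: (le_trans (le_normr_Rintegral measurableT fi)).
rewrite -RintegralZl//; last exact: integrable_decay.
apply: le_Rintegral => //.
- exact: (integrable_norm fi).
- exact: (integrableZl measurableT M integrable_decay).
Qed.

Lemma ccontinuous_cmeasurable f : ccontinuous f -> cmeasurable_fun f.
Proof. by move=> [f1 f2]; split; exact: continuous_measurable_rV. Qed.

Lemma cintegrable_le_decay f M : cmeasurable_fun f ->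
  (forall x, Normc.normc (f x) <= M * decay x) -> cintegrable mu f.
Proof.
move=> [f1 f2] fM; split; apply: (@integrable_le_decay _ M) => // x.
  exact: le_trans (normr_Re_normc _) (fM x).
exact: le_trans (normr_Im_normc _) (fM x).
Qed.

Lemma cintegral_le_decay f M : cmeasurable_fun f ->
  (forall x, Normc.normc (f x) <= M * decay x) ->
  Normc.normc (cintegral mu f) <= 2 * M * \int[mu]_x decay x.
Proof.
move=> [f1 f2] fM; apply: (le_trans (normc_le_ReIm _)) => /=.
rewrite -mulrA mulr2n mulrDl !mul1r; apply: lerD; apply: Rintegral_le_decay => // x.
  exact: le_trans (normr_Re_normc _) (fM x).
exact: le_trans (normr_Im_normc _) (fM x).
Qed.

Lemma schwartz_cintegrable f : schwartz f -> cintegrable mu f.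
Proof.
move=> Sf; have [M _ HM] := schwartz_decay Sf.
by apply: cintegrable_le_decay HM; exact/ccontinuous_cmeasurable/schwartz_ccontinuous.
Qed.

(** Differentiation under the integral, applied to real and imaginary parts. The domination is asked
    on []-1, 1[] because translates by arbitrary [t] have no common integrable majorant in
    general. *)
Lemma is_cderive_cintegral (F DF : R -> 'rV[R]_n -> R[i]) (M : R) :
  (forall t, -1 < t < 1 -> cintegrable mu (F t)) ->
  (forall (t : R) x, is_cderive t 1 (fun s => F s x) (DF t x)) ->
  (forall t x, -1 < t < 1 -> Normc.normc (DF t x) <= M * decay x) ->
  is_cderive (0 : R) 1 (fun t => cintegral mu (F t)) (cintegral mu (DF 0)).
Proof.
move=> Fi dF DFM.
have I0 : (0 : R) \in `](-1), 1[ by rewrite in_itv/= ltrN10 ltr01.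
have M0 x : 0 <= M * decay x.
  by apply: le_trans (DFM 0 x _); rewrite ?normc_ge0// ltrN10 ltr01.
have Gi : mu.-integrable setT (EFin \o (fun x => M * decay x)).
  exact: (integrableZl measurableT M integrable_decay).
have H (u : R -> 'rV[R]_n -> R) (du : R -> 'rV[R]_n -> R) :
    (forall t, -1 < t < 1 -> mu.-integrable setT (EFin \o u t)) ->
    (forall (t : R) x, is_derive t 1 (fun s => u s x) (du t x)) ->
    (forall t x, -1 < t < 1 -> `|du t x| <= M * decay x) ->
    is_derive (0 : R) 1 (fun t => \int[mu]_x u t x) (\int[mu]_x du 0 x).
  move=> ui dui duM.
  have E t x : partial1of2 u t x = du t x.
    by rewrite partial1of2E; have [_ ->] := dui t x.
  have D1 t x : `](-1), 1[%classic t -> setT x -> derivable (u ^~ x) t 1.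
    by move=> _ _; have [] := dui t x.
  have ui' t : `](-1), 1[%classic t -> mu.-integrable setT (EFin \o u t).
    by rewrite /= in_itv/= => /ui.
  have duM' t x : `](-1), 1[%classic t -> setT x -> `|partial1of2 u t x| <= M * decay x.
    by rewrite /= in_itv/= E => /duM.
  split; first exact: (derivable_under_integral measurableT I0 ui' D1 M0 Gi duM').
  rewrite -derive1E (differentiation_under_integral measurableT I0 ui' D1 M0 Gi duM').
  by apply: eq_Rintegral => x _; rewrite E.
split.
  apply: (H (fun t x => complex.Re (F t x)) (fun t x => complex.Re (DF t x))).
  - by move=> t /Fi [].
  - by move=> t x; have [] := dF t x.
  - by move=> t x /(DFM t x); exact/le_trans/normr_Re_normc.
apply: (H (fun t x => complex.Im (F t x)) (fun t x => complex.Im (DF t x))).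
- by move=> t /Fi [].
- by move=> t x; have [] := dF t x.
- by move=> t x /(DFM t x); exact/le_trans/normr_Im_normc.
Qed.

Lemma is_cderive_line f x (v : 'rV[R]_n) (t : R) d :
  is_cderive (x + t *: v) v f d <-> is_cderive t 1 (fun s => f (x + s *: v)) d.
Proof.
split=> -[d1 d2]; split.
- exact: (proj1 (is_derive_line _ x v t _) d1).
- exact: (proj1 (is_derive_line _ x v t _) d2).
- exact: (proj2 (is_derive_line _ x v t _) d1).
- exact: (proj2 (is_derive_line _ x v t _) d2).
Qed.

Lemma Rintegral_shift (f : 'rV[R]_n -> R) (b : 'rV[R]_n) : measurable_fun setT f ->
  \int[mu]_x f (x + b) = \int[mu]_x f x.
Proof.
move=> mf; rewrite /Rintegral integralE [in RHS]integralE.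
have H (g : 'rV[R]_n -> \bar R) : measurable_fun setT g -> (forall x, 0 <= g x)%E ->
    (\int[mu]_x g (x + b)%R = \int[mu]_x g x)%E.
  move=> mg g0; have := ge0_integral_rV_affine b ltr01 mg g0.
  by under eq_integral do rewrite scale1r; rewrite invr1 expr1n mul1e.
have mEf : measurable_fun setT (fun x => (f x)%:E) by exact/measurable_EFinP.
congr (fine (_ - _)).
  rewrite -(H _ (measurable_funepos mEf))//; apply: eq_integral => x _.
  by rewrite !funeposE.
rewrite -(H _ (measurable_funeneg mEf))//; apply: eq_integral => x _.
by rewrite !funenegE.
Qed.

(** Only the factor of index [j] changes, and it grows at most threefold. *)
Lemma decay_shift x (j : 'I_n) (t : R) : -1 < t < 1 ->
  decay (x + t *: delta_mx ord0 j) <= 3 * decay x.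
Proof.
move=> /andP[t1 t2]; rewrite /decay (bigD1 j)//= [in leRHS](bigD1 j)//= mulrA.
have E i : i != j -> (x + t *: delta_mx ord0 j) ord0 i = x ord0 i.
  by move=> ij; rewrite !mxE eqxx (negbTE ij) mulr0 addr0.
rewrite (eq_bigr (fun i => (1 + x ord0 i ^+ 2)^-1)); last by move=> i /E ->.
apply: ler_wpM2r.
  by apply: prodr_ge0 => i _; rewrite invr_ge0 addr_ge0// sqr_ge0.
rewrite !mxE !eqxx mulr1.
have key (a : R) : (1 + (a + t) ^+ 2)^-1 <= 3 * (1 + a ^+ 2)^-1.
  have p (b : R) : 0 < 1 + b ^+ 2 by rewrite ltr_pwDl// sqr_ge0.
  rewrite ler_pdivlMr// ler_pdivrMl//.
  (* [3 (1 + (a + t)^2) - (1 + a^2)] equals [2 (a + 3t/2)^2 + 3/2 (1 - t^2) + 1/2]. *)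
  have h1 := sqr_ge0 (a + 3 / 2 * t).
  have h2 : 0 < (1 - t) * (1 + t) by rewrite mulr_gt0//; lra.
  by nra.
exact: key.
Qed.

(* Translation invariance: the integral of [f (x + t e_j)] does not depend on
   [t], and its derivative at [0] is the integral of the partial derivative. *)
Lemma cintegral_partial (j : 'I_n) f : schwartz f -> cintegral mu (partial j f) = 0.
Proof.
move=> Sf; pose e : 'rV[R]_n := delta_mx ord0 j.
have Sdf := schwartz_partial j Sf.
have [M M0 HM] := schwartz_decay Sf; have [N N0 HN] := schwartz_decay Sdf.
have mf := ccontinuous_cmeasurable (schwartz_ccontinuous Sf).
have mshift (t : R) : measurable_fun setT (fun x : 'rV[R]_n => x + t *: e).
  have := measurable_rV_affine 1 (t *: e).
  by under eq_fun do rewrite scale1r.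
have := @is_cderive_cintegral (fun t x => f (x + t *: e)) (fun t x => partial j f (x + t *: e)) (N * 3).
have Ecst t : cintegral mu (fun x => f (x + t *: e)) = cintegral mu f.
  by rewrite /cintegral (Rintegral_shift _ mf.1) (Rintegral_shift _ mf.2).
have E0 : (fun x => partial j f (x + 0 *: e)) = partial j f.
  by apply/funext => x; rewrite scale0r addr0.
rewrite E0 => /(_ _ _ _)[].
- move=> t t1; apply: (@cintegrable_le_decay _ (M * 3)).
    split.
      by apply: (measurableT_comp mf.1); exact: mshift.
    by apply: (measurableT_comp mf.2); exact: mshift.
  move=> x; apply: (le_trans (HM _)); rewrite -mulrA ler_wpM2l//.
  exact: decay_shift.
- by move=> t x; apply/is_cderive_line; exact: schwartz_cderive.
- move=> t x t1; apply: (le_trans (HN _)); rewrite -mulrA ler_wpM2l//.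
  exact: decay_shift.
under eq_fun do rewrite Ecst.
move=> d1 d2; have {}d2 : is_derive (0 : R) 1 (fun=> complex.Im (cintegral mu f)) (complex.Im (cintegral mu (partial j f))).
  by move: d2; under eq_fun do rewrite Ecst.
case: d1 d2 => [_ d1] [_ d2]; move: d1 d2; rewrite !derive_cst /=.
by rewrite /cintegral /= => <- <-.
Qed.

(* The Fourier transform for [sg = -1], its inverse for [sg = 1]. *)
Definition fourier_sign (sg : R) f : 'rV[R]_n -> R[i] := fun k =>
  cintegral mu (fun x => f x * expi (sg * (2 * pi) * dotp x k)).

Lemma fourierE f : fourier f = fourier_sign (-1) f.
Proof.
apply/funext => k; rewrite /fourier /fourier_sign; congr (cintegral _ _).
by apply/funext => x; rewrite mulN1r mulNr.
Qed.

Lemma dotpD x y k : dotp (x + y) k = dotp x k + dotp y k.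
Proof. by rewrite /dotp -big_split; apply: eq_bigr => i _; rewrite mxE mulrDl. Qed.

Lemma dotpZ (a : R) x k : dotp (a *: x) k = a * dotp x k.
Proof. by rewrite /dotp mulr_sumr; apply: eq_bigr => i _; rewrite mxE mulrA. Qed.

Lemma dotpC x k : dotp x k = dotp k x.
Proof. by apply: eq_bigr => i _; rewrite mulrC. Qed.

Lemma dotp_delta x (j : 'I_n) : dotp (delta_mx ord0 j) x = x ord0 j.
Proof.
rewrite /dotp (bigD1 j)//= big1 ?addr0; first by rewrite mxE !eqxx mul1r.
by move=> i ij; rewrite mxE eqxx (negbTE ij) mul0r.
Qed.

(** The character has modulus 1, so the differentiated integrand is dominated by a multiple of
    [|x_j f|], uniformly in the parameter. *)
Lemma cderive_fourier_sign (sg : R) f (j : 'I_n) k : schwartz f ->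
  is_cderive k (delta_mx ord0 j) (fourier_sign sg f)
    (fourier_sign sg (fun x => Complex 0 (sg * (2 * pi)) * ((x ord0 j)%:C%C * f x)) k).
Proof.
move=> Sf; pose c := sg * (2 * pi).
have Sg : schwartz (fun x => Complex 0 c * ((x ord0 j)%:C%C * f x)).
  exact/schwartzZ/schwartz_coord.
have [M M0 HM] := schwartz_decay Sg.
rewrite -[X in is_cderive X](addr0 k) -(scale0r (delta_mx ord0 j)).
apply/is_cderive_line.
have := @is_cderive_cintegral (fun t x => f x * expi (c * dotp x (k + t *: delta_mx ord0 j)))
  (fun t x => Complex 0 c * ((x ord0 j)%:C%C * f x) * expi (c * dotp x (k + t *: delta_mx ord0 j))) M.
rewrite /fourier_sign -/c.
rewrite [X in cintegral mu X](_ : _ = (fun x => Complex 0 c * ((x ord0 j)%:C%C * f x) * expi (c * dotp x k))); last first.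
  by apply/funext => x; rewrite scale0r addr0.
apply.
- by move=> t _; apply: schwartz_cintegrable; exact: schwartz_expi.
- move=> t x; pose a := c * dotp x k; pose b := c * x ord0 j.
  have E s : c * dotp x (k + s *: delta_mx ord0 j) = a + s * b.
    by rewrite dotpC dotpD dotpZ dotp_delta (dotpC k) mulrDr mulrCA.
  have d1 : is_derive t 1 (fun s : R => c * dotp x (k + s *: delta_mx ord0 j)) b.
    under eq_fun do rewrite E.
    apply: (is_derive_eq (is_deriveD (is_derive_cst a t 1) (is_deriveM (is_derive_id t 1) (is_derive_cst b t 1)))).
    by rewrite add0r /GRing.scale/= mulr0 add0r mulr1.
  have := is_cderiveM (is_cderive_cst t 1 (f x)) (is_cderive_expi d1).
  have -> : Complex 0 b = Complex 0 c * (x ord0 j)%:C%C.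
    by apply/eqP; rewrite eq_complex /b /=; apply/andP; split; apply/eqP; ring.
  by congr is_cderive; ring.
- by move=> t x _; rewrite Normc.normcM normc_expi mulr1.
Qed.

(** Integration by parts: the partial derivative of [f] times the character integrates to 0, and the
    product rule splits it into the two sides. *)
Lemma fourier_sign_partial (sg : R) f (j : 'I_n) k : schwartz f ->
  fourier_sign sg (partial j f) k =
  Complex 0 (- (sg * (2 * pi) * k ord0 j)) * fourier_sign sg f k.
Proof.
move=> Sf; pose c := sg * (2 * pi).
have Se := schwartz_expi c k Sf.
have := cintegral_partial j Se.
have -> : partial j (fun x => f x * expi (c * dotp x k)) =
    fun x => Complex 0 (c * k ord0 j) * (f x * expi (c * dotp x k)) + partial j f x * expi (c * dotp x k).
  apply/funext => x.
  have d1 : is_derive x (delta_mx ord0 j) (fun y => c * dotp y k) (c * k ord0 j).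
    by apply: (is_derive_eq (is_deriveZ c (is_derive_dotp x (delta_mx ord0 j) k))); rewrite dotp_delta.
  have [_ ->] := is_cderive_partial (is_cderiveM (schwartz_cderive j x Sf) (is_cderive_expi d1)).
  by rewrite addrC; congr (_ + _); rewrite mulrCA.
have i1 := schwartz_cintegrable Se.
have i2 := schwartz_cintegrable (schwartz_expi c k (schwartz_partial j Sf)).
have [_ ->] := cintegral_lin (Complex 0 (c * k ord0 j)) i1 i2.
rewrite /fourier_sign -/c => /eqP; rewrite addrC addr_eq0 => /eqP ->.
rewrite -mulNr; congr (_ * _).
by apply/eqP; rewrite eq_complex/= oppr0 !eqxx.
Qed.

Lemma normc_fourier_sign sg f M k : cmeasurable_fun f ->
  (forall x, Normc.normc (f x) <= M * decay x) ->
  Normc.normc (fourier_sign sg f k) <= 2 * M * \int[mu]_x decay x.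
Proof.
move=> mf fM; apply: cintegral_le_decay; last first.
  by move=> x; rewrite Normc.normcM normc_expi mulr1.
have [e1 e2] : cmeasurable_fun (fun x : 'rV[R]_n => expi (sg * (2 * pi) * dotp x k)).
  apply/ccontinuous_cmeasurable/ccontinuous_expi => x.
  exact: (@continuousM _ _ (cst (sg * (2 * pi))) (fun y => dotp y k) x (@cst_continuous _ _ _ x) (@continuous_dotp _ _ k x)).
case: mf => f1 f2; split.
  under eq_fun do rewrite ReM.
  by apply: measurable_funB; exact: measurable_funM.
under eq_fun do rewrite ImM.
by apply: measurable_funD; exact: measurable_funM.
Qed.

(** Each derivative contributes a factor of modulus [2 pi |k_j|], and [2 pi >= 1] is discarded. *)
Lemma fourier_sign_partials (sg : R) f (j : 'I_n) m k : schwartz f -> sg ^+ 2 = 1 ->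
  `|k ord0 j| ^+ m * Normc.normc (fourier_sign sg f k) <=
  Normc.normc (fourier_sign sg (partials (nseq m j) f) k).
Proof.
move=> Sf sg1; elim: m => [|m IH]; first by rewrite expr0 mul1r.
rewrite (_ : partials (nseq m.+1 j) f = partial j (partials (nseq m j) f))//.
rewrite fourier_sign_partial; last exact: schwartz_partials.
rewrite exprS -mulrA Normc.normcM; apply: ler_pM => //.
  by rewrite mulr_ge0 ?normc_ge0// exprn_ge0.
rewrite /= expr0n/= add0r sqrtr_sqr normrN -!mulrA normrM.
have -> : `|sg| = 1 by move/eqP: sg1; rewrite sqrf_eq1 => /orP[] /eqP ->; rewrite ?normrN normr1.
have p1 : 1 <= 2 * pi :> R by have := pi_ge2 R; lra.
by rewrite mul1r mulrA normrM ler_peMl// (ger0_norm (le_trans ler01 p1)).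
Qed.

(** The class of all transforms of Schwartz functions is stable under derivatives, continuous
    because its partial derivatives are bounded, and rapidly decreasing because each coordinate of a
    monomial is traded for a derivative of the original function. *)
Lemma schwartz_fourier_sign (sg : R) f : sg ^+ 2 = 1 -> schwartz f ->
  schwartz (fourier_sign sg f).
Proof.
move=> sg1 Sf; pose C := [set h : 'rV[R]_n -> R[i] | exists2 f, schwartz f & h = fourier_sign sg f].
have bnd h : schwartz h -> exists M, forall k, Normc.normc (fourier_sign sg h k) <= M.
  move=> Sh; have [M M0 HM] := schwartz_decay Sh.
  exists (2 * M * \int[mu]_x decay x) => k; apply: normc_fourier_sign => //.
  exact/ccontinuous_cmeasurable/schwartz_ccontinuous.
apply: (@schwartz_coind _ _ C); last by exists f.
- move=> _ [h Sh ->].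
  have /choice[M HM] (j : 'I_n) := bnd _ (schwartzZ (Complex 0 (sg * (2 * pi))) (schwartz_coord j Sh)).
  pose N := \sum_j `|M j|.
  have MN j : M j <= N.
    by rewrite (le_trans (ler_norm _))// /N (bigD1 j)//= lerDl sumr_ge0.
  split.
    apply: (@continuous_partial _ _ _ (fun j k => complex.Re (fourier_sign sg (fun x => Complex 0 (sg * (2 * pi)) * ((x ord0 j)%:C%C * h x)) k)) N).
      by move=> j k; have [] := cderive_fourier_sign sg j k Sh.
    by move=> j k; exact: le_trans (normr_Re_normc _) (le_trans (HM j k) (MN j)).
  apply: (@continuous_partial _ _ _ (fun j k => complex.Im (fourier_sign sg (fun x => Complex 0 (sg * (2 * pi)) * ((x ord0 j)%:C%C * h x)) k)) N).
    by move=> j k; have [] := cderive_fourier_sign sg j k Sh.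
  by move=> j k; exact: le_trans (normr_Im_normc _) (le_trans (HM j k) (MN j)).
- move=> _ j [h Sh ->].
  exists (fourier_sign sg (fun x => Complex 0 (sg * (2 * pi)) * ((x ord0 j)%:C%C * h x))).
    by exists (fun x => Complex 0 (sg * (2 * pi)) * ((x ord0 j)%:C%C * h x)) => //; exact/schwartzZ/schwartz_coord.
  by move=> k; exact: cderive_fourier_sign.
- move=> _ r [h Sh ->]; elim: r h Sh => [|j r IH] h Sh.
    by have [M HM] := bnd _ Sh; exists M => k; rewrite /monomial big_nil normr1 mul1r.
  have [M HM] := IH _ (schwartz_partial j Sh); exists M => k.
  apply: le_trans (HM k); rewrite /monomial big_cons normrM mulrAC.
  rewrite mulrC; apply: ler_wpM2l => //.
  by have := fourier_sign_partials j 1 k Sh sg1; rewrite expr1.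
Qed.

End fourier_of_schwartz.

(** * Fourier inversion *)

Section Rintegral_lemmas.
Context d (T : measurableType d) {R : realType}.

Lemma Rdominated_cvg (mu : {measure set T -> \bar R}) (u_ : nat -> T -> R) (u g : T -> R) :
  (forall j, measurable_fun setT (u_ j)) ->
  (forall x, u_ ^~ x @ \oo --> u x) ->
  mu.-integrable setT (EFin \o g) -> (forall j x, `|u_ j x| <= g x) ->
  mu.-integrable setT (EFin \o u) /\
  (\int[mu]_x u_ j x) @[j --> \oo] --> \int[mu]_x u x.
Proof.
move=> mu_ uu gi ug.
have mu' : measurable_fun setT u.
  by apply: (measurable_fun_cvg _ (fun x _ => uu x)).
have m1 j : measurable_fun setT (fun x => (u_ j x)%:E) by exact/measurable_EFinP.
have m2 : measurable_fun setT (EFin \o u) by exact/measurable_EFinP.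
have c1 : {ae mu, forall x, setT x -> (fun x0 => (u_ x0 x)%:E) @ \oo --> (EFin \o u) x}.
  by apply: aeW => x _; apply: cvg_EFin; [exact: nearW|exact: uu].
have b1 : {ae mu, forall x j, setT x -> (`|(u_ j x)%:E| <= (EFin \o g) x)%E}.
  by apply: aeW => x j _; rewrite /= lee_fin.
have [ui _ c] := @dominated_convergence _ _ _ mu setT measurableT
  (fun j x => (u_ j x)%:E) (EFin \o u) (EFin \o g) m1 m2 c1 gi b1.
split => //; apply: fine_cvg; rewrite fineK; first exact: c.
exact: integrable_fin_num.
Qed.

End Rintegral_lemmas.

Lemma ae_eq_integrable d (T : measurableType d) (R : realType)
    (mu : {measure set T -> \bar R}) (f g : T -> \bar R) :
  measurable_fun setT g -> ae_eq mu setT f g ->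
  mu.-integrable setT f -> mu.-integrable setT g.
Proof.
move=> mg fg fi; have mf := measurable_int _ fi.
apply/integrableP; split => //; have /integrableP[_] := fi; apply: le_lt_trans.
rewrite le_eqVlt; apply/orP; left; apply/eqP; apply: ge0_ae_eq_integral => //.
- exact: measurableT_comp.
- exact: measurableT_comp.
- by apply: filterS fg => x /[apply] ->.
Qed.

(** * Fubini for real and complex integrals *)

Section Rfubini.
Context d1 d2 (T1 : measurableType d1) (T2 : measurableType d2) {R : realType}.
Variables (m1 : {sigma_finite_measure set T1 -> \bar R}).
Variables (m2 : {sigma_finite_measure set T2 -> \bar R}).
Variable f : T1 * T2 -> R.
Hypothesis fi : (m1 \x m2)%E.-integrable setT (EFin \o f).

(** The real inner integral is [fine] of the extended one; the two agree on the sections that are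
    integrable, hence almost everywhere. *)
Lemma Rfubini_l : m1.-integrable setT (EFin \o (fun x => \int[m2]_y f (x, y))) /\
  \int[m1]_x \int[m2]_y f (x, y) = \int[(m1 \x m2)%E]_z f z.
Proof.
have Fi := integrable_fubini_F fi.
have E : ae_eq m1 setT (EFin \o (fun x => \int[m2]_y f (x, y))) (fubini_F m2 (EFin \o f)).
  apply: filterS (ae_integrable1 fi) => x xi _ /=; rewrite /Rintegral fineK//.
  exact: integrable_fin_num xi.
have mR : measurable_fun setT (EFin \o (fun x => \int[m2]_y f (x, y))).
  apply/measurable_EFinP; apply: measurableT_comp; first exact: fine_measurable.
  exact: measurable_int Fi.
split; last first.
  rewrite /Rintegral -(integral12_prod_meas1 fi); congr fine.
  by apply: ae_eq_integral => //; exact: measurable_int Fi.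
apply: (ae_eq_integrable mR _ Fi); exact: ae_eq_sym.
Qed.

Lemma Rfubini_r : m2.-integrable setT (EFin \o (fun y => \int[m1]_x f (x, y))) /\
  \int[m2]_y \int[m1]_x f (x, y) = \int[(m1 \x m2)%E]_z f z.
Proof.
have mf : measurable_fun setT (EFin \o f) by exact: measurable_int fi.
have Gi : m2.-integrable setT (fubini_G m1 (EFin \o f)).
  apply/integrableP; split; first exact: (measurable_fubini_G fi).
  apply: le_lt_trans ((integrable21ltyP m1 m2 mf).1 fi); apply: ge0_le_integral => //.
  - by apply: measurableT_comp => //; exact: (measurable_fubini_G fi).
  - apply: (measurable_fun_fubini_tonelli_G (abse \o (EFin \o f))) => //=.
    exact: measurableT_comp.
  - move=> y _; apply: le_abse_integral => //.
    exact: (measurableT_comp mf (measurable_pair2 y)).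
have E : ae_eq m2 setT (EFin \o (fun y => \int[m1]_x f (x, y))) (fubini_G m1 (EFin \o f)).
  apply: filterS (ae_integrable2 fi) => x xi _ /=; rewrite /Rintegral fineK//.
  exact: integrable_fin_num xi.
have mR : measurable_fun setT (EFin \o (fun y => \int[m1]_x f (x, y))).
  apply/measurable_EFinP; apply: measurableT_comp; first exact: fine_measurable.
  exact: measurable_int Gi.
split; last first.
  rewrite /Rintegral -(integral21_prod_meas1 fi); congr fine.
  by apply: ae_eq_integral => //; exact: measurable_int Gi.
apply: (ae_eq_integrable mR _ Gi); exact: ae_eq_sym.
Qed.

End Rfubini.

Section cfubini.
Context d1 d2 (T1 : measurableType d1) (T2 : measurableType d2) {R : realType}.
Variables (m1 : {sigma_finite_measure set T1 -> \bar R}).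
Variables (m2 : {sigma_finite_measure set T2 -> \bar R}).

Lemma cfubini (f : T1 * T2 -> R[i]) : cintegrable (m1 \x m2)%E f ->
  cintegral m1 (fun x => cintegral m2 (fun y => f (x, y))) =
  cintegral m2 (fun y => cintegral m1 (fun x => f (x, y))).
Proof.
move=> [f1 f2]; rewrite /cintegral /=; congr Complex.
  by rewrite (Rfubini_l f1).2 (Rfubini_r f1).2.
by rewrite (Rfubini_l f2).2 (Rfubini_r f2).2.
Qed.

Lemma integrable_tensor (u : T1 -> R) (v : T2 -> R) :
  m1.-integrable setT (EFin \o u) -> m2.-integrable setT (EFin \o v) ->
  (m1 \x m2)%E.-integrable setT (EFin \o (fun z => u z.1 * v z.2)).
Proof.
move=> ui vi.
have mu : measurable_fun setT u by exact/measurable_EFinP/(measurable_int m1).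
have mv : measurable_fun setT v by exact/measurable_EFinP/(measurable_int m2).
have mz : measurable_fun setT (fun z : T1 * T2 => u z.1 * v z.2).
  by apply: measurable_funM; exact: measurableT_comp.
apply/integrableP; split; first exact/measurable_EFinP.
rewrite fubini_tonelli1//; last exact/measurableT_comp/measurable_EFinP.
rewrite /fubini_F/=.
under eq_integral => x _.
  under eq_integral do rewrite normrM EFinM.
  rewrite ge0_integralZl//; last exact/measurable_EFinP/measurableT_comp.
  over.
move/integrableP : ui => [_ ui]; move/integrableP : vi => [_ vi].
rewrite ge0_integralZr//; last 2 first.
- exact/measurable_EFinP/measurableT_comp.
- exact: integral_ge0.
apply: lte_mul_pinfty => //; first exact: integral_ge0.
by rewrite ge0_fin_numE// integral_ge0.
Qed.

End cfubini.

(** * The Gaussian and its Fourier transform *)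

Section gaussian.
Context {R : realType}.

Lemma integral_gauss_scale (a : R) : 0 < a ->
  (\int[@lebesgue_measure R]_t (expR (- (a * t ^+ 2)))%:E = (Num.sqrt (pi / a))%:E)%E.
Proof.
move=> a0; have s0 : 0 < Num.sqrt a by rewrite sqrtr_gt0.
have mg : measurable_fun setT (fun t : R => (gauss_fun t)%:E).
  by apply/measurable_EFinP; exact: measurable_gauss_fun.
have := @ge0_integral_lebesgue_affine R (Num.sqrt a) 0 (fun t => (gauss_fun t)%:E) s0 mg.
rewrite integralT_gauss => H.
rewrite sqrtrM ?pi_ge0// sqrtrV ?(ltW a0)// mulrC EFinM -H; last first.
  by move=> t; rewrite lee_fin gauss_fun_ge0.
by apply: eq_integral => t _; rewrite /gauss_fun addr0 exprMn sqr_sqrtr ?(ltW a0).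
Qed.

Lemma integral_gauss_rV n (a : R) : 0 < a ->
  (\int[lebesgue_rV n]_x (expR (- (a * enorm x ^+ 2)))%:E =
   (Num.sqrt (pi / a) ^+ n)%:E)%E.
Proof.
move=> a0.
have := @ge0_integral_rV_prod R n (fun _ t => expR (- (a * t ^+ 2))).
rewrite (eq_bigr (fun=> (Num.sqrt (pi / a))%:E)); last first.
  by move=> i _; rewrite integral_gauss_scale.
rewrite prodEFin prodr_const card_ord => <-.
- apply: eq_integral => x _; rewrite -expR_sum enorm_sqr.
  by rewrite mulr_sumr -sumrN.
- move=> i; apply: continuous_measurable_fun => t.
  apply: (@continuous_comp _ _ _ (fun t : R => - (a * t ^+ 2)) expR); last exact: continuous_expR.
  apply: continuousN; apply: (@continuousM _ _ (cst a) (fun t : R => t ^+ 2)).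
    exact: cst_continuous.
  exact: exprn_continuous.
- by move=> i t; exact: expR_ge0.
Qed.

Context {n : nat}.
Local Notation mu := (@lebesgue_rV R n).

(** The factor [pi] makes the total mass 1 and the function equal to its own Fourier transform. *)
Definition gauss (x : 'rV[R]_n) : R := expR (- pi * enorm x ^+ 2).

Lemma polyfun_enorm_sqr : polyfun (fun x : 'rV[R]_n => enorm x ^+ 2).
Proof.
under eq_fun do rewrite enorm_sqr.
by apply: polyfun_sum => i; apply: polyfunX; exact: Polyfun_coord.
Qed.

Lemma schwartz_poly_gauss p : polyfun p -> schwartz (fun x : 'rV[R]_n => (p x * gauss x)%:C%C).
Proof.
move=> pp; apply: (@schwartz_expR _ _ p (fun x => - pi * enorm x ^+ 2) pi 0) => //.
- by apply: PolyfunM; [exact: Polyfun_cst|exact: polyfun_enorm_sqr].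
- exact: pi_gt0.
- by move=> x; rewrite sub0r mulNr.
Qed.

Lemma schwartz_gauss : schwartz (fun x : 'rV[R]_n => (gauss x)%:C%C).
Proof.
have := schwartz_poly_gauss (Polyfun_cst 1).
by under eq_fun do rewrite mul1r.
Qed.

Lemma gauss_gt0 x : 0 < gauss x. Proof. exact: expR_gt0. Qed.

Lemma integral_gauss : \int[mu]_x gauss x = 1.
Proof.
rewrite /Rintegral -[RHS]/(fine 1%:E); congr fine.
have := @integral_gauss_rV n pi (pi_gt0 _).
rewrite divff ?gt_eqF ?pi_gt0// sqrtr1 expr1n => <-.
by apply: eq_integral => x _; rewrite /gauss mulNr.
Qed.

Lemma is_derive_enorm_sqr (x : 'rV[R]_n) j :
  is_derive x (delta_mx ord0 j) (fun y : 'rV[R]_n => enorm y ^+ 2) (2 * x ord0 j).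
Proof.
rewrite (_ : (fun y => _) = fun y : 'rV[R]_n => dotp y y); last first.
  by apply/funext => y; rewrite enorm_sqr; apply: eq_bigr => i _; rewrite expr2.
apply/is_derive_line0.
rewrite (_ : (fun s : R => _) = fun s : R => dotp x x + (s * (2 * x ord0 j) + s * s)).
  apply: (is_derive_eq (is_deriveD (is_derive_cst (dotp x x) (0:R) 1) (is_deriveD (is_deriveM (is_derive_id (0:R) 1) (is_derive_cst (2 * x ord0 j) (0:R) 1)) (is_deriveM (is_derive_id (0:R) 1) (is_derive_id (0:R) 1))))).
  by rewrite /GRing.scale/=; ring.
apply/funext => s; rewrite dotpD dotpZ dotp_delta (dotpC x) dotpD dotpZ dotp_delta.
have -> : (x + s *: delta_mx ord0 j) ord0 j = x ord0 j + s by rewrite !mxE !eqxx mulr1.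
by move: (dotp x x) (x ord0 j) => a b; ring.
Qed.

(** The Gaussian and its transform [F] solve the same first-order equations, so [F] times
    [exp (pi |x|^2)] has zero partial derivatives and is constant. Its value at 0 is the integral of
    the Gaussian, which is 1. *)
Lemma fourier_sign_gauss (sg : R) k : sg ^+ 2 = 1 ->
  fourier_sign sg (fun x : 'rV[R]_n => (gauss x)%:C%C) k = (gauss k)%:C%C.
Proof.
move=> sg1; pose G (x : 'rV[R]_n) : R[i] := (gauss x)%:C%C.
pose F := fourier_sign sg G.
have dG x j : is_cderive x (delta_mx ord0 j) G ((- 2 * pi * x ord0 j)%:C%C * G x).
  rewrite -rmorphM; apply: is_cderive_real.
  apply: (is_derive_eq (is_derive_comp1 (is_derive_expR _) (is_deriveZ (- pi) (is_derive_enorm_sqr x j)))).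
  by rewrite /GRing.scale/= /gauss; ring.
have pG j : partial j G = fun x => (- 2 * pi)%:C%C * ((x ord0 j)%:C%C * G x).
  apply/funext => x; have [_ ->] := is_cderive_partial (dG x j).
  by rewrite rmorphM mulrA.
(* The derivative of [F] is the transform of [2 pi sg i x_j G], that is of [- sg i] times the
   partial derivative of [G]; integrating by parts gives [- 2 pi sg^2 x_j F]. *)
have dF x j : is_cderive x (delta_mx ord0 j) F ((- 2 * pi * x ord0 j)%:C%C * F x).
  have := cderive_fourier_sign sg j x schwartz_gauss; rewrite -/G -/F; congr is_cderive.
  have -> : (fun x : 'rV[R]_n => Complex 0 (sg * (2 * pi)) * ((x ord0 j)%:C%C * G x)) =
      fun x => Complex 0 (- sg) * partial j G x + 0.
    apply/funext => y; rewrite pG addr0 mulrA.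
    have -> : Complex 0 (sg * (2 * pi)) = Complex 0 (- sg) * (- 2 * pi)%:C%C.
      by apply/eqP; rewrite eq_complex /=; apply/andP; split; apply/eqP; ring.
    by rewrite !mulrA.
  have SpG := schwartz_partial j schwartz_gauss.
  have := fourier_sign_partial sg j x schwartz_gauss; rewrite -/G -/F => E.
  transitivity (Complex 0 (- sg) * fourier_sign sg (partial j G) x).
    rewrite /fourier_sign.
    have i1 := schwartz_cintegrable (schwartz_expi (sg * (2 * pi)) x SpG).
    have [i0 e0] := @cintegral_0 R _ _ mu.
    have [_] := cintegral_lin (Complex 0 (- sg)) i1 i0.
    rewrite e0 addr0 => <-; congr cintegral; apply/funext => y.
    by rewrite !addr0 -[LHS]mulrA.
  rewrite E mulrA; congr (_ * _).
  transitivity ((- 2 * pi * x ord0 j * sg ^+ 2)%:C%C : R[i]); last by rewrite sg1 mulr1.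
  by apply/eqP; rewrite eq_complex /=; apply/andP; split; apply/eqP; ring.
pose H x : R[i] := (expR (pi * enorm x ^+ 2))%:C%C * F x.
have dH x j : is_cderive x (delta_mx ord0 j) H 0.
  have de : is_derive x (delta_mx ord0 j) (fun y => expR (pi * enorm y ^+ 2)) (2 * pi * x ord0 j * expR (pi * enorm x ^+ 2)).
    apply: (is_derive_eq (is_derive_comp1 (is_derive_expR _) (is_deriveZ pi (is_derive_enorm_sqr x j)))).
    by rewrite /GRing.scale/=; ring.
  have := is_cderiveM (is_cderive_real de) (dF x j); congr is_cderive.
  by rewrite !rmorphM !rmorphN /=; ring.
have HE : H k = H 0.
  apply/eqP; rewrite eq_complex; apply/andP; split; apply/eqP.
    by apply: (@partial0_cst _ _ (fun x => complex.Re (H x))) => j x; have [] := dH x j.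
  by apply: (@partial0_cst _ _ (fun x => complex.Im (H x))) => j x; have [] := dH x j.
have e0 : enorm (0 : 'rV[R]_n) = 0.
  by rewrite /enorm big1 ?sqrtr0// => i _; rewrite mxE expr0n.
have F0 : F 0 = 1.
  rewrite /F /fourier_sign /cintegral /G.
  have d0 (x : 'rV[R]_n) : dotp x 0 = 0 by rewrite /dotp big1// => i _; rewrite mxE mulr0.
  under eq_Rintegral do rewrite d0 mulr0 ReM /= cos0 sin0 mulr1 mulr0 subr0.
  under [X in Complex _ X]eq_Rintegral do rewrite d0 mulr0 ImM /= cos0 sin0 mul0r mulr0 addr0.
  by rewrite integral_gauss Rintegral_cst// mul0r.
move: HE; rewrite /H e0 expr0n mulr0 expR0 mul1r F0 => HE.
transitivity ((gauss k)%:C%C * ((expR (pi * enorm k ^+ 2))%:C%C * F k)).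
  by rewrite mulrA -rmorphM /= /gauss -expRD mulNr addNr expR0 mul1r.
by rewrite HE mulr1.
Qed.

End gaussian.

Section complex_integrable.
Context {R : realType}.

Lemma cmeasurableM d (T : measurableType d) (f g : T -> R[i]) :
  cmeasurable_fun f -> cmeasurable_fun g -> cmeasurable_fun (fun x => f x * g x).
Proof.
move=> [f1 f2] [g1 g2]; split.
  under eq_fun do rewrite ReM.
  by apply: measurable_funB; exact: measurable_funM.
under eq_fun do rewrite ImM.
by apply: measurable_funD; exact: measurable_funM.
Qed.

Lemma cmeasurable_expi d (T : measurableType d) (f : T -> R) :
  measurable_fun setT f -> cmeasurable_fun (fun x => expi (f x) : R[i]).
Proof.
move=> mf; split.
  apply: (measurableT_comp _ mf); apply: continuous_measurable_fun; exact: continuous_cos.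
apply: (measurableT_comp _ mf); apply: continuous_measurable_fun; exact: continuous_sin.
Qed.

Lemma cmeasurable_comp d1 d2 (T1 : measurableType d1) (T2 : measurableType d2)
    (f : T2 -> R[i]) (h : T1 -> T2) : measurable_fun setT h ->
  cmeasurable_fun f -> cmeasurable_fun (fun x => f (h x)).
Proof.
by move=> mh [f1 f2]; split; [exact: (measurableT_comp f1 mh)|exact: (measurableT_comp f2 mh)].
Qed.

Lemma expiD (a b : R) : expi (a + b) = expi a * expi b.
Proof. by apply/eqP; rewrite eq_complex /= cosD sinD addrC !eqxx/= addrC. Qed.

Lemma cintegrable_dominated d (T : measurableType d) (m : {measure set T -> \bar R})
    (f : T -> R[i]) (g : T -> R) : cmeasurable_fun f ->
  m.-integrable setT (EFin \o g) -> (forall x, Normc.normc (f x) <= g x) ->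
  cintegrable m f.
Proof.
move=> [f1 f2] gi fg; split; apply: (le_integrable measurableT _ _ gi) => //.
- exact/measurable_EFinP.
- move=> x _; rewrite /= lee_fin (le_trans (normr_Re_normc _))//.
  by rewrite (le_trans (fg x))// ler_norm.
- exact/measurable_EFinP.
- move=> x _; rewrite /= lee_fin (le_trans (normr_Im_normc _))//.
  by rewrite (le_trans (fg x))// ler_norm.
Qed.

Lemma measurable_normc d (T : measurableType d) (f : T -> R[i]) :
  cmeasurable_fun f -> measurable_fun setT (fun x => Normc.normc (f x)).
Proof.
move=> mf; rewrite (_ : (fun x => _) = fun x => Num.sqrt (Normc.normc (f x) ^+ 2)).
  apply: (measurableT_comp _ (cmeasurable_normc mf)).
  by apply: continuous_measurable_fun => x; exact: sqrt_continuous.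
by apply/funext => x; rewrite sqrtr_sqr ger0_norm// normc_ge0.
Qed.

Lemma cintegrable_normc d (T : measurableType d) (m : {measure set T -> \bar R})
    (f : T -> R[i]) : cmeasurable_fun f -> cintegrable m f ->
  m.-integrable setT (EFin \o (fun x => Normc.normc (f x))).
Proof.
move=> mf [f1 f2].
have mn := measurable_normc mf.
apply: (le_integrable measurableT _ _ (integrableD measurableT (integrable_norm f1) (integrable_norm f2))).
  exact/measurable_EFinP.
move=> x _ /=; rewrite lee_fin ger0_norm ?normc_ge0// ger0_norm ?addr_ge0//.
exact: normc_le_ReIm.
Qed.

Lemma cintegralZ d (T : measurableType d) (m : {measure set T -> \bar R})
    (a : R[i]) (f : T -> R[i]) : cintegrable m f ->
  cintegral m (fun x => a * f x) = a * cintegral m f.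
Proof.
move=> fi; have [i0 e0] := @cintegral_0 R _ _ m.
have [_] := cintegral_lin a fi i0; rewrite e0 addr0 => <-.
by congr cintegral; apply/funext => x; rewrite addr0.
Qed.

Lemma cintegrableZ d (T : measurableType d) (m : {measure set T -> \bar R})
    (a : R[i]) (f : T -> R[i]) : cintegrable m f -> cintegrable m (fun x => a * f x).
Proof.
move=> fi; have [i0 _] := @cintegral_0 R _ _ m.
have [+ _] := cintegral_lin a fi i0; congr cintegrable.
by apply/funext => x; rewrite addr0.
Qed.

End complex_integrable.

(** * The inversion formula *)

Section inversion.
Context {R : realType} {n : nat}.
Local Notation mu := (@lebesgue_rV R n).
Implicit Types (f g : 'rV[R]_n -> R[i]) (x k : 'rV[R]_n).

Lemma Rintegral_affine (f : 'rV[R]_n -> R) (a : R) (b : 'rV[R]_n) : 0 < a ->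
  mu.-integrable setT (EFin \o f) ->
  \int[mu]_x f (a *: x + b) = a^-1 ^+ n * \int[mu]_x f x.
Proof.
move=> a0 fi; have mf : measurable_fun setT (EFin \o f) by exact: measurable_int fi.
have H (g : 'rV[R]_n -> \bar R) : measurable_fun setT g -> (forall x, 0 <= g x)%E ->
    (\int[mu]_x g (a *: x + b)%R = (a^-1 ^+ n)%:E * \int[mu]_x g x)%E.
  by move=> mg g0; exact: ge0_integral_rV_affine.
rewrite /Rintegral -[X in X * _]/(fine (a^-1 ^+ n)%:E) -fineM//; last exact: integrable_fin_num fi.
congr fine; rewrite integralE [in RHS]integralE muleBr//; last first.
  by apply: fin_num_adde_defl; rewrite fin_numN; exact: (integrable_fin_num measurableT (integrable_funeneg measurableT fi)).
congr (_ - _)%E.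
  rewrite -(H _ (measurable_funepos mf))//; apply: eq_integral => x _.
  by rewrite !funeposE.
rewrite -(H _ (measurable_funeneg mf))//; apply: eq_integral => x _.
by rewrite !funenegE.
Qed.

Lemma cintegral_affine f (a : R) (b : 'rV[R]_n) : 0 < a -> cintegrable mu f ->
  cintegral mu (fun x => f (a *: x + b)) = (a^-1 ^+ n)%:C%C * cintegral mu f.
Proof.
move=> a0 [f1 f2]; rewrite /cintegral (Rintegral_affine _ a0 f1) (Rintegral_affine _ a0 f2).
by apply/eqP; rewrite eq_complex /= !mul0r subr0 addr0 !eqxx.
Qed.

Lemma measurable_dotp2 : measurable_fun setT (fun z : 'rV[R]_n * 'rV[R]_n => dotp z.1 z.2).
Proof.
apply: measurable_sum => i; apply: measurable_funM.
  exact: (measurableT_comp (@measurable_rV_coord _ R n i)).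
exact: (measurableT_comp (@measurable_rV_coord _ R n i)).
Qed.

(* By Fubini, the kernel of the Fourier transform being symmetric. *)
Lemma fourier_sign_mul (sg : R) f g : cmeasurable_fun f -> cintegrable mu f ->
  cmeasurable_fun g -> cintegrable mu g ->
  cintegral mu (fun k => fourier_sign sg f k * g k) =
  cintegral mu (fun x => f x * fourier_sign sg g x).
Proof.
move=> mf fi mg gi.
pose F (z : 'rV[R]_n * 'rV[R]_n) := f z.1 * g z.2 * expi (sg * (2 * pi) * dotp z.1 z.2).
have mF : cmeasurable_fun F.
  apply: cmeasurableM; last first.
    by apply: cmeasurable_expi; apply: measurable_funM => //; exact: measurable_dotp2.
  by apply: cmeasurableM; exact: cmeasurable_comp.
have iF : cintegrable (mu \x mu)%E F.
  apply: (cintegrable_dominated mF (integrable_tensor (cintegrable_normc mf fi) (cintegrable_normc mg gi))).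
  by move=> z; rewrite !Normc.normcM normc_expi mulr1.
have iexp (u : 'rV[R]_n -> R[i]) k : cmeasurable_fun u -> cintegrable mu u ->
    cintegrable mu (fun x => u x * expi (sg * (2 * pi) * dotp x k)).
  move=> mu' ui; apply: (cintegrable_dominated _ (cintegrable_normc mu' ui)); last first.
    by move=> x; rewrite Normc.normcM normc_expi mulr1.
  apply: cmeasurableM => //; apply: cmeasurable_expi; apply: measurable_funM => //.
  by apply: continuous_measurable_rV; exact: continuous_dotp.
have := cfubini iF; rewrite /F /= => E.
transitivity (cintegral mu (fun k => cintegral mu (fun x => f x * g k * expi (sg * (2 * pi) * dotp x k)))).
  congr cintegral; apply/funext => k; rewrite mulrC /fourier_sign -cintegralZ; last exact: iexp.
  by congr cintegral; apply/funext => x; ring.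
rewrite -E; congr cintegral; apply/funext => x; rewrite /fourier_sign -cintegralZ; last exact: iexp.
by congr cintegral; apply/funext => k; rewrite (dotpC k); ring.
Qed.

(** The modulation moves the centre to [x] and the scaling is undone by substitution: a wide
    Gaussian becomes a peak of width [a] and mass 1 at [x]. *)
Lemma fourier_sign_gauss_scale (sg a : R) x y : sg ^+ 2 = 1 -> 0 < a ->
  fourier_sign sg (fun k => expi (- sg * (2 * pi) * dotp k x) * (gauss (a *: k))%:C%C) y =
  (a^-1 ^+ n)%:C%C * (gauss (a^-1 *: (y - x)))%:C%C.
Proof.
move=> sg1 a0; rewrite -(fourier_sign_gauss _ sg1) /fourier_sign.
have Su := schwartz_expi (sg * (2 * pi)) (a^-1 *: (y - x)) (@schwartz_gauss R n).
rewrite -(cintegral_affine 0 a0 (schwartz_cintegrable Su)); congr cintegral.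
apply/funext => k; rewrite addr0 mulrAC mulrC; congr (_ * _).
rewrite dotpZ !(dotpC k) dotpZ mulVKf ?gt_eqF//.
have -> : dotp (y - x) k = dotp y k - dotp x k by rewrite dotpD -scaleN1r dotpZ mulN1r.
by rewrite -expiD; congr expi; ring.
Qed.

Lemma cvg_scale_shift (x z : 'rV[R]_n) :
  (fun j : nat => j.+1%:R^-1 *: z + x) @ \oo --> x.
Proof.
rewrite -[X in _ --> X]add0r -(scale0r z); apply: cvgD; last exact: cvg_cst.
apply: cvgZr_tmp; exact: cvg_harmonic.
Qed.

Lemma gauss_le1 (k : 'rV[R]_n) : gauss k <= 1.
Proof. by rewrite -expR0 ler_expR mulNr oppr_le0 mulr_ge0 ?pi_ge0// sqr_ge0. Qed.

Lemma gauss0 : gauss (0 : 'rV[R]_n) = 1.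
Proof.
rewrite /gauss (_ : enorm 0 = 0) ?expr0n ?mulr0 ?expR0//.
by rewrite /enorm big1 ?sqrtr0// => i _; rewrite mxE expr0n.
Qed.

Lemma continuous_gauss : continuous (@gauss R n).
Proof. by have [] := schwartz_ccontinuous (@schwartz_gauss R n). Qed.

Lemma integrable_gauss : mu.-integrable setT (EFin \o @gauss R n).
Proof. by have [] := schwartz_cintegrable (@schwartz_gauss R n). Qed.

(** The widened Gaussians are at most 1 and tend to 1 pointwise: the regularization disappears in
    the limit. *)
Lemma cvg_integral_gauss_flat (u : 'rV[R]_n -> R) : mu.-integrable setT (EFin \o u) ->
  (\int[mu]_k (u k * gauss (j.+1%:R^-1 *: k))) @[j --> \oo] --> \int[mu]_k u k.
Proof.
move=> ui; have mu' : measurable_fun setT u by apply/measurable_EFinP; exact: measurable_int ui.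
have mG := continuous_measurable_rV continuous_gauss.
apply: (@Rdominated_cvg _ _ _ mu (fun j k => u k * gauss (j.+1%:R^-1 *: k)) u (fun k => `|u k|) _ _ (integrable_norm ui) _).2.
- move=> j; apply: measurable_funM => //.
  have := measurable_rV_affine j.+1%:R^-1 (0 : 'rV[R]_n); under eq_fun do rewrite addr0.
  by move=> ma; exact: (measurableT_comp mG ma).
- move=> k; suff h : u k * gauss (j.+1%:R^-1 *: k) @[j --> \oo] --> u k * gauss (0 : 'rV[R]_n).
    by move: h; rewrite gauss0 mulr1.
  apply: cvgM; first exact: cvg_cst.
  rewrite (_ : (fun j : nat => _) = gauss \o (fun j : nat => j.+1%:R^-1 *: k + 0)).
    exact: (cvg_comp _ _ (@cvg_scale_shift 0 k) (@continuous_gauss 0)).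
  by apply/funext => j /=; rewrite addr0.
- by move=> j k; rewrite normrM ler_piMr// (ger0_norm (ltW (gauss_gt0 _))) gauss_le1.
Qed.

Lemma cvg_integral_gauss_peak (u : 'rV[R]_n -> R) (M : R) x :
  continuous u -> (forall k, `|u k| <= M) ->
  (\int[mu]_z (u (j.+1%:R^-1 *: z + x) * gauss z)) @[j --> \oo] --> u x.
Proof.
move=> cu uM; have mu' := continuous_measurable_rV cu.
have mG := continuous_measurable_rV continuous_gauss.
have E : \int[mu]_z (u x * gauss z) = u x.
  by rewrite RintegralZl//; [rewrite integral_gauss mulr1|exact: integrable_gauss].
rewrite -[X in _ --> X]E.
apply: (@Rdominated_cvg _ _ _ mu (fun j z => u (j.+1%:R^-1 *: z + x) * gauss z) (fun z => u x * gauss z) (fun k => M * gauss k) _ _ _ _).2.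
- move=> j; apply: measurable_funM => //.
  exact: (measurableT_comp mu' (measurable_rV_affine _ x)).
- move=> z; apply: cvgM; last exact: cvg_cst.
  exact: (cvg_comp _ _ (@cvg_scale_shift x z) (cu x)).
- exact: (integrableZl measurableT M integrable_gauss).
- by move=> j z; rewrite normrM (ger0_norm (ltW (gauss_gt0 _))) ler_wpM2r// ltW// gauss_gt0.
Qed.

(* The multiplication formula turns the inversion integral, regularized by
   [gauss (a *: k)], into an average of [f] against a peaked Gaussian. *)
Lemma fourier_sign_regularized (sg a : R) f x : sg ^+ 2 = 1 -> schwartz f -> 0 < a ->
  cintegral mu (fun k => fourier_sign sg f k * expi (- sg * (2 * pi) * dotp k x) *
    (gauss (a *: k))%:C%C) =
  cintegral mu (fun z => f (a *: z + x) * (gauss z)%:C%C).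
Proof.
move=> sg1 Sf a0; have Sfh := schwartz_fourier_sign sg1 Sf.
set fh := fourier_sign sg f in Sfh *.
pose E k : R[i] := expi (- sg * (2 * pi) * dotp k x).
have mE : cmeasurable_fun E.
  apply: cmeasurable_expi; apply: measurable_funM => //.
  by apply: continuous_measurable_rV; exact: continuous_dotp.
have mG := ccontinuous_cmeasurable (schwartz_ccontinuous (@schwartz_gauss R n)).
have mf := ccontinuous_cmeasurable (schwartz_ccontinuous Sf).
have mfh := ccontinuous_cmeasurable (schwartz_ccontinuous Sfh).
have maff (b : R) c : measurable_fun setT (fun k : 'rV[R]_n => b *: k + c) by exact: measurable_rV_affine.
have iG := integrable_gauss.
pose g k := E k * (gauss (a *: k))%:C%C.
have mGa : cmeasurable_fun (fun k : 'rV[R]_n => (gauss (a *: k))%:C%C).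
  have := maff a 0; under eq_fun do rewrite addr0.
  by case: mG => m1 m2 ma; split => //=; exact: (measurableT_comp m1 ma).
have mg : cmeasurable_fun g by exact: cmeasurableM.
have iGa : mu.-integrable setT (EFin \o (fun k => gauss (a *: k))).
  apply/integrableP; split; first by apply/measurable_EFinP; exact: mGa.1.
  under eq_integral do rewrite /= (ger0_norm (ltW (gauss_gt0 _))).
  have mEG : measurable_fun setT (fun x : 'rV[R]_n => (gauss x)%:E) by apply/measurable_EFinP; exact: mG.1.
  rewrite (eq_integral (fun k => (gauss (a *: k + 0))%:E)); last by move=> k _; rewrite addr0.
  rewrite (ge0_integral_rV_affine 0 a0 mEG); last by move=> k; rewrite lee_fin (ltW (gauss_gt0 _)).
  have -> : (\int[mu]_x (gauss x)%:E = (\int[mu]_x gauss x)%:E)%E.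
    by rewrite /Rintegral fineK//; exact: integrable_fin_num iG.
  exact: ltry.
have gi : cintegrable mu g.
  apply: (cintegrable_dominated mg iGa) => k.
  by rewrite Normc.normcM normc_expi mul1r normcR ger0_norm// ltW// gauss_gt0.
transitivity (cintegral mu (fun y => f y * ((a^-1 ^+ n)%:C%C * (gauss (a^-1 *: (y - x)))%:C%C))).
  rewrite (_ : (fun k => _) = fun k => fh k * g k); last by apply/funext => k; rewrite [RHS]mulrA.
  rewrite fourier_sign_mul//; last exact: schwartz_cintegrable.
  congr cintegral; apply/funext => y; congr (_ * _).
  exact: fourier_sign_gauss_scale.
pose v z := f (a *: z + x) * (gauss z)%:C%C.
have [M M0 HM] := schwartz_decay Sf.
have mv : cmeasurable_fun v.
  apply: cmeasurableM; last exact: mG.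
  by case: mf => m1 m2; split; [exact: (measurableT_comp m1 (maff a x))|exact: (measurableT_comp m2 (maff a x))].
have iv : cintegrable mu v.
  apply: (@cintegrable_dominated _ _ _ mu v (fun z => M * gauss z) mv).
    exact: (integrableZl measurableT M iG).
  move=> z; rewrite Normc.normcM normcR (ger0_norm (ltW (gauss_gt0 _))) ler_wpM2r ?(ltW (gauss_gt0 _))//.
  by rewrite (le_trans (HM _))// ler_piMr// decay_le1.
have ai : 0 < a^-1 by rewrite invr_gt0.
(* Substitution [z = (y - x) / a]; its Jacobian cancels the normalization of the peak. *)
have := @cintegral_affine (fun y => (a^-1 ^+ n)%:C%C * v y) a^-1 (- a^-1 *: x) ai (cintegrableZ _ iv).
rewrite (cintegralZ _ iv) invrK mulrA -rmorphM /= -exprMn mulfV ?gt_eqF// expr1n mul1r => <-.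
congr cintegral; apply/funext => y; rewrite /v scaleNr -scalerBr scalerA mulfV ?gt_eqF// scale1r subrK.
by rewrite mulrCA.
Qed.

(** The regularized identity for [a = 1 / (j + 1)] has two limits: the inversion integral on the
    flat side, [f x] on the peaked side. *)
Lemma fourier_sign_inversion (sg : R) f x : sg ^+ 2 = 1 -> schwartz f ->
  fourier_sign (- sg) (fourier_sign sg f) x = f x.
Proof.
move=> sg1 Sf; have Sfh := schwartz_fourier_sign sg1 Sf.
have mfh := ccontinuous_cmeasurable (schwartz_ccontinuous Sfh).
have [M M0 HM] := schwartz_decay Sf.
have fM k : Normc.normc (f k) <= M by rewrite (le_trans (HM k))// ler_piMr// decay_le1.
have [ifE1 ifE2] := schwartz_cintegrable (schwartz_expi (- sg * (2 * pi)) x Sfh).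
have [cf1 cf2] := schwartz_ccontinuous Sf.
have j0 (j : nat) : 0 < j.+1%:R^-1 :> R by rewrite invr_gt0.
apply/eqP; rewrite eq_complex; apply/andP; split; apply/eqP.
  have h2 := @cvg_integral_gauss_peak _ M x cf1 (fun k => le_trans (normr_Re_normc _) (fM k)).
  apply: (cvg_unique _ (cvg_integral_gauss_flat ifE1)) => /=; first exact: Rhausdorff.
  apply: cvg_trans h2; apply: near_eq_cvg; apply: nearW => j.
  have := congr1 (@complex.Re R) (fourier_sign_regularized x sg1 Sf (j0 j)); rewrite /cintegral /= => e.
  transitivity (\int[mu]_z complex.Re (f (j.+1%:R^-1 *: z + x) * (gauss z)%:C%C)).
    by apply: eq_Rintegral => z _; rewrite ReM /= mulr0 subr0.
  rewrite -e; apply: eq_Rintegral => z _.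
  by rewrite mulr0 subr0.
have h2 := @cvg_integral_gauss_peak _ M x cf2 (fun k => le_trans (normr_Im_normc _) (fM k)).
apply: (cvg_unique _ (cvg_integral_gauss_flat ifE2)) => /=; first exact: Rhausdorff.
apply: cvg_trans h2; apply: near_eq_cvg; apply: nearW => j.
have := congr1 (@complex.Im R) (fourier_sign_regularized x sg1 Sf (j0 j)); rewrite /cintegral /= => e.
transitivity (\int[mu]_z complex.Im (f (j.+1%:R^-1 *: z + x) * (gauss z)%:C%C)).
  by apply: eq_Rintegral => z _; rewrite ImM /= mulr0 add0r.
rewrite -e; apply: eq_Rintegral => z _.
by rewrite mulr0 add0r.
Qed.

End inversion.

(** * Uniqueness of the function representing a Fourier transform *)

Section boxes.
Context {R : realType} {n : nat}.
Implicit Types (a b c r x : 'rV[R]_n).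

Definition obox a b : set 'rV[R]_n := [set x | forall i, a ord0 i < x ord0 i < b ord0 i].

Lemma measurable_obox a b : measurable (obox a b).
Proof.
rewrite (_ : obox a b = [set x : 'rV[R]_n | forall i, `]a ord0 i, b ord0 i[%classic (x ord0 i)]).
  by apply: (@measurable_rV_box _ R n (fun i => `]a ord0 i, b ord0 i[%classic)) => i.
by apply/seteqP; split => x H i; have := H i; rewrite /= in_itv.
Qed.

Lemma oboxI a b a' b' : obox a b `&` obox a' b' =
  obox (\row_i Num.max (a ord0 i) (a' ord0 i)) (\row_i Num.min (b ord0 i) (b' ord0 i)).
Proof.
apply/seteqP; split => x.
  move=> [H H'] i; rewrite !mxE gt_max lt_min.
  by move: (H i) (H' i) => /andP[-> ->] /andP[-> ->].
move=> H; split => i; have := H i; rewrite !mxE gt_max lt_min.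
  by move=> /andP[/andP[-> _] /andP[-> _]].
by move=> /andP[/andP[_ ->] /andP[_ ->]].
Qed.

Definition cube (N : nat) : set 'rV[R]_n := obox (const_mx (- N%:R)) (const_mx N%:R).

Lemma bigcup_cube : \bigcup_N cube N = setT.
Proof.
apply/seteqP; split => // x _.
pose S := \sum_i `|x ord0 i|; exists (Num.truncn S).+1 => // i; rewrite !mxE.
rewrite -ltr_norml; apply: le_lt_trans (truncnS_gt _).
by rewrite /S (bigD1 i)//= lerDl sumr_ge0.
Qed.

Lemma nondecreasing_cube : nondecreasing_seq cube.
Proof.
move=> N M NM; apply/subsetPset => x H i; have := H i; rewrite !mxE => /andP[h1 h2].
have NM' : N%:R <= M%:R :> R by rewrite ler_nat.
by rewrite (le_lt_trans _ h1) ?lerN2// (lt_le_trans h2).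
Qed.

(** A slab [u < x_i < v] is the union of the boxes whose other sides are []-N, N[], and the slabs
    generate the sigma-algebra. *)
Lemma measurable_rV_obox : @measurable _ 'rV[R]_n `<=` <<s [set A | exists a b, A = obox a b] >>.
Proof.
set G := [set A | _].
apply: smallest_sub; first exact: smallest_sigma_algebra.
move=> A; rewrite -bigcup_seq /= => -[i _] [Y mY <-]; rewrite setTI.
suff : measurable_fun setT ((fun x : 'rV[R]_n => x ord0 i) : g_sigma_algebraType G -> R).
  by move=> /(_ measurableT Y mY); rewrite setTI.
apply: (measurability _ (RGenOpens.measurableE R)).
move=> _ [_ [u [v ->]] <-]; rewrite setTI.
pose a (N : nat) : 'rV[R]_n := \row_j if j == i then u else - N%:R.
pose b (N : nat) : 'rV[R]_n := \row_j if j == i then v else N%:R.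
rewrite (_ : _ @^-1` _ = \bigcup_N obox (a N) (b N)).
  by apply: bigcup_measurable => N _; apply: sub_sigma_algebra; exists (a N), (b N).
apply/seteqP; split => x /=; rewrite in_itv/=.
  move=> uxv; have : setT x by []; rewrite -bigcup_cube => -[N _ HN].
  exists N => // j; rewrite !mxE; case: eqP => [->//|_].
  by have := HN j; rewrite !mxE.
by move=> [N _ /(_ i)]; rewrite !mxE eqxx.
Qed.

(** Dynkin's argument: boxes are stable under intersection and generate, so a lambda-system that
    contains them contains every measurable set. *)
Lemma measurable_rV_ind (P : set (set 'rV[R]_n)) : P setT ->
  (forall A B, B `<=` A -> P A -> P B -> P (A `\` B)) ->
  (forall F : (set 'rV[R]_n)^nat, nondecreasing_seq F -> (forall k, P (F k)) ->
    P (\bigcup_k F k)) ->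
  (forall a b, P (obox a b)) -> forall A, measurable A -> P A.
Proof.
move=> PT PD PU PB A /measurable_rV_obox mA.
apply: (@lambda_system_subset _ [set A | exists a b, A = obox a b] _ setT P) mA => //.
- by move=> _ _ [a [b ->]] [a' [b' ->]]; rewrite oboxI; eexists; eexists.
- by move=> _ [a [b ->]]; exact: PB.
Qed.

(** With [s = |q|], half of the power absorbs the factor: [(j + 1) s^(j+1)] is at most a geometric
    sum, hence at most [1 / (1 - s)]. The other half tends to 0. *)
Lemma cvg_mulrn_exprn (q : R) : `|q| < 1 -> (fun j : nat => - j.+1%:R * q ^+ (2 * j.+1)) @ \oo --> (0 : R).
Proof.
move=> q1; set s := `|q| in q1; have s0 : 0 <= s by exact: normr_ge0.
have E (j : nat) : `|- j.+1%:R * q ^+ (2 * j.+1)| <= (1 - s)^-1 * s ^+ j.+1.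
  rewrite normrM normrN normr_nat normrX -/s mul2n -addnn exprD mulrA.
  rewrite ler_wpM2r ?exprn_ge0// -[leRHS]mul1r ler_pdivlMr ?subr_gt0//.
  have h : j.+1%:R * s ^+ j.+1 <= \sum_(i < j.+1) s ^+ i.
    rewrite -[X in X%:R](card_ord j.+1) mulr_natl -sumr_const.
    apply: ler_sum => i _; apply: ler_wiXn2l => //; [exact: ltW|exact: ltnW].
  rewrite mulrC; apply: (le_trans (ler_wpM2l _ h)); first by rewrite subr_ge0 ltW.
  by rewrite -opprB mulNr -subrX1 opprB gerBl exprn_ge0.
apply/norm_cvg0P.
apply: (@squeeze_cvgr _ _ _ _ (cst 0) (fun j => (1 - s)^-1 * s ^+ j.+1)).
- by apply: nearW => j; rewrite normr_ge0 E.
- exact: cvg_cst.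
- rewrite -[X in _ --> X](mulr0 (1 - s)^-1); apply: cvgMl_tmp.
  rewrite (cvg_shiftS (fun j => s ^+ j)); apply: cvg_expr.
  by rewrite ger0_norm.
Qed.

Section bump.
Variables (c r : 'rV[R]_n) (r_gt0 : forall i, 0 < r ord0 i).

Let u (i : 'I_n) x := (r ord0 i)^-1 * (x ord0 i + (- c ord0 i)).

(* Tends to the indicator of the box: the factor [j.+1] makes the limit 0 also
   on the boundary, where [u i x ^+ 2 = 1] for some [i]. *)
Definition bump (j : nat) x : R := expR (\sum_(i < n) - j.+1%:R * u i x ^+ (2 * j.+1)).

(** A Gaussian majorant common to all [bump j], from [(j + 1) t^(j+1) >= t - 1] with [t = u_i^2].
    Being itself a Schwartz function, it can serve as a dominating test function. *)
Definition bump_bound x : R := expR (\sum_(i < n) (1 + (- 1) * u i x ^+ 2)).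

Let polyfun_u i : polyfun (u i).
Proof.
apply: PolyfunM; first exact: Polyfun_cst.
by apply: PolyfunD; [exact: Polyfun_coord|exact: Polyfun_cst].
Qed.

Let bumpexp_le j x : \sum_(i < n) - j.+1%:R * u i x ^+ (2 * j.+1) <=
  \sum_(i < n) (1 + (- 1) * u i x ^+ 2).
Proof.
apply: ler_sum => i _; set t := u i x; rewrite exprM.
have t0 : 0 <= t ^+ 2 by exact: sqr_ge0.
have j1 : 1 <= j.+1%:R :> R by rewrite ler1n.
have h : t ^+ 2 - 1 <= (t ^+ 2) ^+ j.+1.
  have [t1|t1] := leP 1 (t ^+ 2).
    apply: (le_trans (_ : _ <= t ^+ 2)); first by rewrite gerBl.
    by rewrite -[leLHS]expr1 ler_weXn2l.
  by apply: (@le_trans _ _ 0); [rewrite subr_le0 ltW|rewrite exprn_ge0].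
rewrite mulN1r mulNr lerNl opprD opprK addrC (le_trans h)//.
by rewrite ler_peMl// exprn_ge0.
Qed.

(** A rate at most [1 / (2 r_i^2)] for every [i]: half of each quadratic term gives the decay, the
    other half absorbs the shift by the centre. *)
Let K := (2 * (1 + \sum_i r ord0 i ^+ 2))^-1.

Let K_gt0 : 0 < K.
Proof. by rewrite invr_gt0 mulr_gt0// ltr_pwDl// sumr_ge0// => i _; exact: sqr_ge0. Qed.

Let bound_le x : \sum_(i < n) (1 + (- 1) * u i x ^+ 2) <=
  \sum_(i < n) (1 + (c ord0 i / r ord0 i) ^+ 2) - K * enorm x ^+ 2.
Proof.
rewrite enorm_sqr mulr_sumr -sumrB; apply: ler_sum => i _.
rewrite mulN1r -addrA lerD2l /u.
set t := x ord0 i; set s := c ord0 i; have ri := r_gt0 i; set q := r ord0 i in ri *.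
have Kq : K <= (2 * q ^+ 2)^-1.
  rewrite /K lef_pV2 ?posrE ?mulr_gt0 ?exprn_gt0//; last first.
    by rewrite ltr_pwDl// sumr_ge0// => k _; exact: sqr_ge0.
  rewrite ler_pM2l// (bigD1 i)//= addrCA lerDl addr_ge0// sumr_ge0// => k _.
  exact: sqr_ge0.
apply: (@le_trans _ _ ((s / q) ^+ 2 - (2 * q ^+ 2)^-1 * t ^+ 2)); last first.
  by rewrite lerD2l lerN2 ler_wpM2r// sqr_ge0.
rewrite -subr_ge0.
have -> : (s / q) ^+ 2 - (2 * q ^+ 2)^-1 * t ^+ 2 - - (q^-1 * (t - s)) ^+ 2 =
  (2 * q ^+ 2)^-1 * (t - 2 * s) ^+ 2.
  by field; rewrite gt_eqF.
by rewrite mulr_ge0 ?sqr_ge0// invr_ge0 mulr_ge0// sqr_ge0.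
Qed.

Lemma schwartz_bump j : schwartz (fun x => (bump j x)%:C%C).
Proof.
have := @schwartz_expR R n (fun=> 1) (fun x => \sum_(i < n) - j.+1%:R * u i x ^+ (2 * j.+1)) K
  (\sum_(i < n) (1 + (c ord0 i / r ord0 i) ^+ 2)) (Polyfun_cst 1).
under [in X in _ -> _ -> _ -> X]eq_fun do rewrite mul1r.
apply=> // [|x]; last exact: le_trans (bumpexp_le j x) (bound_le x).
apply: polyfun_sum => i; apply: PolyfunM; first exact: Polyfun_cst.
exact: polyfunX.
Qed.

Lemma schwartz_bump_bound : schwartz (fun x => (bump_bound x)%:C%C).
Proof.
have := @schwartz_expR R n (fun=> 1) (fun x => \sum_(i < n) (1 + (- 1) * u i x ^+ 2)) K
  (\sum_(i < n) (1 + (c ord0 i / r ord0 i) ^+ 2)) (Polyfun_cst 1).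
under [in X in _ -> _ -> _ -> X]eq_fun do rewrite mul1r.
apply=> //; apply: polyfun_sum => i; apply: PolyfunD; first exact: Polyfun_cst.
by apply: PolyfunM; [exact: Polyfun_cst|exact: polyfunX].
Qed.

Lemma bump_ge0 j x : 0 <= bump j x. Proof. exact: expR_ge0. Qed.

Lemma bump_le j x : bump j x <= bump_bound x.
Proof. by rewrite ler_expR bumpexp_le. Qed.

Let unit_le x i : (c - r) ord0 i < x ord0 i < (c + r) ord0 i = (`|u i x| < 1).
Proof.
rewrite !mxE /u normrM normfV (gtr0_norm (r_gt0 i)) mulrC ltr_pdivrMr ?r_gt0// mul1r.
by rewrite ltr_distl.
Qed.

Lemma bump_bound_ge1 x : obox (c - r) (c + r) x -> 1 <= bump_bound x.
Proof.
move=> H; rewrite -expR0 ler_expR sumr_ge0// => i _.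
have := H i; rewrite unit_le mulN1r subr_ge0 => u1.
by rewrite -[u i x ^+ 2]real_normK ?num_real// expr_le1// ltW.
Qed.

(** Inside the box every term of the exponent tends to 0. Elsewhere, boundary included, some term is
    at most [- (j + 1)] and the others are nonpositive. *)
Lemma bump_cvg x : (fun j => bump j x) @ \oo --> (\1_(obox (c - r) (c + r)) x : R).
Proof.
have cvgexp : (fun j : nat => expR (- j.+1%:R) : R) @ \oo --> (0 : R).
  by have := @cvgn_expR R; rewrite -(cvg_shiftS (fun j => expR (- j%:R))).
have [xB|xB] := pselect (obox (c - r) (c + r) x).
  rewrite indicE mem_set// -expR0; apply: continuous_cvg; first exact: continuous_expR.
  have : forall s : seq 'I_n, (fun j : nat => \sum_(i <- s) (- j.+1%:R * u i x ^+ (2 * j.+1))) @ \oo --> (0 : R).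
    elim=> [|i s IH]; first by under eq_fun do rewrite big_nil; exact: cvg_cst.
    rewrite (_ : (fun j : nat => _) = (fun j : nat => - j.+1%:R * u i x ^+ (2 * j.+1) +
      \sum_(i <- s) (- j.+1%:R * u i x ^+ (2 * j.+1)))); last by apply/funext => j; rewrite big_cons.
    rewrite -[X in _ --> X]addr0; apply: cvgD IH.
    by apply: cvg_mulrn_exprn; rewrite -unit_le.
  by apply.
rewrite indicE memNset//.
have [i Hi] : exists i, 1 <= `|u i x|.
  apply: contrapT => /forallNP H; apply: xB => i; rewrite unit_le ltNge; exact/negP.
apply: (@squeeze_cvgr _ _ _ _ (cst 0) _ _ _ _ _ cvgexp); last exact: cvg_cst.
apply: nearW => j; rewrite bump_ge0/= ler_expR (bigD1 i)//=.
rewrite (le_trans (_ : _ <= - j.+1%:R * u i x ^+ (2 * j.+1)))//.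
  by rewrite gerDl sumr_le0// => k _; rewrite mulNr oppr_le0 mulr_ge0// exprM exprn_ge0// sqr_ge0.

rewrite mulNr lerN2 ler_peMr// exprM exprn_ege1// -real_normK ?num_real// exprn_ege1//.
Qed.

End bump.

End boxes.

Lemma cvg_indic_bigcup T (R : realType) (F : (set T)^nat) x : nondecreasing_seq F ->
  (fun k => \1_(F k) x : R) @ \oo --> (\1_(\bigcup_k F k) x : R).
Proof.
move=> ndF; have [[k _ Fk]|nF] := pselect ((\bigcup_k F k) x); last first.
  rewrite indicE memNset//; apply: cvg_near_cst; apply: nearW => k.
  by rewrite indicE memNset// => Fk; apply: nF; exists k.
rewrite indicE mem_set; last by exists k.
apply: cvg_near_cst; exists k => // j /= kj.
by rewrite indicE mem_set//; move/subsetPset: (ndF _ _ kj); exact.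
Qed.

(** * Functions orthogonal to all Schwartz functions *)

Section fundamental_lemma.
Context {R : realType} {n : nat}.
Local Notation mu := (lebesgue_rV n : {measure set 'rV[R]_n -> \bar R}).

Lemma indic_obox_bump (a b : 'rV[R]_n) : (forall i, a ord0 i < b ord0 i) ->
  exists c r : 'rV[R]_n, [/\ forall i, 0 < r ord0 i, a = c - r & b = c + r].
Proof.
move=> ab; exists (2^-1 *: (a + b)), (2^-1 *: (b - a)).
split; first by move=> i; rewrite !mxE mulr_gt0// subr_gt0.
  by apply/rowP => i; rewrite !mxE; lra.
by apply/rowP => i; rewrite !mxE; lra.
Qed.

Lemma obox_eq0 (a b : 'rV[R]_n) i : b ord0 i <= a ord0 i -> obox a b = set0.
Proof.
move=> ba; apply/seteqP; split => // x /(_ i) /andP[h1 h2].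
by have := lt_trans h1 h2; rewrite ltNge ba.
Qed.

Lemma integrable_mul_indic (d : 'rV[R]_n -> R) A : measurable A ->
  mu.-integrable setT (EFin \o d) -> mu.-integrable setT (EFin \o (fun x => d x * \1_A x)).
Proof.
move=> mA di; have md : measurable_fun setT d by apply/measurable_EFinP; exact: measurable_int di.
apply: (le_integrable measurableT _ _ di).
  by apply/measurable_EFinP; apply: measurable_funM => //; exact: measurable_indic.
move=> x _; rewrite /= lee_fin normrM ler_piMr// indicE.
by case: (_ \in _); rewrite ?normr1 ?normr0.
Qed.

(** The sets over which [d] integrates to 0 form a lambda-system. The total integral is a separate
    hypothesis because such a system must contain the whole space. *)
Lemma ae_eq0_box (d : 'rV[R]_n -> R) : mu.-integrable setT (EFin \o d) ->
  (forall a b, \int[mu]_x (d x * \1_(obox a b) x) = 0) ->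
  \int[mu]_x d x = 0 ->
  {ae mu, forall x, d x = 0}.
Proof.
move=> di dB dT.
have md : measurable_fun setT d by apply/measurable_EFinP; exact: measurable_int di.
have dA A : measurable A -> \int[mu]_x (d x * \1_A x) = 0.
  move=> mA; suff : measurable A /\ \int[mu]_x (d x * \1_A x) = 0 by case.
  move: A mA; apply: measurable_rV_ind.
  - by split => //; under eq_Rintegral do rewrite indicT mulr1.
  - move=> A B BA [mA A0] [mB B0]; split; first exact: measurableD.
    rewrite -[RHS](subrr (0 : R)) -{1}A0 -B0 -RintegralB//; try exact: integrable_mul_indic.
    apply: eq_Rintegral => x _; rewrite -mulrBr; congr (_ * _).
    rewrite !indicE in_setD; have [xB|xB] := boolP (x \in B); last by rewrite andbT subr0.
    have -> : x \in A by rewrite inE in xB; rewrite inE; exact: BA.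
    by rewrite subrr.
  - move=> F ndF HF; have mF k : measurable (F k) by case: (HF k).
    split; first exact: bigcup_measurable.
    have mI k : measurable_fun setT (fun x => d x * \1_(F k) x : R).
      by apply: measurable_funM => //; exact: measurable_indic.
    have [|||_ h] := @Rdominated_cvg _ _ _ mu (fun k x => d x * \1_(F k) x)
      (fun x => d x * \1_(\bigcup_k F k) x) (fun x => `|d x|) mI.
    + by move=> x; apply: cvgMl_tmp; exact: cvg_indic_bigcup.
    + exact: integrable_norm.
    + move=> k x; rewrite normrM ler_piMr// indicE.
      by case: (_ \in _); rewrite ?normr1 ?normr0.
    apply: (cvg_unique _ h) => /=; first exact: Rhausdorff.
    by apply: cvg_near_cst; apply: nearW => k; exact: (proj2 (HF k)).
  - by move=> a b; split => //; exact: measurable_obox.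
have : ae_eq mu setT (EFin \o d) (cst 0%E).
  apply: integral_ae_eq => // E _ mE; rewrite integral0.
  rewrite integral_mkcond -[RHS]/(0%:E) -(dA E mE) /Rintegral fineK.
    by apply: eq_integral => x _; rewrite patchE indicE /=; case: (_ \in _); rewrite ?mulr1 ?mulr0.
  by apply: integrable_fin_num => //; exact: integrable_mul_indic.
by apply: filterS => x /(_ I) /= [].
Qed.

(** Integrals over boxes are limits of integrals against bumps. As [d] may fail to be integrable on
    the whole space, it is first cut off by a cube; a box within a cube is again a box, and the
    cubes exhaust the space. *)
Lemma ae_eq0_schwartz (d : 'rV[R]_n -> R) : measurable_fun setT d ->
  (forall p : 'rV[R]_n -> R, schwartz (fun x => (p x)%:C%C) ->
    mu.-integrable setT (EFin \o (fun x => d x * p x)) /\ \int[mu]_x (d x * p x) = 0) ->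
  {ae mu, forall x, d x = 0}.
Proof.
move=> md dp.
have box a b : mu.-integrable setT (EFin \o (fun x => d x * \1_(obox a b) x)) /\
    \int[mu]_x (d x * \1_(obox a b) x) = 0.
  have [[i ba]|ab] := pselect (exists i, b ord0 i <= a ord0 i).
    rewrite (obox_eq0 ba); under eq_fun do rewrite indic0 mulr0.
    by split; [exact: integrable0|rewrite Rintegral_cst// mul0r].
  have {ab} [c [r [r0 -> ->]]] : exists c r : 'rV[R]_n, [/\ forall i, 0 < r ord0 i, a = c - r & b = c + r].
    by apply: indic_obox_bump => i; rewrite ltNge; apply/negP => h; apply: ab; exists i.
  have mb j : measurable_fun setT (bump c r j).
    by have [] := ccontinuous_cmeasurable (schwartz_ccontinuous (schwartz_bump c r0 j)).
  have [gi _] := dp _ (schwartz_bump_bound c r0).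
  have mdb j : measurable_fun setT (fun x => d x * bump c r j x) by exact: measurable_funM.
  have [|||ui h] := @Rdominated_cvg _ _ _ mu (fun j x => d x * bump c r j x)
    (fun x => d x * \1_(obox (c - r) (c + r)) x) (fun x => `|d x * bump_bound c r x|) mdb.
  - by move=> x; apply: cvgMl_tmp; exact: bump_cvg.
  - exact: (integrable_norm gi).
  - move=> j x; rewrite !normrM ler_wpM2l// (ger0_norm (bump_ge0 _ _ _ _)).
    exact: le_trans (bump_le _ _ _ _) (ler_norm _).
  split => //.
  apply: (cvg_unique _ h) => /=; first exact: Rhausdorff.
  by apply: cvg_near_cst; apply: nearW => k; exact: (proj2 (dp _ (schwartz_bump c r0 k))).
have cubes N : {ae mu, forall x, d x * \1_(@cube R n N) x = 0}.
  apply: ae_eq0_box; [exact: (proj1 (box _ _))| |exact: (proj2 (box _ _))].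
  move=> a b; rewrite -[RHS](proj2 (box (\row_i Num.max ((const_mx (- N%:R) : 'rV[R]_n) ord0 i) (a ord0 i))
    (\row_i Num.min ((const_mx N%:R : 'rV[R]_n) ord0 i) (b ord0 i)))).
  apply: eq_Rintegral => x _; rewrite -mulrA; congr (_ * _).
  by rewrite -oboxI indicI.
have := ae_foralln cubes; apply: filterS => x H.
have : setT x by []; rewrite -(@bigcup_cube R n) => -[N _ xN].
by have := H N; rewrite indicE mem_set// mulr1.
Qed.

Lemma is_fourier_of_ae (T : functional R n) g g' : is_fourier_of T g -> is_fourier_of T g' ->
  {ae mu, forall x, g x = g' x}.
Proof.
move=> [mg Hg] [mg' Hg'].
have H (p : 'rV[R]_n -> R) : schwartz (fun x => (p x)%:C%C) ->
   cintegrable mu (fun k => -1 * (g k * (p k)%:C%C) + g' k * (p k)%:C%C) /\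
   cintegral mu (fun k => -1 * (g k * (p k)%:C%C) + g' k * (p k)%:C%C) = 0.
  move=> Sp; have [i1 e1] := Hg _ Sp; have [i2 e2] := Hg' _ Sp.
  have [i12 e12] := cintegral_lin (-1) i1 i2; split => //.
  by rewrite e12 -e1 -e2 mulN1r addNr.
have [m1 m2] := mg; have [m1' m2'] := mg'.
have h1 : {ae mu, forall x, complex.Re (g' x) - complex.Re (g x) = 0}.
  apply: ae_eq0_schwartz => [|p Sp]; first exact: measurable_funB.
  have [[i _] e] := H p Sp.
  have E : (fun x => (complex.Re (g' x) - complex.Re (g x)) * p x) =
    (fun k => complex.Re (-1 * (g k * (p k)%:C%C) + g' k * (p k)%:C%C)).
    apply/funext => x; case: (g x) (g' x) => [a b] [a' b'] /=; simpc; rewrite /=; ring.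
  rewrite E; split => //.
  by have := congr1 (@complex.Re R) e.
have h2 : {ae mu, forall x, complex.Im (g' x) - complex.Im (g x) = 0}.
  apply: ae_eq0_schwartz => [|p Sp]; first exact: measurable_funB.
  have [[_ i] e] := H p Sp.
  have E : (fun x => (complex.Im (g' x) - complex.Im (g x)) * p x) =
    (fun k => complex.Im (-1 * (g k * (p k)%:C%C) + g' k * (p k)%:C%C)).
    apply/funext => x; case: (g x) (g' x) => [a b] [a' b'] /=; simpc; rewrite /=; ring.
  rewrite E; split => //.
  by have := congr1 (@complex.Im R) e.
apply: filterS2 h1 h2 => x /eqP; rewrite subr_eq0 => /eqP r1 /eqP; rewrite subr_eq0 => /eqP r2.
by case: (g x) (g' x) r1 r2 => [a b] [a' b'] /= -> ->.
Qed.

End fundamental_lemma.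

(** * Distributions with a given Fourier transform *)

Section weights.
Context {R : realType} {n : nat}.
Local Notation mu := (lebesgue_rV n : {measure set 'rV[R]_n -> \bar R}).
Implicit Types (u g phi : 'rV[R]_n -> R[i]) (k x : 'rV[R]_n) (s : R).

Lemma ae_enorm_gt0 : (0 < n)%N -> {ae mu, forall x, 0 < enorm x}.
Proof.
move=> n0; apply: filterS (@ae_coord_neq0 R n) => x /(_ (Ordinal n0)) x0.
by apply: lt_le_trans (le_coord_enorm x (Ordinal n0)); rewrite normr_gt0.
Qed.

Lemma measurable_enorm_powR s : measurable_fun setT (fun k : 'rV[R]_n => enorm k `^ s).
Proof.
by apply: (measurableT_comp (measurable_powR s)); exact: measurable_enorm.
Qed.

Lemma measurable_normc2_enorm u s : cmeasurable_fun u ->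
  measurable_fun setT (fun k => Normc.normc (u k) ^+ 2 * enorm k `^ s).
Proof.
move=> mu_; apply: measurable_funM; first exact: cmeasurable_normc.
exact: measurable_enorm_powR.
Qed.

(* Schwartz functions are bounded by multiples of [decay]: this is what makes
   [phi |-> \int u phi] a tempered distribution. *)
Definition tame u := cmeasurable_fun u /\
  mu.-integrable setT (EFin \o (fun k => Normc.normc (u k) * decay k)).

(** The square of [a t - d], divided by [t], is nonnegative, and [d^2 <= d]. *)
Lemma le_young (a t d : R) : 0 <= a -> 0 < t -> 0 <= d -> d <= 1 ->
  a * d <= a ^+ 2 * t + t^-1 * d.
Proof.
move=> a0 t0 d0 d1.
have h : t^-1 * d ^+ 2 <= t^-1 * d by rewrite ler_pM2l ?invr_gt0// expr2 ler_piMl.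
have ti : 0 < t^-1 by rewrite invr_gt0.
have e : t * t^-1 = 1 by rewrite mulfV// gt_eqF.
have : 0 <= t^-1 * (a * t - d) ^+ 2 by rewrite mulr_ge0 ?sqr_ge0// ltW.
have -> : t^-1 * (a * t - d) ^+ 2 = (a ^+ 2 * t + t^-1 * d ^+ 2) - 2 * (a * d).
  by field; rewrite gt_eqF.
have : 0 <= a * d by rewrite mulr_ge0.
lra.
Qed.

(** Young's inequality with [t = |k|^s] bounds [|u|] times [decay] by [|u|^2 |k|^s] plus [|k|^(-s)]
    times [decay], and the last term is integrable because [s < n]. *)
Lemma tame_weight u s : 0 < s -> s < n%:R -> cmeasurable_fun u ->
  (\int[mu]_k (Normc.normc (u k) ^+ 2 * enorm k `^ s)%:E < +oo)%E -> tame u.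
Proof.
move=> s0 sn mu_ uy; have n0 : (0 < n)%N by rewrite -(ltr0n R) (lt_trans s0).
split=> //; have mn := measurable_normc mu_.
have mnd : measurable_fun setT (fun k => Normc.normc (u k) * decay k).
  by apply: measurable_funM => //; exact: measurable_decay.
apply/integrableP; split; first exact/measurable_EFinP.
apply: (@le_lt_trans _ _ (\int[mu]_k ((Normc.normc (u k) ^+ 2 * enorm k `^ s)%:E +
    (enorm k `^ (- s) * decay k)%:E))%E).
  apply: ae_ge0_le_integral => //.
  - by do 2 apply: measurableT_comp => //.
  - move=> k _; rewrite adde_ge0// lee_fin mulr_ge0 ?sqr_ge0 ?powR_ge0//.
    exact: ltW (decay_gt0 _).
  - apply: emeasurable_funD; apply/measurable_EFinP; first exact: measurable_normc2_enorm.
    by apply: measurable_funM; [exact: measurable_enorm_powR|exact: measurable_decay].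
  apply: filterS (ae_enorm_gt0 n0) => k k0 _.
  rewrite /= lee_fin ger0_norm ?mulr_ge0 ?normc_ge0 ?(ltW (decay_gt0 _))//.
  rewrite powRN le_young ?normc_ge0 ?powR_gt0 ?decay_le1//.
  exact: ltW (decay_gt0 _).
rewrite ge0_integralD//=.
- by rewrite lte_add_pinfty// lty_integral_enormN_decay// ltW.
- by move=> k _; rewrite lee_fin mulr_ge0 ?sqr_ge0 ?powR_ge0.
- by apply/measurable_EFinP; exact: measurable_normc2_enorm.
- by move=> k _; rewrite lee_fin mulr_ge0 ?powR_ge0// ltW// decay_gt0.
- apply/measurable_EFinP.
  by apply: measurable_funM; [exact: measurable_enorm_powR|exact: measurable_decay].
Qed.

Lemma tame_cintegrable u phi M : tame u -> cmeasurable_fun phi ->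
  (forall k, Normc.normc (phi k) <= M * decay k) ->
  cintegrable mu (fun k => u k * phi k).
Proof.
move=> [mu_ ui] mp pM.
have Mi : mu.-integrable setT (EFin \o (fun k => M * (Normc.normc (u k) * decay k))).
  exact: (integrableZl measurableT M ui).
apply: (cintegrable_dominated _ Mi); first exact: cmeasurableM.
by move=> k; rewrite Normc.normcM mulrCA ler_wpM2l// normc_ge0.
Qed.

Lemma tame_cintegral_le u phi M : tame u -> cmeasurable_fun phi ->
  (forall k, Normc.normc (phi k) <= M * decay k) ->
  Normc.normc (cintegral mu (fun k => u k * phi k)) <=
  2 * M * \int[mu]_k (Normc.normc (u k) * decay k).
Proof.
move=> tu mp pM; have [i1 i2] := tame_cintegrable tu mp pM; have [mu_ ui] := tu.
have h (v : 'rV[R]_n -> R) : mu.-integrable setT (EFin \o v) ->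
    (forall k, `|v k| <= Normc.normc (u k * phi k)) ->
    `|\int[mu]_k v k| <= M * \int[mu]_k (Normc.normc (u k) * decay k).
  move=> vi vu; apply: (le_trans (le_normr_Rintegral _ vi)) => //.
  rewrite -RintegralZl//; apply: le_Rintegral => //.
  - exact: (integrable_norm vi).
  - exact: (integrableZl measurableT M ui).
  - by move=> k _; rewrite (le_trans (vu k))// Normc.normcM mulrCA ler_wpM2l// normc_ge0.
apply: (le_trans (normc_le_ReIm _)) => /=; rewrite -mulrA (mulrDl 1 1) !mul1r; apply: lerD.
  by apply: h => // k; exact: normr_Re_normc.
by apply: h => // k; exact: normr_Im_normc.
Qed.

Lemma tame_schwartz u phi : tame u -> schwartz phi -> cintegrable mu (fun k => u k * phi k).
Proof.
move=> tu Sp; have [M _ pM] := schwartz_decay Sp.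
exact: tame_cintegrable tu (ccontinuous_cmeasurable (schwartz_ccontinuous Sp)) pM.
Qed.

(* The inverse Fourier transform of [u], by duality. *)
Definition ift_dist u : functional R n := fun phi =>
  if `[< schwartz phi >] then cintegral mu (fun k => u k * fourier_sign 1 phi k) else 0.

Lemma sqrN11 : (-1) ^+ 2 = 1 :> R. Proof. by rewrite sqrrN expr1n. Qed.

Lemma ift_distE u phi : schwartz phi ->
  ift_dist u phi = cintegral mu (fun k => u k * fourier_sign 1 phi k).
Proof. by move=> Sp; rewrite /ift_dist; case: asboolP. Qed.

Lemma is_fourier_of_ift u : tame u -> is_fourier_of (ift_dist u) u.
Proof.
move=> tu; split=> [|phi Sp]; first by case: tu.
split; first exact: tame_schwartz.
have Sf : schwartz (fourier phi) by rewrite fourierE; exact: schwartz_fourier_sign sqrN11 Sp.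
rewrite ift_distE//; congr cintegral; apply/funext => k; congr (_ * _).
have := @fourier_sign_inversion R n (-1) phi k sqrN11 Sp.
by rewrite opprK fourierE.
Qed.

Lemma fourier_sign_lin sg a phi psi : schwartz phi -> schwartz psi ->
  fourier_sign sg (fun x => a * phi x + psi x) =
  (fun k => a * fourier_sign sg phi k + fourier_sign sg psi k).
Proof.
move=> Sp Sq; apply/funext => k.
have i1 := schwartz_cintegrable (schwartz_expi (sg * (2 * pi)) k Sp).
have i2 := schwartz_cintegrable (schwartz_expi (sg * (2 * pi)) k Sq).
have [_ <-] := cintegral_lin a i1 i2; congr cintegral; apply/funext => x.
by rewrite [LHS]mulrDl -[X in X + _]mulrA.
Qed.

(** [le_decay] is used twice: on derivatives of [phi], to bound their integrals, and on the
    transform, whose [k_i^(2n)] multiples are controlled by transforms of those derivatives. Order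
    [2 n] in both indices therefore suffices. *)
Lemma fourier_sign_le_decay sg phi (d : R) : sg ^+ 2 = 1 -> schwartz phi ->
  (forall r s : seq 'I_n, (size r <= 2 * n)%N -> (size s <= 2 * n)%N ->
    (seminorm r s phi < d%:E)%E) ->
  forall k, Normc.normc (fourier_sign sg phi k) <=
    (2 ^+ n * (1 + n%:R)) * (2 * ((2 ^+ n * (1 + n%:R)) * d) * \int[mu]_x decay x) * decay k.
Proof.
move=> sg1 Sp Hd k; set C : R := 2 ^+ n * (1 + n%:R).
have Hd' (r s : seq 'I_n) x : (size r <= 2 * n)%N -> (size s <= 2 * n)%N ->
    `|monomial r x| * Normc.normc (partials s phi x) <= d.
  move=> rn sn; rewrite -lee_fin; apply/ltW; apply: le_lt_trans (Hd r s rn sn).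
  by apply: ereal_sup_ubound; exists x => //; rewrite Normc.normcM normcR.
have Hs (s : seq 'I_n) : (size s <= 2 * n)%N -> forall x, Normc.normc (partials s phi x) <= C * d * decay x.
  move=> sn x; apply: le_decay => [|| i]; first exact: normc_ge0.
    by have := Hd' [::] s x isT sn; rewrite /monomial big_nil normr1 mul1r.
  by apply: Hd' => //; rewrite size_nseq.
have HF (s : seq 'I_n) : (size s <= 2 * n)%N -> Normc.normc (fourier_sign sg (partials s phi) k) <=
    2 * (C * d) * \int[mu]_x decay x.
  move=> sn; apply: normc_fourier_sign; last exact: Hs.
  exact: ccontinuous_cmeasurable (schwartz_ccontinuous (schwartz_partials s Sp)).
apply: le_decay => [|| i]; first exact: normc_ge0.
  exact: (HF [::]).
rewrite monomial_nseq normrX.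
by apply: le_trans (fourier_sign_partials _ _ _ Sp sg1) _; apply: HF; rewrite size_nseq.
Qed.

Lemma tempered_ift u : tame u -> tempered (ift_dist u).
Proof.
move=> tu; split.
- move=> a phi psi Sp Sq; rewrite !ift_distE//; last exact: schwartz_lin.
  have i1 := tame_schwartz tu (schwartz_fourier_sign (expr1n _ 2) Sp).
  have i2 := tame_schwartz tu (schwartz_fourier_sign (expr1n _ 2) Sq).
  have [_ <-] := cintegral_lin a i1 i2; congr cintegral; apply/funext => k.
  by rewrite fourier_sign_lin// mulrDr mulrCA.
- move=> e e0; set C : R := 2 ^+ n * (1 + n%:R).
  set B := \int[mu]_k (Normc.normc (u k) * decay k).
  have B0 : 0 <= B by apply: Rintegral_ge0 => k _; rewrite mulr_ge0 ?normc_ge0// ltW// decay_gt0.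
  have C0 : 0 <= C by rewrite mulr_ge0 ?exprn_ge0// addr_ge0.
  set D : R := \int[mu]_x decay x.
  have D0 : 0 <= D by apply: Rintegral_ge0 => k _; rewrite ltW// decay_gt0.
  pose q := 2 * (C * (2 * C * D)) * B.
  have q0 : 0 <= q by rewrite !mulr_ge0.
  (* [q] is the constant of the resulting estimate for [d = 1]; the added 1 covers [q = 0] and makes
     the final bound strict. *)
  exists (2 * n)%N, (e / (q + 1)); split; first by rewrite divr_gt0// ltr_wpDl.
  move=> phi Sp Hd; rewrite ift_distE//.
  have h := fourier_sign_le_decay (expr1n _ 2) Sp Hd.
  have mS := ccontinuous_cmeasurable (schwartz_ccontinuous (schwartz_fourier_sign (expr1n _ 2) Sp)).
  apply: (le_lt_trans (tame_cintegral_le tu mS h)); rewrite -/B -/C -/D.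
  have -> : 2 * (C * (2 * (C * (e / (q + 1))) * D)) * B = q * (e / (q + 1)).
    by rewrite /q; ring.
  by rewrite mulrCA gtr_pMr// ltr_pdivrMr ?ltr_wpDl// mul1r ltrDl.
- by move=> phi nS; rewrite /ift_dist; case: asboolP.
Qed.

(** Every Schwartz function is the transform of its inverse transform, so [g] fixes the values of
    [T]. Hence identities between elements of the spaces reduce to identities between functions. *)
Lemma fourier_inj_dist (T : functional R n) g : tempered T -> is_fourier_of T g ->
  T = ift_dist g.
Proof.
move=> [_ _ T0] [_ Tg]; apply/funext => phi.
have [Sp|nSp] := pselect (schwartz phi); last by rewrite T0// /ift_dist; case: asboolP.
have Sf := schwartz_fourier_sign (expr1n R 2) Sp.
rewrite ift_distE// -(proj2 (Tg _ Sf)); congr T; apply/funext => x.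
by rewrite fourierE fourier_sign_inversion// expr1n.
Qed.

Lemma ae_eq_cintegral (f g : 'rV[R]_n -> R[i]) : cmeasurable_fun f -> cmeasurable_fun g ->
  {ae mu, forall x, f x = g x} -> cintegral mu f = cintegral mu g.
Proof.
move=> [f1 f2] [g1 g2] fg; rewrite /cintegral /Rintegral; congr Complex; congr fine.
  apply: ae_eq_integral => //; [exact/measurable_EFinP|exact/measurable_EFinP|].
  by apply: filterS fg => x -> _.
apply: ae_eq_integral => //; [exact/measurable_EFinP|exact/measurable_EFinP|].
by apply: filterS fg => x -> _.
Qed.

Lemma ift_dist_ae u v : cmeasurable_fun u -> cmeasurable_fun v ->
  {ae mu, forall x, u x = v x} -> ift_dist u = ift_dist v.
Proof.
move=> mu_ mv uv; apply/funext => phi.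
have [Sp|nSp] := pselect (schwartz phi); last by rewrite /ift_dist; case: asboolP.
have mS := ccontinuous_cmeasurable (schwartz_ccontinuous (schwartz_fourier_sign (expr1n _ 2) Sp)).
rewrite !ift_distE//; apply: ae_eq_cintegral; [exact: cmeasurableM|exact: cmeasurableM|].
by apply: filterS uv => x ->.
Qed.

(** The multiplication formula moves the transform from [phi] onto the inverse transform of the test
    function, where inversion cancels it. *)
Lemma dist_of_schwartz phi : schwartz phi -> dist_of phi = ift_dist (fourier phi).
Proof.
move=> Sp; apply/funext => psi.
have [Sq|nSq] := pselect (schwartz psi); last by rewrite /ift_dist /dist_of; case: asboolP.
rewrite ift_distE// /dist_of; case: asboolP => // _.
have S1 := schwartz_fourier_sign (expr1n R 2) Sq.
have ci f : schwartz f -> cmeasurable_fun f /\ cintegrable mu f.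
  by move=> Sf; split; [exact: ccontinuous_cmeasurable (schwartz_ccontinuous Sf)|exact: schwartz_cintegrable].
have [m1 i1] := ci _ Sp; have [m2 i2] := ci _ S1.
rewrite fourierE fourier_sign_mul//; congr cintegral; apply/funext => x.
by rewrite fourier_sign_inversion// expr1n.
Qed.

Lemma tame_of_schwartz phi : schwartz phi -> tame phi.
Proof.
move=> Sp; have mp := ccontinuous_cmeasurable (schwartz_ccontinuous Sp).
have [M M0 pM] := schwartz_decay Sp; split => //.
apply: (integrable_le_decay (M := M)).
  by apply: measurable_funM; [exact: measurable_normc|exact: measurable_decay].
move=> x; rewrite ger0_norm ?mulr_ge0 ?normc_ge0 ?(ltW (decay_gt0 _))//.
by rewrite ler_wpM2r ?(ltW (decay_gt0 _))// (le_trans (pM x))// ler_piMr// decay_le1.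
Qed.

End weights.

(** * Density of the Schwartz functions *)

Import HBNNSimple.

Section density.
Context {R : realType} {n : nat}.
Local Notation mu := (lebesgue_rV n : {measure set 'rV[R]_n -> \bar R}).
Implicit Types (f g : 'rV[R]_n -> R) (x : 'rV[R]_n).
Variables (s : R) (s0 : 0 <= s).
Let w x := enorm x `^ s.

Let w0 x : 0 <= w x. Proof. exact: powR_ge0. Qed.

Let sqrw_ge0 (a : R) x : 0 <= a ^+ 2 * w x. Proof. by rewrite mulr_ge0// sqr_ge0. Qed.

Let mw : measurable_fun setT w. Proof. exact: measurable_enorm_powR. Qed.

Lemma schwartz_polyfun (p : 'rV[R]_n -> R) phi : polyfun p -> schwartz phi ->
  schwartz (fun x => (p x)%:C%C * phi x).
Proof.
move=> pp; elim: pp phi => {p} [c|i|p q _ IHp _ IHq|p q _ IHp _ IHq] phi Sp.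
- exact: schwartzZ.
- exact: schwartz_coord.
- have := schwartz_lin 1 (IHp _ Sp) (IHq _ Sp).
  congr schwartz; apply/funext => x.
  by rewrite mul1r -mulrDl -rmorphD.
- have := IHp _ (IHq _ Sp); congr schwartz; apply/funext => x.
  by rewrite mulrA -rmorphM.
Qed.

Lemma enorm_powR_le x : w x <= (1 + enorm x ^+ 2) ^+ (Num.truncn s).+1.
Proof.
have e0 := enorm_ge0 x; rewrite /w; have [e1|e1] := leP (enorm x) 1.
  apply: (@le_trans _ _ 1); last by rewrite exprn_ege1// lerDl sqr_ge0.
  have := @ge0_ler_powR R s s0 (enorm x) 1; rewrite powR1; apply => //; exact: ler01.
apply: (@le_trans _ _ (enorm x `^ (Num.truncn s).+1%:R)).
  by rewrite ler_powR ?(ltW e1)// ltW// truncnS_gt.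
rewrite powR_mulrn// lerXn2r ?nnegrE ?addr_ge0 ?sqr_ge0//.
by rewrite (@le_trans _ _ (enorm x ^+ 2))// ?lerDr// -[leLHS]expr1 ler_weXn2l// ltW.
Qed.

(** One factor [|phi|] is bounded; the other, times a polynomial majorant of the weight, is again a
    Schwartz function up to modulus and is dominated by [decay]. *)
Lemma schwartz_weight phi : schwartz phi ->
  mu.-integrable setT (EFin \o (fun x => Normc.normc (phi x) ^+ 2 * w x)).
Proof.
move=> Sp; pose p x := (1 + enorm x ^+ 2) ^+ (Num.truncn s).+1.
have pp : polyfun p.
  by apply: polyfunX; apply: PolyfunD; [exact: Polyfun_cst|exact: polyfun_enorm_sqr].
have [M M0 HM] := schwartz_decay Sp; have [N N0 HN] := schwartz_decay (schwartz_polyfun pp Sp).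
have mp := ccontinuous_cmeasurable (schwartz_ccontinuous Sp).
apply: (integrable_le_decay (M := M * N)); first exact: measurable_normc2_enorm.
move=> x; rewrite ger0_norm ?sqrw_ge0//.
have p0 : 0 <= p x by rewrite exprn_ge0// addr_ge0 ?sqr_ge0.
have {}HN : Normc.normc (phi x) * p x <= N * decay x.
  by have := HN x; rewrite Normc.normcM normcR ger0_norm// mulrC.
have h1 : Normc.normc (phi x) <= M.
  by rewrite (le_trans (HM x))// ler_piMr// decay_le1.
rewrite expr2 -mulrA -mulrA; apply: ler_pM => //; [exact: normc_ge0|by rewrite mulr_ge0 ?normc_ge0|].
by apply: le_trans HN; rewrite ler_wpM2l ?normc_ge0// enorm_powR_le.
Qed.

(** Closure of the real Schwartz functions in weighted L^2. Squared distances avoid roots, at the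
    price of factors 2 in sums. *)
Definition approximable f := measurable_fun setT f /\ forall e : R, 0 < e ->
  exists p, schwartz (fun x => (p x)%:C%C : R[i]) /\ (\int[mu]_x ((f x - p x) ^+ 2 * w x)%:E < e%:E)%E.

Lemma schwartz_measurable p : schwartz (fun x => (p x)%:C%C : R[i]) -> measurable_fun setT p.
Proof. by move=> Sp; have [] := ccontinuous_cmeasurable (schwartz_ccontinuous Sp). Qed.

Lemma integral_sqr_lin_lt a f g (c d : R) : measurable_fun setT f -> measurable_fun setT g ->
  (\int[mu]_x ((f x) ^+ 2 * w x)%:E < c%:E)%E ->
  (\int[mu]_x ((g x) ^+ 2 * w x)%:E < d%:E)%E ->
  (\int[mu]_x ((a * f x + g x) ^+ 2 * w x)%:E < (2 * a ^+ 2 * c + 2 * d)%:E)%E.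
Proof.
move=> mf mg fc gd.
have mq (h : 'rV[R]_n -> R) : measurable_fun setT h -> measurable_fun setT (fun x => (h x ^+ 2 * w x)%:E).
  move=> mh; apply/measurable_EFinP; apply: measurable_funM => //; exact: measurable_funX.
have q0 (h : 'rV[R]_n -> R) x : (0 <= (h x ^+ 2 * w x)%:E)%E by rewrite lee_fin mulr_ge0// sqr_ge0.
apply: (@le_lt_trans _ _ (\int[mu]_x ((2 * a ^+ 2)%:E * ((f x) ^+ 2 * w x)%:E + 2%:E * ((g x) ^+ 2 * w x)%:E))%E).
  apply: ge0_le_integral => //.
  - by move=> x _; rewrite lee_fin.
  - by apply: mq; apply: measurable_funD => //; exact: measurable_funM.
  - apply: emeasurable_funD; apply: measurable_funeM; exact: mq.
  - move=> x _; rewrite -!EFinM -EFinD lee_fin.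
    have -> : 2 * a ^+ 2 * (f x ^+ 2 * w x) + 2 * (g x ^+ 2 * w x) =
      (a * f x + g x) ^+ 2 * w x + (a * f x - g x) ^+ 2 * w x by ring.
    by rewrite lerDl mulr_ge0// sqr_ge0.
have a20 : (0 <= (2 * a ^+ 2)%:E :> \bar R)%E by rewrite lee_fin mulr_ge0// sqr_ge0.
rewrite ge0_integralD//; last 4 first.
- by move=> x _; rewrite mule_ge0.
- by apply: measurable_funeM; exact: mq.
- by move=> x _; rewrite mule_ge0.
- by apply: measurable_funeM; exact: mq.
rewrite !ge0_integralZl//; [|exact: mq..].
have -> : (2 * a ^+ 2 * c + 2 * d)%:E = ((2 * a ^+ 2)%:E * c%:E + 2%:E * d%:E)%E.
  by rewrite -!EFinM -EFinD.
have F0 : (0 <= \int[mu]_x ((f x) ^+ 2 * w x)%:E)%E by exact: integral_ge0.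
have ff : (\int[mu]_x ((f x) ^+ 2 * w x)%:E)%E \is a fin_num.
  by rewrite ge0_fin_numE// (lt_trans fc)// ltry.
apply: lee_ltD => //.
- by rewrite fin_numM.
- by apply: lee_wpmul2l => //; exact: ltW.
- by rewrite lte_pmul2l.
Qed.

Lemma approximable_lin a f g : approximable f -> approximable g ->
  approximable (fun x => a * f x + g x).
Proof.
move=> [mf Hf] [mg Hg]; split; first by apply: measurable_funD => //; exact: measurable_funM.
move=> e e0; have a0 : 0 < 2 * a ^+ 2 + 1 by rewrite ltr_wpDl// mulr_ge0// sqr_ge0.
(* The quarter makes room for the factor 2 of [integral_sqr_lin_lt], and [2 a^2 + 1] stays positive
   when [a] is 0. *)
have [p [Sp Hp]] := Hf (e / 4 / (2 * a ^+ 2 + 1)) ltac:(by rewrite !divr_gt0).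
have [q [Sq Hq]] := Hg (e / 4) ltac:(by rewrite !divr_gt0).
exists (fun x => a * p x + q x); split.
  have := schwartz_lin a%:C%C Sp Sq; congr schwartz; apply/funext => x.
  by rewrite -rmorphM -rmorphD.
have mp := schwartz_measurable Sp; have mq := schwartz_measurable Sq.
have := integral_sqr_lin_lt a (measurable_funB mf mp) (measurable_funB mg mq) Hp Hq.
under eq_integral do rewrite /=.
move=> h; apply: (le_lt_trans _ (lt_le_trans h _)).
  rewrite le_eqVlt; apply/orP; left; apply/eqP; apply: eq_integral => x _ /=.
  congr (_%:E); ring.
rewrite lee_fin.
have h1 : 2 * a ^+ 2 * (e / 4 / (2 * a ^+ 2 + 1)) <= e / 4.
  by rewrite mulrCA ler_piMr ?divr_ge0 ?ltW// ltr_pdivrMr// mul1r ltrDl.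
lra.
Qed.

Lemma approximable_lim f : measurable_fun setT f -> (forall e : R, 0 < e -> exists g,
  approximable g /\ (\int[mu]_x ((f x - g x) ^+ 2 * w x)%:E < e%:E)%E) -> approximable f.
Proof.
move=> mf H; split => // e e0; have [g [[mg Hg] fg]] := H (e / 4) ltac:(by rewrite divr_gt0).
have [p [Sp gp]] := Hg (e / 4) ltac:(by rewrite divr_gt0).
exists p; split => //; have mp := schwartz_measurable Sp.
have h := integral_sqr_lin_lt 1 (measurable_funB mf mg) (measurable_funB mg mp) fg gp.
apply: (le_lt_trans _ (lt_le_trans h _)); last by rewrite lee_fin; lra.
rewrite le_eqVlt; apply/orP; left; apply/eqP; apply: eq_integral => x _ /=.
congr (_%:E); ring.
Qed.

(** Dominated convergence for the squared distance: [|f - u_j| <= 2 g], so [4 g^2] times the weight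
    is a majorant. *)
Lemma approximable_dominated (u : nat -> 'rV[R]_n -> R) f g :
  (forall j, approximable (u j)) -> (forall x, u ^~ x @ \oo --> f x) ->
  mu.-integrable setT (EFin \o (fun x => g x ^+ 2 * w x)) ->
  (forall j x, `|u j x| <= g x) -> approximable f.
Proof.
move=> Hu uf gi ug; have mu_ j : measurable_fun setT (u j) by case: (Hu j).
have mf : measurable_fun setT f by apply: (measurable_fun_cvg _ (fun x _ => uf x)).
apply: approximable_lim => // e e0.
have fg x : `|f x| <= g x.
  by apply: (cvgr_to_le (cvg_norm (uf x))); exact: nearW.
have md j : measurable_fun setT (fun x => (f x - u j x) ^+ 2 * w x).
  by apply: measurable_funM => //; apply: measurable_funX; exact: measurable_funB.
have bnd j x : `|(f x - u j x) ^+ 2 * w x| <= 4 * (g x ^+ 2 * w x).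
  rewrite ger0_norm ?sqrw_ge0// mulrA ler_wpM2r//.
  have -> : 4 * g x ^+ 2 = (2 * g x) ^+ 2 by ring.
  rewrite -real_normK ?num_real// lerXn2r ?nnegrE ?mulr_ge0//.
    exact: le_trans (fg x).
  by rewrite (le_trans (ler_normB _ _))// mulrDl !mul1r lerD.
have [|||_ h] := @Rdominated_cvg _ _ _ mu (fun j x => (f x - u j x) ^+ 2 * w x) (fun=> 0)
    (fun x => 4 * (g x ^+ 2 * w x)) md.
- move=> x; have c1 : (fun j => f x - u j x) @ \oo --> (0 : R).
    by rewrite -(subrr (f x)); apply: cvgB; [exact: cvg_cst|exact: uf].
  by have := cvgM (cvgM c1 c1) (cvg_cst (w x)); rewrite !mul0r; exact.
- exact: (integrableZl measurableT 4 gi).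
- exact: bnd.
move: h; rewrite Rintegral_cst// mul0r => /cvgr0Pnorm_lt/(_ e e0)[j _ /(_ j (leqnn j))] h.
exists (u j); split => //.
have ui : mu.-integrable setT (EFin \o (fun x => (f x - u j x) ^+ 2 * w x)).
  apply: (le_integrable measurableT _ _ (integrableZl measurableT 4 gi)).
    exact/measurable_EFinP.
  by move=> x _; rewrite /= lee_fin (le_trans (bnd j x))// ler_norm.
move: h; rewrite ger0_norm; last by apply: Rintegral_ge0 => x _; rewrite mulr_ge0 ?sqr_ge0.
rewrite -lte_fin; apply: le_lt_trans; rewrite /Rintegral fineK//.
by apply: integrable_fin_num => //.
Qed.

Lemma approximable_schwartz p : schwartz (fun x => (p x)%:C%C : R[i]) -> approximable p.
Proof.
move=> Sp; split; first exact: schwartz_measurable.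
move=> e e0; exists p; split => //.
by rewrite integral0_eq// => x _; rewrite subrr expr0n mul0r.
Qed.

Lemma approximable0 : approximable (fun=> 0).
Proof. exact: approximable_schwartz (@schwartz0 R n). Qed.

Lemma approximable_obox (a b : 'rV[R]_n) : approximable (\1_(obox a b)).
Proof.
have [[i ba]|ab] := pselect (exists i, b ord0 i <= a ord0 i).
  rewrite (obox_eq0 ba) (_ : \1_set0 = fun=> 0); first exact: approximable0.
  by apply/funext => x; rewrite indic0.
have {ab} [c [r [r0 -> ->]]] : exists c r : 'rV[R]_n, [/\ forall i, 0 < r ord0 i, a = c - r & b = c + r].
  by apply: indic_obox_bump => i; rewrite ltNge; apply/negP => h; apply: ab; exists i.
apply: (@approximable_dominated (bump c r) _ (bump_bound c r)).
- by move=> j; apply: approximable_schwartz; exact: schwartz_bump.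
- by move=> x; exact: bump_cvg.
- have := schwartz_weight (schwartz_bump_bound c r0).
  congr (mu.-integrable setT (EFin \o _)); apply/funext => x.
  by rewrite normcR real_normK ?num_real.
- by move=> j x; rewrite ger0_norm ?bump_ge0// bump_le.
Qed.

(** The cube is there because an unbounded set may have infinite weighted norm, and its [bump_bound]
    dominates all the indicators at once. The index [N.+1] gives the cube a positive half-side. *)
Lemma approximable_indic N A : measurable A -> approximable (\1_(A `&` cube N.+1)).
Proof.
move: A; apply: measurable_rV_ind.
- by rewrite setTI; exact: approximable_obox.
- move=> A B BA aA aB; have := approximable_lin (-1) aB aA.
  congr approximable; apply/funext => x; rewrite !indicE (in_setI _ (A `\` B)) in_setD !in_setI.
  have : (x \in B) -> (x \in A) by rewrite !inE; exact: BA.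
  case: (x \in A); case: (x \in B); case: (x \in cube _) => //= H; rewrite ?mulr0 ?addr0 ?add0r ?mulr1 ?addNr//.
  by have := H isT.
- move=> F ndF HF.
  have r0 (i : 'I_n) : 0 < (const_mx N.+1%:R : 'rV[R]_n) ord0 i by rewrite mxE.
  have E : @cube R n N.+1 = obox (0 - const_mx N.+1%:R) (0 + const_mx N.+1%:R).
    by rewrite /cube; congr obox; apply/rowP => i; rewrite !mxE ?add0r.
  apply: (@approximable_dominated (fun k => \1_(F k `&` cube N.+1)) _ (bump_bound 0 (const_mx N.+1%:R))) => //.
  + move=> x; rewrite setI_bigcupl; apply: cvg_indic_bigcup => i j ij.
    by apply/subsetPset; apply: setSI; apply/subsetPset; exact: ndF.
  + have := schwartz_weight (schwartz_bump_bound 0 r0).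
    congr (mu.-integrable setT (EFin \o _)); apply/funext => x.
    by rewrite normcR real_normK ?num_real.
  + move=> j x; rewrite indicE; have [xF|xF] := boolP (x \in _); last by rewrite normr0 expR_ge0.
    rewrite normr1 bump_bound_ge1// -E.
    by move: xF; rewrite inE => -[].
- by move=> a b; rewrite oboxI; exact: approximable_obox.
Qed.

Lemma approximable_sum (I : Type) (l : seq I) (h : I -> 'rV[R]_n -> R) :
  (forall i, approximable (h i)) -> approximable (fun x => \sum_(i <- l) h i x).
Proof.
move=> ah; elim: l => [|i l IH].
  rewrite (_ : (fun _ => _) = fun=> 0); first exact: approximable0.
  by apply/funext => x; rewrite big_nil.
have := approximable_lin 1 (ah i) IH; congr approximable; apply/funext => x.
by rewrite big_cons mul1r.
Qed.

(** [f] is the limit, dominated by itself, of simple functions cut off by growing cubes; each of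
    these is a finite combination of indicators of bounded sets. *)
Lemma approximable_ge0 f : measurable_fun setT f -> (forall x, 0 <= f x) ->
  mu.-integrable setT (EFin \o (fun x => f x ^+ 2 * w x)) -> approximable f.
Proof.
move=> mf f0 fi; have mEf : measurable_fun setT (EFin \o f) by exact/measurable_EFinP.
pose h j : 'rV[R]_n -> R := nnsfun_approx measurableT mEf j.
have hf x : (fun j => h j x) @ \oo --> f x.
  have := @cvg_nnsfun_approx _ _ _ _ measurableT _ mEf (fun x _ => f0 x) x I.
  by move=> /fine_cvg.
have h0 j x : 0 <= h j x by exact: fun_ge0.
have hle j x : h j x <= f x.
  rewrite -(cvg_lim (@Rhausdorff R) (hf x)); apply: nondecreasing_cvgn_le.
    by move=> i k ik; exact: (lefP _ _ (nd_nnsfun_approx measurableT mEf ik)).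
  by apply/cvg_ex; exists (f x).
apply: (@approximable_dominated (fun j x => h j x * \1_(cube j.+1) x) _ f) => //.
- move=> j.
  rewrite (_ : (fun _ => _) = fun x => \sum_(y <- finmap.enum_fset (fset_set (range (h j))))
      (y * \1_(h j @^-1` [set y] `&` cube j.+1) x + (fun=> 0) x)).
    apply: approximable_sum => y; apply: approximable_lin; last exact: approximable0.
    by apply: approximable_indic; exact: measurable_funPTI.
  apply/funext => x; rewrite /h [X in X * _]fimfunE fsbig_finite// mulr_suml; apply: eq_bigr => y _.
  by rewrite addr0 -mulrA indicI.
- move=> x; rewrite -[X in _ --> X]mulr1; apply: cvgM; first exact: hf.
  have : setT x by []; rewrite -(@bigcup_cube R n) => -[N _ xN].
  apply: cvg_near_cst; exists N => // j /= Nj; rewrite indicE mem_set//.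
  by move/subsetPset: (@nondecreasing_cube R n _ _ (leqW Nj)); exact.
- move=> j x; rewrite normrM (ger0_norm (h0 _ _)) indicE.
  by case: (_ \in _); rewrite ?normr1 ?mulr1// normr0 mulr0.
Qed.

Lemma approximable_weight f : measurable_fun setT f ->
  mu.-integrable setT (EFin \o (fun x => f x ^+ 2 * w x)) -> approximable f.
Proof.
move=> mf fi.
have H (g : 'rV[R]_n -> R) : measurable_fun setT g -> (forall x, 0 <= g x) ->
    (forall x, g x <= `|f x|) -> approximable g.
  move=> mg g0 gf; apply: approximable_ge0 => //.
  apply: (le_integrable measurableT _ _ fi).
    by apply/measurable_EFinP; apply: measurable_funM => //; exact: measurable_funX.
  move=> x _; rewrite /= lee_fin !ger0_norm ?sqrw_ge0// ler_wpM2r//.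
  by rewrite -[leRHS]real_normK ?num_real// lerXn2r ?nnegrE.
have := approximable_lin (-1) (H (fun x => Num.max (- f x) 0) _ _ _) (H (fun x => Num.max (f x) 0) _ _ _).
have E : (fun x => -1 * Num.max (- f x) 0 + Num.max (f x) 0) = f.
  apply/funext => x; have [f0|f0] := leP 0 (f x).
    by rewrite max_r ?oppr_le0// mulr0 add0r.
  by rewrite max_l ?oppr_ge0 ?ltW// mulN1r opprK addr0.
rewrite E; apply.
- by apply: measurable_maxr => //; exact: measurableT_comp.
- by move=> x; rewrite le_max lexx orbT.
- by move=> x; rewrite ge_max normr_ge0 andbT -normrN ler_norm.
- exact: measurable_maxr.
- by move=> x; rewrite le_max lexx orbT.
- by move=> x; rewrite ge_max normr_ge0 andbT ler_norm.
Qed.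

Lemma schwartz_dense (u : 'rV[R]_n -> R[i]) (e : R) : cmeasurable_fun u -> 0 < e ->
  (\int[mu]_k (Normc.normc (u k) ^+ 2 * w k)%:E < +oo)%E ->
  exists2 phi, schwartz phi &
  (\int[mu]_k (Normc.normc (u k - phi k) ^+ 2 * w k)%:E < e%:E)%E.
Proof.
move=> mu_ e0 uy; have [m1 m2] := mu_.
have ui : mu.-integrable setT (EFin \o (fun k => Normc.normc (u k) ^+ 2 * w k)).
  apply/integrableP; split; first by apply/measurable_EFinP; exact: measurable_normc2_enorm.
  under eq_integral do rewrite /= ger0_norm ?sqrw_ge0//.
  exact: uy.
have H (g : 'rV[R]_n -> R) : measurable_fun setT g ->
    (forall x, `|g x| <= Normc.normc (u x)) -> approximable g.
  move=> mg gu; apply: approximable_weight => //.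
  apply: (le_integrable measurableT _ _ ui).
    by apply/measurable_EFinP; apply: measurable_funM => //; exact: measurable_funX.
  move=> x _; rewrite /= lee_fin !ger0_norm ?sqrw_ge0// ler_wpM2r//.
  by rewrite -[leLHS]real_normK ?num_real// lerXn2r ?nnegrE ?normc_ge0.
have [_ /(_ (e / 2) ltac:(by rewrite divr_gt0))[p [Sp Hp]]] := H _ m1 (fun x => normr_Re_normc _).
have [_ /(_ (e / 2) ltac:(by rewrite divr_gt0))[q [Sq Hq]]] := H _ m2 (fun x => normr_Im_normc _).
have mp := schwartz_measurable Sp; have mq := schwartz_measurable Sq.
exists (fun x => 'i%C * (q x)%:C%C + (p x)%:C%C); first exact: schwartz_lin.
rewrite (eq_integral (fun k => ((complex.Re (u k) - p k) ^+ 2 * w k)%:E +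
  ((complex.Im (u k) - q k) ^+ 2 * w k)%:E)%E); last first.
  move=> x _; rewrite -EFinD normc_sqr -mulrDl; congr ((_ * _)%:E).
  by case: (u x) => a b /=; simpc; rewrite /=; congr (_ ^+ 2 + _ ^+ 2); ring.
rewrite ge0_integralD//.
- by rewrite (splitr e) EFinD; exact: lteD.
- by move=> x _; rewrite lee_fin mulr_ge0// sqr_ge0.
- by apply/measurable_EFinP; apply: measurable_funM => //; apply: measurable_funX; exact: measurable_funB.
- by move=> x _; rewrite lee_fin mulr_ge0// sqr_ge0.
- by apply/measurable_EFinP; apply: measurable_funM => //; apply: measurable_funX; exact: measurable_funB.
Qed.

End density.

(** * The integral of |k|^(-2 alpha) over a slice *)

Section gamma.
Context {R : realType}.
Local Notation mu := (@lebesgue_measure R).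
Implicit Types (s t c : R).

(** The integrand of [Gamma], not normalized, extended by 0 to the line so that affine substitution
    and Tonelli apply on the whole space. *)
Definition gamma_pdf s t : R := t `^ (s - 1) * expR (- t) * \1_`]0, +oo[ t.

Lemma gamma_pdf_ge0 s t : 0 <= gamma_pdf s t.
Proof. by rewrite !mulr_ge0 ?powR_ge0 ?expR_ge0// indicE. Qed.

Lemma measurable_gamma_pdf s : measurable_fun setT (gamma_pdf s).
Proof.
apply: measurable_funM; last exact: measurable_indic.
apply: measurable_funM; first exact: measurable_powR.
by apply: measurableT_comp => //; exact: measurable_oppr.
Qed.

(** Up to 1 the power dominates. Beyond 1, with [N >= s - 1], the product [t^(s-1) (1 + t^2)] is at
    most [2 t^(N+2)], hence at most [2 (N+2)! exp t], so the integrand is at most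
    [C / (1 + t^2)]. *)
Lemma lty_integral_gamma_pdf s : 0 < s -> (\int[mu]_t (gamma_pdf s t)%:E < +oo)%E.
Proof.
move=> s0; pose N := (Num.truncn s).+1; pose C : R := 2 * N.+2`!%:R.
have mq : measurable_fun setT (fun t : R => (1 + t ^+ 2)^-1).
  by apply: continuous_measurable_fun; exact: continuous_oneDsqrV.
have q1 (t : R) : 0 < 1 + t ^+ 2 by rewrite ltr_pwDl// sqr_ge0.
have mp : measurable_fun setT (fun t : R => t `^ (s - 1) * \1_`]0, 1] t).
  by apply: measurable_funM; [exact: measurable_powR|exact: measurable_indic].
apply: (@le_lt_trans _ _ (\int[mu]_t ((t `^ (s - 1) * \1_`]0, 1] t)%:E +
    (C * ((1 + t ^+ 2)^-1 * \1_`[0, +oo[ t))%:E))%E).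
  apply: ge0_le_integral => //.
  - by move=> t _; rewrite lee_fin gamma_pdf_ge0.
  - by apply/measurable_EFinP; exact: measurable_gamma_pdf.
  - apply: emeasurable_funD; apply/measurable_EFinP => //.
    apply: measurable_funM => //; apply: measurable_funM => //; exact: measurable_indic.
  - move=> t _; rewrite -EFinD lee_fin /gamma_pdf !indicE !mem_setE !in_itv/= andbT.
    have [t0|t0] := ltP 0 t; last first.
      rewrite mulr0 addr_ge0 ?mulr_ge0 ?powR_ge0// ?invr_ge0 ?(ltW (q1 _))//.
    rewrite (ltW t0) /= !mulr1; have [t1|t1] := leP t 1.
      rewrite mulr1 -[leLHS]addr0 lerD ?mulr_ge0// ?invr_ge0 ?(ltW (q1 _))//.
      by rewrite ler_piMr ?powR_ge0// -expR0 ler_expR oppr_le0 ltW.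
    rewrite mulr0 add0r expRN -ler_pdivlMr ?invr_gt0 ?expR_gt0// invrK mulrAC ler_pdivlMr//.
    have h1 : t `^ (s - 1) <= t ^+ N.
      rewrite -(powR_mulrn _ (ltW t0)) ler_powR ?(ltW t1)//.
      by rewrite ltW// (lt_trans _ (truncnS_gt s))// gtrBl.
    have h2 : 1 + t ^+ 2 <= 2 * t ^+ 2.
      by rewrite mulrDl !mul1r lerD2r exprn_ege1// ltW.
    apply: (@le_trans _ _ (t ^+ N * (2 * t ^+ 2))).
      by rewrite ler_pM ?powR_ge0// ltW.
    rewrite mulrCA -exprD /C -mulrA ler_pM2l// addn2.
    by apply: expX_le_expR; exact: ltW.
rewrite ge0_integralD//.
- apply: lte_add_pinfty.
    apply: le_lt_trans (ltry s^-1); apply: le_trans (integral_powR_itv01 s0).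
    rewrite [leRHS]integral_mkcond le_eqVlt; apply/orP; left; apply/eqP.
    apply: eq_integral => t _; rewrite patchE indicE.
    by case: (_ \in _); rewrite ?mulr1 ?mulr0.
  have -> : (\int[mu]_t (C * ((1 + t ^+ 2)^-1 * \1_`[0%R, +oo[ t))%:E =
      \int[mu]_t (C%:E * ((fun t : R => ((1 + t ^+ 2)^-1)%:E) \_ `[0%R, +oo[) t))%E.
    apply: eq_integral => t _; rewrite patchE indicE.
    by case: (_ \in _); rewrite ?mulr1 ?mulr0 ?mule0.
  rewrite ge0_integralZl//.
  + rewrite -integral_mkcond; have := @integral0y_oneDsqr R; rewrite /oneDsqr => ->.
    by rewrite -EFinM ltry.
  + by apply/(measurable_restrictT _ _).1 => //; apply/measurable_EFinP/measurable_funTS.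
  + by move=> t _; rewrite patchE; case: ifP => // _; rewrite lee_fin invr_ge0 ltW.
  + by rewrite lee_fin mulr_ge0.
- by move=> t _; rewrite lee_fin mulr_ge0 ?powR_ge0// indicE.
- exact/measurable_EFinP.
- by move=> t _; rewrite lee_fin !mulr_ge0 ?invr_ge0 ?(ltW (q1 _))// indicE.
- by apply/measurable_EFinP; apply: measurable_funM => //; apply: measurable_funM => //; exact: measurable_indic.
Qed.

Lemma integral_gamma_pdf s : 0 < s -> (\int[mu]_t (gamma_pdf s t)%:E = (Gamma s)%:E)%E.
Proof.
move=> s0; rewrite /Gamma /Rintegral integral_mkcond.
have E : (\int[mu]_t (gamma_pdf s t)%:E = \int[mu]_t ((fun x : R => (x `^ (s - 1) * expR (- x))%:E) \_ `]0%R, +oo[) t)%E.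
  apply: eq_integral => t _; rewrite patchE /gamma_pdf indicE.
  by case: (_ \in _); rewrite ?mulr1 ?mulr0.
rewrite -E fineK// ge0_fin_numE ?lty_integral_gamma_pdf// integral_ge0// => t _.
by rewrite lee_fin gamma_pdf_ge0.
Qed.

(** A zero integral would make the integrand vanish almost everywhere, but it is positive on a
    half-line. *)
Lemma Gamma_gt0 s : 0 < s -> 0 < Gamma s.
Proof.
move=> s0; rewrite -lte_fin -integral_gamma_pdf// lt0e; apply/andP; split; last first.
  by apply: integral_ge0 => t _; rewrite lee_fin gamma_pdf_ge0.
apply/eqP => I0.
have : ae_eq mu setT (EFin \o gamma_pdf s) (cst 0%E).
  apply/ae_eq_integral_abs => //; first by apply/measurable_EFinP; exact: measurable_gamma_pdf.
  by rewrite -I0; apply: eq_integral => t _ /=; rewrite ger0_norm// gamma_pdf_ge0.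
move=> [N [mN N0 HN]].
have : (mu `]0%R, +oo[ <= 0)%E.
  rewrite -N0; apply: le_measure; rewrite ?inE//.
  move=> t; rewrite /= in_itv/= andbT => t0; apply: HN => /=.
  move=> /(_ I)/eqP; rewrite eqe /gamma_pdf indicE mem_set ?mulr1; last by rewrite /= in_itv/= t0.
  by rewrite mulf_eq0 (gt_eqF (expR_gt0 _)) (gt_eqF (powR_gt0 _ t0)).
by rewrite lebesgue_measure_itv/= ltry/= leye_eq.
Qed.

Lemma integral_gamma_pdf_scale s c : 0 < s -> 0 < c ->
  (\int[mu]_t (t `^ (s - 1) * expR (- (t * c)) * \1_`]0, +oo[ t)%:E = (c `^ (- s) * Gamma s)%:E)%E.
Proof.
move=> s0 c0; have mg : measurable_fun setT (EFin \o gamma_pdf s).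
  by apply/measurable_EFinP; exact: measurable_gamma_pdf.
have := @ge0_integral_lebesgue_affine R c 0 (EFin \o gamma_pdf s) c0 mg
  (fun t => gamma_pdf_ge0 s t).
rewrite integral_gamma_pdf// => h.
transitivity (\int[mu]_t ((c `^ (1 - s))%:E * (EFin \o gamma_pdf s) (c * t + 0)%R))%E.
  apply: eq_integral => t _; rewrite /= -EFinM addr0 /gamma_pdf !indicE !mem_setE !in_itv/= !andbT.
  rewrite pmulr_rgt0//; have [t0|t0] := ltP 0 t; last by rewrite !mulr0.
  rewrite !mulr1 powRM ?ltW// !mulrA -powRD ?(gt_eqF c0) ?implybT// (_ : 1 - s + (s - 1) = 0).
    by rewrite powRr0 mul1r (mulrC t c).
  by ring.
rewrite ge0_integralZl//.
- rewrite h -!EFinM mulrA; congr ((_ * _)%:E).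
  by rewrite -powR_inv1 ?ltW// -powRD ?(gt_eqF c0) ?implybT//; congr (_ `^ _); ring.
- apply: (measurableT_comp mg); apply: measurable_funD => //; exact: measurable_funM.
- by move=> t _; rewrite lee_fin gamma_pdf_ge0.
- by rewrite lee_fin powR_ge0.
Qed.

(* Both sides multiplied by Gamma alpha are the integral over t > 0 and y of
   t^(alpha - 1) exp (- t (a^2 + |y|^2)). *)
Lemma integral_powR_enorm m (alpha a : R) : 0 < a -> m%:R / 2 < alpha ->
  (\int[lebesgue_rV m]_y ((a ^+ 2 + enorm y ^+ 2) `^ (- alpha))%:E =
   (pi `^ (m%:R / 2) * Gamma (alpha - m%:R / 2) / Gamma alpha *
     (a ^+ 2) `^ (- (alpha - m%:R / 2)))%:E)%E.
Proof.
move=> a0 ma; have al0 : 0 < alpha by apply: le_lt_trans ma; rewrite divr_ge0.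
have G0 := Gamma_gt0 al0.
pose F (z : measurableTypeR R * 'rV[R]_m) : R := z.1 `^ (alpha - 1) * expR (- (z.1 * (a ^+ 2 + enorm z.2 ^+ 2))) * \1_`]0, +oo[ z.1.
have q0 (y : 'rV[R]_m) : 0 < a ^+ 2 + enorm y ^+ 2 by rewrite ltr_pwDl ?sqr_ge0// exprn_gt0.
have mF : measurable_fun setT (EFin \o F).
  apply/measurable_EFinP; apply: measurable_funM; last first.
    have mI : measurable_fun setT (\1_`]0, +oo[ : measurableTypeR R -> R) by exact: measurable_indic.
    exact: (measurableT_comp mI measurable_fst).
  apply: measurable_funM.
    exact: (measurableT_comp (measurable_powR _) measurable_fst).
  apply: measurableT_comp => //; apply: measurableT_comp => //; apply: measurable_funM => //.
  apply: measurable_funD => //; apply: measurable_funX.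
  exact: (measurableT_comp (@measurable_enorm R m)).
have F0 z : (0 <= (EFin \o F) z)%E.
  by rewrite lee_fin !mulr_ge0 ?powR_ge0 ?expR_ge0// indicE.
have := @fubini_tonelli _ _ _ _ _ mu (lebesgue_rV m) (EFin \o F) mF F0.
(* For fixed [y], a gamma integral with rate [a^2 + |y|^2]. *)
have -> : (\int[lebesgue_rV m]_y \int[mu]_t (EFin \o F) (t, y) =
    (Gamma alpha)%:E * \int[lebesgue_rV m]_y ((a ^+ 2 + enorm y ^+ 2) `^ (- alpha))%:E)%E.
  rewrite -ge0_integralZl//.
  - apply: eq_integral => y _; rewrite -EFinM (mulrC (Gamma _)).
    rewrite -(integral_gamma_pdf_scale al0 (q0 y)).
    by apply: eq_integral => t _; rewrite /F.
  - apply/measurable_EFinP; apply: (measurableT_comp (measurable_powR _)).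
    by apply: measurable_funD => //; apply: measurable_funX; exact: measurable_enorm.
  - by move=> y _; rewrite lee_fin powR_ge0.
  - by rewrite lee_fin ltW.
(* For fixed [t > 0], a Gaussian integral equal to [(pi / t)^(m/2)]; it lowers the exponent of [t]
   from [alpha - 1] to [alpha - m/2 - 1]. *)
have -> : (\int[mu]_t \int[lebesgue_rV m]_y (EFin \o F) (t, y) =
    \int[mu]_t ((pi `^ (m%:R / 2))%:E *
      (t `^ (alpha - m%:R / 2 - 1) * expR (- (t * a ^+ 2)) * \1_`]0%R, +oo[ t)%:E))%E.
  apply: eq_integral => t _; have [t0|t0] := ltP 0 t; last first.
    rewrite integral0_eq => [|y _]; rewrite /F/= indicE mem_setE in_itv/= andbT ltNge t0 ?mulr0//.
    by rewrite mule0.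
  rewrite indicE mem_setE in_itv/= t0 mulr1.
  rewrite (eq_integral (fun y : 'rV[R]_m => ((t `^ (alpha - 1) * expR (- (t * a ^+ 2)))%:E *
      (expR (- (t * enorm y ^+ 2)))%:E)%E)); last first.
    move=> y _; rewrite /F /= indicE mem_setE in_itv/= t0 mulr1 -EFinM -mulrA -expRD; congr ((_ * expR _)%:E).
    by ring.
  rewrite ge0_integralZl//.
  - rewrite integral_gauss_rV// -!EFinM; congr (_%:E).
    have pt : 0 <= pi / t by rewrite divr_ge0 ?pi_ge0// ltW.
    have -> : Num.sqrt (pi / t) ^+ m = pi `^ (m%:R / 2) * t `^ (-1 * (m%:R / 2)).
      rewrite -(powR12_sqrt pt) -powR_mulrn ?powR_ge0// -powRrM.
      rewrite (_ : 2^-1 * m%:R = m%:R / 2); last by rewrite mulrC.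
      by rewrite powRM ?pi_ge0 ?invr_ge0 ?(ltW t0)// (powRrM t) powR_inv1 ?(ltW t0).
    rewrite (_ : alpha - m%:R / 2 - 1 = alpha - 1 + (-1 * (m%:R / 2))); last by ring.
    rewrite [in RHS]powRD ?(gt_eqF t0) ?implybT//; ring.
  - apply/measurable_EFinP; apply: measurableT_comp => //; apply: measurableT_comp => //.
    by apply: measurable_funM => //; apply: measurable_funX; exact: measurable_enorm.
  - by rewrite lee_fin mulr_ge0 ?powR_ge0 ?expR_ge0.
rewrite ge0_integralZl//; last 3 first.
- apply/measurable_EFinP; apply: measurable_funM; last exact: measurable_indic.
  apply: measurable_funM; first exact: measurable_powR.
  by apply: measurableT_comp => //; apply: measurableT_comp => //; exact: measurable_funM.
- by move=> t _; rewrite lee_fin !mulr_ge0 ?powR_ge0 ?expR_ge0// indicE.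
- by rewrite lee_fin powR_ge0.
rewrite integral_gamma_pdf_scale ?subr_gt0 ?exprn_gt0// => h.
transitivity (((Gamma alpha)^-1)%:E * ((Gamma alpha)%:E *
    \int[lebesgue_rV m]_y ((a ^+ 2 + enorm y ^+ 2) `^ (- alpha))%:E))%E.
  by rewrite muleA -EFinM mulVf ?gt_eqF// mul1e.
by rewrite -h -!EFinM; congr (_%:E); ring.
Qed.

End gamma.

(** * Orthogonal projection on the slices *)

Section pythagoras.
Context d (T : measurableType d) {R : realType} (mu : {measure set T -> \bar R}).
Variables (w : T -> R).
Hypotheses (mw : measurable_fun setT w) (w0 : forall x, 0 < w x).
Hypothesis wi : mu.-integrable setT (EFin \o (fun x => (w x)^-1)).
Let J := \int[mu]_x (w x)^-1.
Hypothesis J0 : 0 < J.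

Let measurable_sqrw (u : T -> R) : measurable_fun setT u -> measurable_fun setT (fun x => u x ^+ 2 * w x).
Proof. by move=> mu_; apply: measurable_funM => //; exact: measurable_funX. Qed.

(** Young's inequality with [d = 1]: [|u| <= u^2 w + 1 / w]. *)
Lemma integrable_sqr_weight (u : T -> R) : measurable_fun setT u ->
  mu.-integrable setT (EFin \o (fun x => u x ^+ 2 * w x)) -> mu.-integrable setT (EFin \o u).
Proof.
move=> mu_ ui; apply: (le_integrable measurableT _ _ (integrableD measurableT ui wi)).
  exact/measurable_EFinP.
move=> x _; rewrite /= lee_fin.
have := @le_young R `|u x| (w x) 1 (normr_ge0 _) (w0 x) ler01 (lexx _).
rewrite !mulr1 real_normK ?num_real// => h; apply: le_trans h (ler_norm _).
Qed.

(** Expanding the square leaves [u^2 w], [u] and [1 / w], each integrable. With [c = I / J] the last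
    two contribute [- 2 c I + c^2 J], which is [- I^2 / J]. *)
Lemma pythagoras_real (u : T -> R) : measurable_fun setT u ->
  mu.-integrable setT (EFin \o (fun x => u x ^+ 2 * w x)) ->
  let v x := u x - (\int[mu]_x u x) / J * (w x)^-1 in
  mu.-integrable setT (EFin \o (fun x => v x ^+ 2 * w x)) /\
  \int[mu]_x (u x ^+ 2 * w x) = (\int[mu]_x u x) ^+ 2 / J + \int[mu]_x (v x ^+ 2 * w x).
Proof.
move=> mu_ ui v; have u1 := integrable_sqr_weight mu_ ui.
set I := \int[mu]_x u x; pose c := I / J.
have E x : v x ^+ 2 * w x = u x ^+ 2 * w x + (- (2 * c) * u x + c ^+ 2 * (w x)^-1).
  by rewrite /v -/I -/c; field; rewrite gt_eqF.
have i1 : mu.-integrable setT (EFin \o (fun x => - (2 * c) * u x)) by exact: (integrableZl measurableT _ u1).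
have i2 : mu.-integrable setT (EFin \o (fun x => c ^+ 2 * (w x)^-1)) by exact: (integrableZl measurableT _ wi).
have i12 : mu.-integrable setT (EFin \o (fun x => - (2 * c) * u x + c ^+ 2 * (w x)^-1)).
  exact: (integrableD measurableT i1 i2).
rewrite (_ : (fun x => v x ^+ 2 * w x) = (fun x => u x ^+ 2 * w x + (- (2 * c) * u x + c ^+ 2 * (w x)^-1))); last first.
  by apply/funext.
split; first exact: (integrableD measurableT ui i12).
rewrite RintegralD// RintegralD// !RintegralZl// -/I -/J /c.
by field; rewrite gt_eqF.
Qed.

Lemma pythagoras (u : T -> R[i]) : cmeasurable_fun u ->
  (\int[mu]_x (Normc.normc (u x) ^+ 2 * w x)%:E < +oo)%E ->
  cintegrable mu u /\
  (\int[mu]_x (Normc.normc (u x) ^+ 2 * w x)%:E =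
   (Normc.normc (cintegral mu u) ^+ 2 / J)%:E +
   \int[mu]_x (Normc.normc (u x - cintegral mu u * (J^-1 * (w x)^-1)%:C%C) ^+ 2 * w x)%:E)%E.
Proof.
move=> [m1 m2] uy.
have mn : measurable_fun setT (fun x => Normc.normc (u x) ^+ 2 * w x).
  by apply: measurable_funM => //; exact: cmeasurable_normc.
have ui : mu.-integrable setT (EFin \o (fun x => Normc.normc (u x) ^+ 2 * w x)).
  apply/integrableP; split; first exact/measurable_EFinP.
  under eq_integral do rewrite /= ger0_norm ?(mulr_ge0 (sqr_ge0 _) (ltW (w0 _)))//.
  exact: uy.
have H (g : T -> R) : measurable_fun setT g -> (forall x, `|g x| <= Normc.normc (u x)) ->
    mu.-integrable setT (EFin \o (fun x => g x ^+ 2 * w x)).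
  move=> mg gu; apply: (le_integrable measurableT _ _ ui).
    by apply/measurable_EFinP; exact: measurable_sqrw.
  move=> x _; rewrite /= lee_fin !ger0_norm ?(mulr_ge0 (sqr_ge0 _) (ltW (w0 _)))//.
  rewrite ler_wpM2r ?(ltW (w0 _))//.
  by rewrite -[leLHS]real_normK ?num_real// lerXn2r ?nnegrE ?normc_ge0.
have i1 := H _ m1 (fun x => normr_Re_normc _); have i2 := H _ m2 (fun x => normr_Im_normc _).
split; first by split; exact: integrable_sqr_weight.
have [v1 e1] := pythagoras_real m1 i1; have [v2 e2] := pythagoras_real m2 i2.
have EI (g1 g2 : T -> R) : mu.-integrable setT (EFin \o g1) -> mu.-integrable setT (EFin \o g2) ->
    (\int[mu]_x (g1 x + g2 x)%:E = (\int[mu]_x g1 x + \int[mu]_x g2 x)%:E)%E.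
  move=> gi1 gi2; rewrite -RintegralD// /Rintegral fineK//.
  exact: (integrable_fin_num measurableT (integrableD measurableT gi1 gi2)).
transitivity (\int[mu]_x (complex.Re (u x) ^+ 2 * w x) + \int[mu]_x (complex.Im (u x) ^+ 2 * w x))%:E.
  by rewrite -EI//; apply: eq_integral => x _; rewrite normc_sqr mulrDl.
rewrite e1 e2 addrACA -mulrDl EFinD -(normc_sqr (cintegral mu u)) -EI//; congr (_ + _)%E.
apply: eq_integral => x _; rewrite normc_sqr mulrDl; congr (_ + _)%:E.
  congr (_ ^+ 2 * _); case: (u x) => a b /=; rewrite /cintegral; simpc; rewrite /=; ring.
congr (_ ^+ 2 * _); case: (u x) => a b /=; rewrite /cintegral; simpc; rewrite /=; ring.
Qed.

End pythagoras.

Lemma measurable_Rintegral2 d1 d2 (T1 : measurableType d1) (T2 : measurableType d2) (R : realType)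
    (m2 : {sigma_finite_measure set T2 -> \bar R}) (f : T1 * T2 -> R) : measurable_fun setT f ->
  measurable_fun setT (fun x => \int[m2]_y f (x, y)).
Proof.
move=> mf; have mEf : measurable_fun setT (EFin \o f) by exact/measurable_EFinP.
have m1 := @measurable_fun_fubini_tonelli_F _ _ T1 T2 R m2 _ (measurable_funepos mEf) (fun x => funepos_ge0 _ x).
have m2' := @measurable_fun_fubini_tonelli_F _ _ T1 T2 R m2 _ (measurable_funeneg mEf) (fun x => funeneg_ge0 _ x).
apply: (measurableT_comp (fine_measurable measurableT)).
rewrite (_ : (fun x => _) = (fun x => \int[m2]_y ((EFin \o f)^\+ (x, y)) - \int[m2]_y ((EFin \o f)^\- (x, y)))%E).
  exact: emeasurable_funB.
by apply/funext => x; rewrite integralE; congr (_ - _)%E; apply: eq_integral => y _; rewrite ?funeposE ?funenegE.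
Qed.

(** * Integration over the slices and the Pythagorean identity *)

Section marginal.
Context {R : realType} {p m n : nat} (e : (p + m = n)%N).
Local Notation mup := (lebesgue_rV p : {sigma_finite_measure set 'rV[R]_p -> \bar R}).
Local Notation mum := (lebesgue_rV m : {sigma_finite_measure set 'rV[R]_m -> \bar R}).
Local Notation mun := (lebesgue_rV n : {sigma_finite_measure set 'rV[R]_n -> \bar R}).
Implicit Types (g : 'rV[R]_n -> R[i]) (s : R).

Lemma enorm_rV_cat x y : enorm (rV_cat e x y) ^+ 2 = enorm x ^+ 2 + enorm y ^+ 2 :> R.
Proof.
rewrite !enorm_sqr; case: n / e => //=; rewrite big_split_ord/=; congr (_ + _).
  by apply: eq_bigr => i _; rewrite rV_catE row_mxEl.
by apply: eq_bigr => i _; rewrite rV_catE row_mxEr.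
Qed.

Lemma enorm_powR2 k (x : 'rV[R]_k) s : enorm x `^ (2 * s) = (enorm x ^+ 2) `^ s.
Proof. by rewrite powRrM powR_mulrn ?enorm_ge0. Qed.

(** Kept in the extended reals and without the factor [2 pi], which [dnorm_sqr] restores. *)
Definition wnorm2 k s (g : 'rV[R]_k -> R[i]) : \bar R :=
  (\int[lebesgue_rV k]_x (Normc.normc (g x) ^+ 2 * enorm x `^ s)%:E)%E.

(** Total, with a default value on slices that are not integrable; for [g] of finite norm these form
    a null set. *)
Definition marginal g (x : 'rV[R]_p) : R[i] := cintegral mum (fun y => g (rV_cat e x y)).

Lemma cmeasurable_rV_cat g : cmeasurable_fun g ->
  cmeasurable_fun (fun z : 'rV[R]_p * 'rV[R]_m => g (rV_cat e z.1 z.2)).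
Proof. by move=> mg; apply: (cmeasurable_comp (h := fun z : 'rV[R]_p * 'rV[R]_m => rV_cat e z.1 z.2)) => //; exact: measurable_rV_cat. Qed.

Lemma cmeasurable_marginal g : cmeasurable_fun g -> cmeasurable_fun (marginal g).
Proof.
move=> /cmeasurable_rV_cat[m1 m2]; split.
  exact: (measurable_Rintegral2 _ m1).
exact: (measurable_Rintegral2 _ m2).
Qed.

Variables (alpha : R) (alpha_gt : m%:R / 2 < alpha).
Let beta := alpha - m%:R / 2.

Definition slice_cst : R := pi `^ (m%:R / 2) * Gamma beta / Gamma alpha.

Lemma slice_cst_gt0 : 0 < slice_cst.
Proof.
have al0 : 0 < alpha by apply: le_lt_trans alpha_gt; rewrite divr_ge0.
by rewrite divr_gt0 ?mulr_gt0 ?powR_gt0 ?pi_gt0 ?Gamma_gt0 ?subr_gt0.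
Qed.

(* The component of the slice [g (x, .)] that is orthogonal to |k|^(-2 alpha) for
   the weight |k|^(2 alpha). *)
Definition residual g (x : 'rV[R]_p) (y : 'rV[R]_m) : R[i] := g (rV_cat e x y) -
  marginal g x * ((enorm x `^ (2 * beta) / slice_cst) * enorm (rV_cat e x y) `^ (- (2 * alpha)))%:C%C.

Lemma enorm_rV_cat_gt0 x y : 0 < enorm x -> 0 < enorm (rV_cat e x y) :> R.
Proof.
move=> x0; rewrite lt_neqAle enorm_ge0 andbT eq_sym -sqrf_eq0 enorm_rV_cat gt_eqF//.
by rewrite ltr_pwDl ?sqr_ge0// exprn_gt0.
Qed.

Lemma integral_enorm_rV_cat (x : 'rV[R]_p) : 0 < enorm x ->
  (\int[mum]_y (enorm (rV_cat e x y) `^ (- (2 * alpha)))%:E =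
   (slice_cst * enorm x `^ (- (2 * beta)))%:E)%E.
Proof.
move=> x0; rewrite -[in RHS]mulrN enorm_powR2 -(integral_powR_enorm x0 alpha_gt).
by apply: eq_integral => y _; rewrite -mulrN enorm_powR2 enorm_rV_cat.
Qed.

(** [pythagoras] on one slice, whose weight is positive everywhere since [x] is not 0; the integral
    of the inverse weight is the beta integral. *)
Lemma marginal_section g x : cmeasurable_fun g -> 0 < enorm x ->
  (\int[mum]_y (Normc.normc (g (rV_cat e x y)) ^+ 2 * enorm (rV_cat e x y) `^ (2 * alpha))%:E < +oo)%E ->
  cintegrable mum (fun y => g (rV_cat e x y)) /\
  (\int[mum]_y (Normc.normc (g (rV_cat e x y)) ^+ 2 * enorm (rV_cat e x y) `^ (2 * alpha))%:E =
   (slice_cst^-1 * (Normc.normc (marginal g x) ^+ 2 * enorm x `^ (2 * beta)))%:E +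
   \int[mum]_y (Normc.normc (residual g x y) ^+ 2 * enorm (rV_cat e x y) `^ (2 * alpha))%:E)%E.
Proof.
move=> mg x0 gy; pose w (y : 'rV[R]_m) := enorm (rV_cat e x y) `^ (2 * alpha).
have w0 y : 0 < w y by rewrite powR_gt0// enorm_rV_cat_gt0.
have mcat : measurable_fun setT (fun y : 'rV[R]_m => rV_cat e x y).
  exact: (measurableT_comp (@measurable_rV_cat R _ _ _ e) (pair1_measurable x)).
have mw : measurable_fun setT w.
  exact: (measurableT_comp (@measurable_enorm_powR R n (2 * alpha)) mcat).
have Iw : (\int[mum]_y ((w y)^-1)%:E = (slice_cst * enorm x `^ (- (2 * beta)))%:E)%E.
  by rewrite -integral_enorm_rV_cat//; apply: eq_integral => y _; rewrite powRN.
have mwV : measurable_fun setT (fun y => (w y)^-1).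
  rewrite (_ : (fun y => _) = (fun y => enorm (rV_cat e x y) `^ (- (2 * alpha)))).
    exact: (measurableT_comp (@measurable_enorm_powR R n (- (2 * alpha))) mcat).
  by apply/funext => y; rewrite powRN.
have wi : mum.-integrable setT (EFin \o (fun y => (w y)^-1)).
  apply/integrableP; split; first exact/measurable_EFinP.
  under eq_integral do rewrite /= ger0_norm ?invr_ge0 ?(ltW (w0 _))//.
  by rewrite Iw ltry.
have EJ : \int[mum]_y (w y)^-1 = slice_cst * enorm x `^ (- (2 * beta)).
  by rewrite /Rintegral Iw.
have J0 : 0 < \int[mum]_y (w y)^-1.
  by rewrite EJ mulr_gt0 ?slice_cst_gt0// powR_gt0.
have EJV : (\int[mum]_y (w y)^-1)^-1 = enorm x `^ (2 * beta) / slice_cst.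
  by rewrite EJ invfM -powRN opprK mulrC.
have mgx : cmeasurable_fun (fun y => g (rV_cat e x y)) by exact: cmeasurable_comp.
have [gi ->] := pythagoras mw w0 wi J0 mgx gy; split => //; congr (_ + _)%E.
  by rewrite EJV -/(marginal g x); congr (_%:E); ring.
apply: eq_integral => y _; congr ((Normc.normc _ ^+ 2 * _)%:E).
by rewrite /residual EJV powRN.
Qed.

Lemma wnorm2_rV_cat s g : cmeasurable_fun g -> wnorm2 s g =
  (\int[mup]_x \int[mum]_y (Normc.normc (g (rV_cat e x y)) ^+ 2 * enorm (rV_cat e x y) `^ s)%:E)%E.
Proof.
move=> mg; rewrite /wnorm2 (ge0_integral_rV_cat e)//.
- by apply/measurable_EFinP; exact: measurable_normc2_enorm.
- by move=> x; rewrite lee_fin mulr_ge0 ?sqr_ge0 ?powR_ge0.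
Qed.

Lemma measurable_section_wnorm2 s g : cmeasurable_fun g -> measurable_fun setT (fun x =>
  \int[mum]_y (Normc.normc (g (rV_cat e x y)) ^+ 2 * enorm (rV_cat e x y) `^ s)%:E)%E.
Proof.
move=> mg.
apply: (@measurable_fun_fubini_tonelli_F _ _ _ _ R mum
   (fun z => (Normc.normc (g (rV_cat e z.1 z.2)) ^+ 2 * enorm (rV_cat e z.1 z.2) `^ s)%:E)).
  apply: (measurableT_comp (f := fun k : 'rV[R]_n => (Normc.normc (g k) ^+ 2 * enorm k `^ s)%:E)); last exact: measurable_rV_cat.
  by apply/measurable_EFinP; exact: measurable_normc2_enorm.
by move=> z; rewrite lee_fin mulr_ge0 ?sqr_ge0 ?powR_ge0.
Qed.

Lemma ae_section_lty s g : cmeasurable_fun g -> (wnorm2 s g < +oo)%E ->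
  {ae mup, forall x,
  (\int[mum]_y (Normc.normc (g (rV_cat e x y)) ^+ 2 * enorm (rV_cat e x y) `^ s)%:E < +oo)%E}.
Proof.
move=> mg; rewrite wnorm2_rV_cat// => gy.
have F0 x : (0 <= \int[mum]_y (Normc.normc (g (rV_cat e x y)) ^+ 2 * enorm (rV_cat e x y) `^ s)%:E)%E.
  by apply: integral_ge0 => y _; rewrite lee_fin mulr_ge0 ?sqr_ge0 ?powR_ge0.
have : mup.-integrable setT (fun x =>
    \int[mum]_y (Normc.normc (g (rV_cat e x y)) ^+ 2 * enorm (rV_cat e x y) `^ s)%:E)%E.
  apply/integrableP; split; first exact: measurable_section_wnorm2.
  by under eq_integral do rewrite gee0_abs//.
move=> /(integrable_ae measurableT); apply: filterS => x /(_ I).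
by rewrite ge0_fin_numE.
Qed.

Definition residual_norm2 g : \bar R := (\int[mup]_x \int[mum]_y
  (Normc.normc (residual g x y) ^+ 2 * enorm (rV_cat e x y) `^ (2 * alpha))%:E)%E.

Lemma cmeasurable_residual g : cmeasurable_fun g ->
  cmeasurable_fun (fun z : 'rV[R]_p * 'rV[R]_m => residual g z.1 z.2).
Proof.
move=> mg; have [h1 h2] := cmeasurable_marginal mg; have [g1 g2] := cmeasurable_rV_cat mg.
pose c (z : 'rV[R]_p * 'rV[R]_m) := (enorm z.1 `^ (2 * beta) / slice_cst) * enorm (rV_cat e z.1 z.2) `^ (- (2 * alpha)).
have mc : measurable_fun setT c.
  apply: measurable_funM.
    apply: measurable_funM => //.
    exact: (measurableT_comp (@measurable_enorm_powR R p (2 * beta)) measurable_fst).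
  exact: (measurableT_comp (@measurable_enorm_powR R n (- (2 * alpha))) (@measurable_rV_cat R _ _ _ e)).
have mh1 : measurable_fun setT (fun z : 'rV[R]_p * 'rV[R]_m => complex.Re (marginal g z.1)).
  exact: (measurableT_comp h1 measurable_fst).
have mh2 : measurable_fun setT (fun z : 'rV[R]_p * 'rV[R]_m => complex.Im (marginal g z.1)).
  exact: (measurableT_comp h2 measurable_fst).
split.
  rewrite (_ : (fun z => _) = (fun z => complex.Re (g (rV_cat e z.1 z.2)) - complex.Re (marginal g z.1) * c z)).
    by apply: measurable_funB => //; exact: measurable_funM.
  apply/funext => z; rewrite /residual -/(c z); case: (g _) (marginal g _) => [a b] [a' b'] /=; simpc; rewrite /=; ring.
rewrite (_ : (fun z => _) = (fun z => complex.Im (g (rV_cat e z.1 z.2)) - complex.Im (marginal g z.1) * c z)).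
  by apply: measurable_funB => //; exact: measurable_funM.
apply/funext => z; rewrite /residual -/(c z); case: (g _) (marginal g _) => [a b] [a' b'] /=; simpc; rewrite /=; ring.
Qed.

Lemma measurable_residual_norm2 g : cmeasurable_fun g ->
  measurable_fun setT (fun z : 'rV[R]_p * 'rV[R]_m =>
    (Normc.normc (residual g z.1 z.2) ^+ 2 * enorm (rV_cat e z.1 z.2) `^ (2 * alpha))%:E).
Proof.
move=> mg; apply/measurable_EFinP; apply: measurable_funM.
  exact: cmeasurable_normc (cmeasurable_residual mg).
exact: (measurableT_comp (@measurable_enorm_powR R n (2 * alpha)) (@measurable_rV_cat R _ _ _ e)).
Qed.

(** Almost every slice satisfies the identity: its norm is finite by Tonelli, and [x] is not 0
    because [p > 0] makes the origin a null set. *)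
Lemma marginal_pythagoras g : (0 < p)%N -> cmeasurable_fun g -> (wnorm2 (2 * alpha) g < +oo)%E ->
  {ae mup, forall x, cintegrable mum (fun y => g (rV_cat e x y))} /\
  (wnorm2 (2 * alpha) g = slice_cst^-1%:E * wnorm2 (2 * beta) (marginal g) + residual_norm2 g)%E.
Proof.
move=> p0 mg gy; have H : {ae mup, forall x, 0 < enorm x /\
    (\int[mum]_y (Normc.normc (g (rV_cat e x y)) ^+ 2 * enorm (rV_cat e x y) `^ (2 * alpha))%:E < +oo)%E}.
  by apply: filterS2 (@ae_enorm_gt0 R p p0) (ae_section_lty mg gy).
split; first by apply: filterS H => x [x0 xy]; case: (marginal_section mg x0 xy).
have mh := cmeasurable_marginal mg.
have R0 x : (0 <= \int[mum]_y (Normc.normc (residual g x y) ^+ 2 * enorm (rV_cat e x y) `^ (2 * alpha))%:E)%E.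
  by apply: integral_ge0 => y _; rewrite lee_fin mulr_ge0 ?sqr_ge0 ?powR_ge0.
have mR := @measurable_fun_fubini_tonelli_F _ _ _ _ R mum _ (measurable_residual_norm2 mg)
  (fun z => mulr_ge0 (sqr_ge0 _) (powR_ge0 _ _)).
have t0 : 0 <= slice_cst^-1 by rewrite invr_ge0 ltW// slice_cst_gt0.
rewrite /wnorm2 -ge0_integralZl//; last 2 first.
- by apply/measurable_EFinP; exact: measurable_normc2_enorm.
- by move=> x _; rewrite lee_fin mulr_ge0 ?sqr_ge0 ?powR_ge0.
rewrite -[LHS]/(wnorm2 _ _) wnorm2_rV_cat// /residual_norm2 -ge0_integralD//; last 2 first.
- by move=> x _; rewrite -EFinM lee_fin mulr_ge0// mulr_ge0 ?sqr_ge0 ?powR_ge0.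
- by apply: measurable_funeM; apply/measurable_EFinP; exact: measurable_normc2_enorm.
apply: ge0_ae_eq_integral => //.
- exact: measurable_section_wnorm2.
- apply: emeasurable_funD => //.
  by apply: measurable_funeM; apply/measurable_EFinP; exact: measurable_normc2_enorm.
- by move=> x _; apply: integral_ge0 => y _; rewrite lee_fin mulr_ge0 ?sqr_ge0 ?powR_ge0.
- by move=> x _; rewrite adde_ge0// -EFinM lee_fin mulr_ge0// mulr_ge0 ?sqr_ge0 ?powR_ge0.
by apply: filterS H => x [x0 xy] _; case: (marginal_section mg x0 xy).
Qed.

End marginal.

(** * The spaces D_alpha *)

Section dspace.
Context {R : realType} {n : nat}.
Local Notation mu := (lebesgue_rV n : {measure set 'rV[R]_n -> \bar R}).
Implicit Types (u v g : 'rV[R]_n -> R[i]) (alpha s : R).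

Lemma wnorm2_ge0 s u : (0 <= wnorm2 s u)%E.
Proof. by apply: integral_ge0 => x _; rewrite lee_fin mulr_ge0 ?sqr_ge0 ?powR_ge0. Qed.

Lemma wnorm2_ae s u v : cmeasurable_fun u -> cmeasurable_fun v ->
  {ae mu, forall x, u x = v x} -> wnorm2 s u = wnorm2 s v.
Proof.
move=> mu_ mv uv; apply: ge0_ae_eq_integral => //.
- by apply/measurable_EFinP; exact: measurable_normc2_enorm.
- by apply/measurable_EFinP; exact: measurable_normc2_enorm.
- by move=> x _; rewrite lee_fin mulr_ge0 ?sqr_ge0 ?powR_ge0.
- by move=> x _; rewrite lee_fin mulr_ge0 ?sqr_ge0 ?powR_ge0.
- by apply: filterS uv => x -> _.
Qed.

Lemma wnorm2_eq0 s u : (0 < n)%N -> cmeasurable_fun u -> wnorm2 s u = 0%E ->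
  {ae mu, forall x, u x = 0}.
Proof.
move=> n0 mu_ u0; have : ae_eq mu setT (fun x => (Normc.normc (u x) ^+ 2 * enorm x `^ s)%:E) (cst 0%E).
  apply/ae_eq_integral_abs => //; first by apply/measurable_EFinP; exact: measurable_normc2_enorm.
  rewrite -[RHS]u0; apply: eq_integral => x _.
  by rewrite gee0_abs// lee_fin mulr_ge0 ?sqr_ge0 ?powR_ge0.
apply: filterS2 (ae_enorm_gt0 n0) => x x0 /(_ I) /= [] /eqP.
rewrite mulf_eq0 (gt_eqF (powR_gt0 _ x0)) orbF sqrf_eq0 => /eqP.
exact: Normc.eq0_normc.
Qed.

Lemma wnorm2_lin s (a : R[i]) u v : cmeasurable_fun u -> cmeasurable_fun v ->
  (wnorm2 s (fun x => a * u x + v x)%R <=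
   (2 * Normc.normc a ^+ 2)%:E * wnorm2 s u + 2%:E * wnorm2 s v)%E.
Proof.
move=> mu_ mv; have pos (g : 'rV[R]_n -> R[i]) x : 0 <= Normc.normc (g x) ^+ 2 * enorm x `^ s.
  by rewrite mulr_ge0 ?sqr_ge0 ?powR_ge0.
have mg (g : 'rV[R]_n -> R[i]) : cmeasurable_fun g ->
    measurable_fun setT (fun x => (Normc.normc (g x) ^+ 2 * enorm x `^ s)%:E).
  by move=> mg; apply/measurable_EFinP; exact: measurable_normc2_enorm.
have c0 : 0 <= 2 * Normc.normc a ^+ 2 by rewrite mulr_ge0// sqr_ge0.
have Zl (c : R) (g : 'rV[R]_n -> R[i]) : 0 <= c -> cmeasurable_fun g -> (c%:E * wnorm2 s g =
    \int[mu]_x (c%:E * (Normc.normc (g x) ^+ 2 * enorm x `^ s)%:E))%E.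
  by move=> c0' mg'; rewrite ge0_integralZl//; [exact: mg|move=> x _; rewrite lee_fin].
rewrite !Zl// /wnorm2 -ge0_integralD//; last 4 first.
- by move=> x _; rewrite mule_ge0// lee_fin.
- by apply: measurable_funeM; exact: mg.
- by move=> x _; rewrite mule_ge0// lee_fin.
- by apply: measurable_funeM; exact: mg.
apply: ge0_le_integral => //.
- by move=> x _; rewrite lee_fin (pos (fun x => a * u x + v x)).
- by apply: mg; exact: cmeasurable_lin.
- by apply: emeasurable_funD; apply: measurable_funeM; exact: mg.
- move=> x _; rewrite -!EFinM -EFinD lee_fin.
  apply: (le_trans (ler_wpM2r (powR_ge0 _ _) (normc_sqr_le a (u x) (v x)))).
  by rewrite le_eqVlt; apply/orP; left; apply/eqP; ring.
Qed.

Lemma dspace_ift alpha u : 0 < 2 * alpha -> 2 * alpha < n%:R -> cmeasurable_fun u ->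
  (wnorm2 (2 * alpha) u < +oo)%E -> dspace alpha (ift_dist u).
Proof.
move=> a0 an mu_ uy; have tu := tame_weight a0 an mu_ uy.
by split; [exact: tempered_ift|exists u => //; exact: is_fourier_of_ift].
Qed.

Lemma dspaceP alpha (f : dspaceType R n alpha) : dspace alpha f.
Proof. by case: f => T /= /asboolP. Qed.

Lemma fourier_funP alpha (f : dspaceType R n alpha) : is_fourier_of f (fourier_fun f).
Proof. by have [_ [g fg _]] := dspaceP f; rewrite /fourier_fun; case: xgetP => // /(_ g). Qed.

Lemma cmeasurable_fourier_fun alpha (f : dspaceType R n alpha) : cmeasurable_fun (fourier_fun f).
Proof. by case: (fourier_funP f). Qed.

Lemma wnorm2_fourier_fun alpha (f : dspaceType R n alpha) :
  (wnorm2 (2 * alpha) (fourier_fun f) < +oo)%E.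
Proof.
have [_ [g fg gy]] := dspaceP f; have := is_fourier_of_ae (fourier_funP f) fg.
have [mg _] := fg; move=> h.
by rewrite (wnorm2_ae (2 * alpha) (cmeasurable_fourier_fun f) mg h).
Qed.

Lemma dspace_valE alpha (f : dspaceType R n alpha) u : is_fourier_of f u -> f = ift_dist u :> functional R n.
Proof. by move=> fu; have [tf _] := dspaceP f; exact: fourier_inj_dist. Qed.

Lemma enormZ (a : R) (x : 'rV[R]_n) : 0 <= a -> enorm (a *: x) = a * enorm x.
Proof.
move=> a0; rewrite /enorm (eq_bigr (fun i => a ^+ 2 * x ord0 i ^+ 2)).
  by rewrite -mulr_sumr sqrtrM ?sqr_ge0// sqrtr_sqr ger0_norm.
by move=> i _; rewrite mxE exprMn.
Qed.

Lemma dnorm_ge0 alpha (f : dspaceType R n alpha) : 0 <= dnorm f.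
Proof. exact: sqrtr_ge0. Qed.

(** Any representative [u] may be used in place of the chosen one, since two representatives agree
    almost everywhere. *)
Lemma dnorm_sqr alpha (f : dspaceType R n alpha) u : is_fourier_of f u ->
  ((dnorm f ^+ 2)%:E = ((2 * pi) `^ (2 * alpha))%:E * wnorm2 (2 * alpha) u)%E.
Proof.
move=> fu; have [mu_ _] := fu.
rewrite -(wnorm2_ae (2 * alpha) (cmeasurable_fourier_fun f) mu_ (is_fourier_of_ae (fourier_funP f) fu)).
have p0 : 0 <= 2 * pi :> R by rewrite mulr_ge0 ?pi_ge0.
rewrite /dnorm sqr_sqrtr; last first.
  by apply: Rintegral_ge0 => x _; rewrite mulr_ge0 ?sqr_ge0 ?powR_ge0.
rewrite /wnorm2 -ge0_integralZl//; last 3 first.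
- by apply/measurable_EFinP; apply: measurable_normc2_enorm; exact: cmeasurable_fourier_fun.
- by move=> x _; rewrite lee_fin mulr_ge0 ?sqr_ge0 ?powR_ge0.
- by rewrite lee_fin powR_ge0.
have E : (\int[mu]_x (((2 * pi) `^ (2 * alpha))%:E * (Normc.normc (fourier_fun f x) ^+ 2 * enorm x `^ (2 * alpha))%:E) =
   \int[mu]_x (Normc.normc (fourier_fun f x) ^+ 2 * enorm ((2 * pi) *: x) `^ (2 * alpha))%:E)%E.
  apply: eq_integral => x _; rewrite -EFinM enormZ// (powRM _ p0 (enorm_ge0 _)).
  by congr EFin; ring.
rewrite E /Rintegral fineK// -E ge0_integralZl//.
- by rewrite fin_numM// ge0_fin_numE ?wnorm2_ge0// wnorm2_fourier_fun.
- by apply/measurable_EFinP; apply: measurable_normc2_enorm; exact: cmeasurable_fourier_fun.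
- by move=> x _; rewrite lee_fin mulr_ge0 ?sqr_ge0 ?powR_ge0.
- by rewrite lee_fin powR_ge0.
Qed.

Lemma dspace_val_lin alpha (a : R[i]) (f g : dspaceType R n alpha) :
  dspace_val (a *: f + g) = a *: dspace_val f + dspace_val g.
Proof. by []. Qed.

(** A substitute for the triangle inequality, sufficient for the approximation argument that proves
    uniqueness. *)
Lemma dnorm_lin alpha (a : R[i]) (f g : dspaceType R n alpha) :
  dnorm (a *: f + g) ^+ 2 <= 2 * Normc.normc a ^+ 2 * dnorm f ^+ 2 + 2 * dnorm g ^+ 2.
Proof.
have hf := fourier_funP f; have hg := fourier_funP g.
have hfg : is_fourier_of (a *: f + g : dspaceType R n alpha) (fun k => a * fourier_fun f k + fourier_fun g k).
  by rewrite dspace_val_lin; exact: is_fourier_of_lin.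
rewrite -lee_fin (dnorm_sqr hfg) EFinD EFinM (EFinM _ (dnorm g ^+ 2)) (dnorm_sqr hf) (dnorm_sqr hg).
rewrite muleCA [X in (_ <= _ + X)%E]muleCA -ge0_muleDr ?mule_ge0 ?wnorm2_ge0//; last first.
  by rewrite lee_fin mulr_ge0 ?sqr_ge0.
apply: lee_wpmul2l; first by rewrite lee_fin powR_ge0.
by apply: wnorm2_lin; exact: cmeasurable_fourier_fun.
Qed.

Lemma dnorm_eq0 alpha (f : dspaceType R n alpha) : (0 < n)%N -> dnorm f = 0 -> f = 0.
Proof.
move=> n0 f0; have := dnorm_sqr (fourier_funP f); rewrite f0 expr0n /= => /esym/eqP.
rewrite mule_eq0 eqe gt_eqF ?powR_gt0 ?mulr_gt0 ?pi_gt0//= => /eqP h.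
have mf := cmeasurable_fourier_fun f.
have m0 : cmeasurable_fun (fun _ : 'rV[R]_n => 0 : R[i]) by split; exact: measurable_cst.
apply: val_inj => /=; rewrite (dspace_valE (fourier_funP f)).
rewrite (ift_dist_ae mf m0 (wnorm2_eq0 n0 mf h)).
apply/funext => phi; rewrite /ift_dist; case: asboolP => // _.
by under [X in cintegral _ X]funext do rewrite mul0r; exact: (proj2 (cintegral_0 _)).
Qed.

Lemma dspace_schwartz alpha phi : 0 < 2 * alpha -> 2 * alpha < n%:R -> schwartz phi ->
  dspace alpha (dist_of phi : functional R n).
Proof.
move=> a0 an Sp; rewrite dist_of_schwartz//.
have Sf : schwartz (fourier phi) by rewrite fourierE; exact: schwartz_fourier_sign (sqrN11) Sp.
apply: dspace_ift => //; first exact: ccontinuous_cmeasurable (schwartz_ccontinuous Sf).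
have /integrableP[_] := schwartz_weight (ltW a0) Sf; apply: le_lt_trans.
rewrite le_eqVlt; apply/orP; left; apply/eqP; apply: eq_integral => x _ /=.
by rewrite ger0_norm// mulr_ge0 ?sqr_ge0 ?powR_ge0.
Qed.

(** The approximation is made on the Fourier side by [psi], and [phi] is the inverse transform of
    [psi]. Dividing [eps] by [(2 pi)^(2 alpha)] accounts for the weight of [dnorm]. *)
Lemma dist_of_dense alpha (f : dspaceType R n alpha) (eps : R) : 0 < 2 * alpha ->
  2 * alpha < n%:R -> 0 < eps -> exists2 phi, schwartz phi &
  forall g : dspaceType R n alpha, g = dist_of phi :> functional R n ->
    dnorm (-1 *: g + f) ^+ 2 < eps.
Proof.
move=> a0 an eps0; have c0 : 0 < (2 * pi) `^ (2 * alpha) :> R by rewrite powR_gt0 ?mulr_gt0 ?pi_gt0.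
have [psi Sp Hp] := schwartz_dense (ltW a0) (cmeasurable_fourier_fun f) (divr_gt0 eps0 c0) (wnorm2_fourier_fun f).
have Sq := schwartz_fourier_sign (expr1n R 2) Sp.
exists (fourier_sign 1 psi) => // g gE.
have Fpsi : fourier (fourier_sign 1 psi) = psi.
  by apply/funext => k; rewrite fourierE fourier_sign_inversion// expr1n.
have hg : is_fourier_of g psi.
  by rewrite gE dist_of_schwartz// Fpsi; apply: is_fourier_of_ift; exact: tame_of_schwartz.
have hfg : is_fourier_of (-1 *: g + f : dspaceType R n alpha) (fun k => -1 * psi k + fourier_fun f k).
  by rewrite dspace_val_lin; apply: is_fourier_of_lin => //; exact: fourier_funP.
have E : eps = (2 * pi) `^ (2 * alpha) * (eps / (2 * pi) `^ (2 * alpha)).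
  by rewrite mulrCA mulfV ?mulr1// gt_eqF.
rewrite -lte_fin (dnorm_sqr hfg) [in ltRHS]E EFinM lte_pmul2l// ?lte_fin//.
apply: le_lt_trans Hp; rewrite le_eqVlt; apply/orP; left; apply/eqP.
by apply: eq_integral => x _; rewrite mulN1r addrC.
Qed.

End dspace.

(** * Integration over the slices *)

Section rV_cat_integral.
Context {R : realType} {p m n : nat} (e : (p + m = n)%N).
Local Notation mup := (lebesgue_rV p : {sigma_finite_measure set 'rV[R]_p -> \bar R}).
Local Notation mum := (lebesgue_rV m : {sigma_finite_measure set 'rV[R]_m -> \bar R}).
Local Notation mun := (lebesgue_rV n : {sigma_finite_measure set 'rV[R]_n -> \bar R}).
Let cat (z : 'rV[R]_p * 'rV[R]_m) := rV_cat e z.1 z.2.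

Let mcat : measurable_fun setT cat. Proof. exact: measurable_rV_cat. Qed.

Lemma ge0_integral_rV_cat_prod (f : 'rV[R]_n -> \bar R) : measurable_fun setT f ->
  (forall x, 0 <= f x)%E -> (\int[(mup \x mum)%E]_z f (cat z) = \int[mun]_x f x)%E.
Proof.
move=> mf f0; rewrite (ge0_integral_rV_cat e)//.
rewrite (fubini_tonelli1 (fun z => f (cat z)))//; exact: measurableT_comp.
Qed.

Lemma integrable_rV_cat (f : 'rV[R]_n -> R) : mun.-integrable setT (EFin \o f) ->
  (mup \x mum)%E.-integrable setT (EFin \o (fun z => f (cat z))) /\
  \int[(mup \x mum)%E]_z f (cat z) = \int[mun]_x f x.
Proof.
move=> fi; have mf : measurable_fun setT (EFin \o f) by exact: measurable_int fi.
split.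
  apply/integrableP; split; first exact: (measurableT_comp mf mcat).
  have /integrableP[_] := fi; rewrite -ge0_integral_rV_cat_prod//.
  exact: measurableT_comp.
rewrite /Rintegral; congr fine; rewrite integralE [in RHS]integralE; congr (_ - _)%E.
  rewrite -(ge0_integral_rV_cat_prod (measurable_funepos mf))//.
  by apply: eq_integral => z _; rewrite !funeposE.
rewrite -(ge0_integral_rV_cat_prod (measurable_funeneg mf))//.
by apply: eq_integral => z _; rewrite !funenegE.
Qed.

Lemma cintegral_marginal (f : 'rV[R]_n -> R[i]) : cintegrable mun f ->
  cintegrable mup (marginal e f) /\ cintegral mup (marginal e f) = cintegral mun f.
Proof.
move=> [f1 f2]; have [i1 e1] := integrable_rV_cat f1; have [i2 e2] := integrable_rV_cat f2.
have [j1 E1] := Rfubini_l i1; have [j2 E2] := Rfubini_l i2.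
split; first by split.
by rewrite /cintegral; congr Complex; [rewrite -e1 -E1|rewrite -e2 -E2].
Qed.

Lemma ae_rV_cat (P : 'rV[R]_n -> Prop) : {ae mun, forall k, P k} ->
  {ae (mup \x mum)%E, forall z, P (cat z)}.
Proof.
move=> [N [mN N0 NP]]; exists (cat @^-1` N); split.
- by rewrite -[X in measurable X]setTI; exact: mcat.
- by rewrite -[LHS]lebesgue_rV_cat.
- by move=> z /= nz; apply: NP.
Qed.

Lemma dotp_rV_cat x y x' y' : dotp (rV_cat e x y) (rV_cat e x' y') = dotp x x' + dotp y y' :> R.
Proof.
rewrite /dotp; case: n / e => //=; rewrite big_split_ord/=; congr (_ + _).
  by apply: eq_bigr => i _; rewrite !rV_catE !row_mxEl.
by apply: eq_bigr => i _; rewrite !rV_catE !row_mxEr.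
Qed.

End rV_cat_integral.

(** * The slice integral as a bounded linear map, and its extremal functions *)

Section marginal_linear.
Context {R : realType} {p m n : nat} (e : (p + m = n)%N) (alpha : R).
Hypotheses (alpha_gt : m%:R / 2 < alpha) (p0 : (0 < p)%N).
Local Notation mup := (lebesgue_rV p : {sigma_finite_measure set 'rV[R]_p -> \bar R}).
Local Notation mum := (lebesgue_rV m : {sigma_finite_measure set 'rV[R]_m -> \bar R}).
Local Notation mun := (lebesgue_rV n : {sigma_finite_measure set 'rV[R]_n -> \bar R}).
Let beta := alpha - m%:R / 2.
Implicit Types (u v g : 'rV[R]_n -> R[i]).
Local Notation A := (@slice_cst R m alpha).

Let A0 : 0 < A. Proof. exact: slice_cst_gt0. Qed.

Lemma residual_norm2_ge0 g : (0 <= residual_norm2 e alpha g)%E.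
Proof.
apply: integral_ge0 => x _; apply: integral_ge0 => y _.
by rewrite lee_fin mulr_ge0 ?sqr_ge0 ?powR_ge0.
Qed.

Lemma wnorm2_marginal g : cmeasurable_fun g -> (wnorm2 (2 * alpha) g < +oo)%E ->
  (A%:E * wnorm2 (2 * alpha) g = wnorm2 (2 * beta) (marginal e g) + A%:E * residual_norm2 e alpha g)%E.
Proof.
move=> mg gy; have [_ ->] := marginal_pythagoras e alpha_gt p0 mg gy.
rewrite ge0_muleDr ?residual_norm2_ge0//; last first.
  by rewrite mule_ge0 ?wnorm2_ge0// lee_fin invr_ge0 ltW.
by rewrite muleA -EFinM mulfV ?mul1e// gt_eqF.
Qed.

Lemma wnorm2_marginal_le g : cmeasurable_fun g -> (wnorm2 (2 * alpha) g < +oo)%E ->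
  (wnorm2 (2 * beta) (marginal e g) <= A%:E * wnorm2 (2 * alpha) g)%E.
Proof.
move=> mg gy; rewrite wnorm2_marginal// leeDl// mule_ge0 ?residual_norm2_ge0//.
by rewrite lee_fin ltW.
Qed.

Lemma wnorm2_marginal_lty g : cmeasurable_fun g -> (wnorm2 (2 * alpha) g < +oo)%E ->
  (wnorm2 (2 * beta) (marginal e g) < +oo)%E.
Proof.
move=> mg gy; apply: (le_lt_trans (wnorm2_marginal_le mg gy)).
by rewrite lte_mul_pinfty// lee_fin ltW.
Qed.

(** The equality is almost everywhere because additivity requires both slices to be integrable. *)
Lemma marginal_lin a u v : cmeasurable_fun u -> cmeasurable_fun v ->
  (wnorm2 (2 * alpha) u < +oo)%E -> (wnorm2 (2 * alpha) v < +oo)%E ->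
  {ae mup, forall x, marginal e (fun k => a * u k + v k) x = a * marginal e u x + marginal e v x}.
Proof.
move=> mu_ mv uy vy; have [iu _] := marginal_pythagoras e alpha_gt p0 mu_ uy.
have [iv _] := marginal_pythagoras e alpha_gt p0 mv vy.
by apply: filterS2 iu iv => x ui vi; case: (cintegral_lin a ui vi).
Qed.

(** The norm bound does the work: the difference has norm 0, hence so has its slice integral, which
    therefore vanishes almost everywhere. *)
Lemma marginal_ae u v : cmeasurable_fun u -> cmeasurable_fun v ->
  (wnorm2 (2 * alpha) u < +oo)%E -> {ae mun, forall k, u k = v k} ->
  {ae mup, forall x, marginal e u x = marginal e v x}.
Proof.
move=> mu_ mv uy uv; have vy : (wnorm2 (2 * alpha) v < +oo)%E.
  by rewrite -(wnorm2_ae _ mu_ mv uv).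
pose d k := -1 * u k + v k; have md : cmeasurable_fun d by exact: cmeasurable_lin.
have m0 : cmeasurable_fun (fun _ : 'rV[R]_n => 0 : R[i]) by split; exact: measurable_cst.
have d0 : wnorm2 (2 * alpha) d = 0%E.
  rewrite (wnorm2_ae _ md m0); last by apply: filterS uv => k; rewrite /d => ->; rewrite mulN1r addNr.
  by apply: integral0_eq => x _; rewrite Normc.normc0 expr0n mul0r.
have dy : (wnorm2 (2 * alpha) d < +oo)%E by rewrite d0.
have md0 : wnorm2 (2 * beta) (marginal e d) = 0%E.
  apply/eqP; rewrite eq_le wnorm2_ge0 andbT.
  by apply: le_trans (wnorm2_marginal_le md dy) _; rewrite d0 mule0.
apply: filterS2 (wnorm2_eq0 p0 (cmeasurable_marginal e md) md0) (marginal_lin (-1) mu_ mv uy vy) => x h1 h2.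
by move: h2; rewrite -/d h1 mulN1r => /esym/eqP; rewrite addrC subr_eq0 => /eqP.
Qed.

(** In the inversion formula at [(x, 0)] the character does not depend on [k2], so integrating over
    [k2] first leaves the inverse transform of the slice integral at [x]. The multiplication formula
    passes from this function to the distribution. *)
Lemma marginal_fourier (phi : 'rV[R]_n -> R[i]) : 0 < 2 * alpha -> schwartz phi ->
  ift_dist (marginal e (fourier phi)) = dist_of (fun x => phi (rV_cat e x 0)).
Proof.
move=> a0 Sp; set g := fourier phi.
have Sg : schwartz g by rewrite /g fourierE; exact: schwartz_fourier_sign (sqrN11) Sp.
have mg := ccontinuous_cmeasurable (schwartz_ccontinuous Sg).
have gy : (wnorm2 (2 * alpha) g < +oo)%E.
  have /integrableP[_] := schwartz_weight (ltW a0) Sg; apply: le_lt_trans.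
  rewrite le_eqVlt; apply/orP; left; apply/eqP; apply: eq_integral => x _ /=.
  by rewrite ger0_norm// mulr_ge0 ?sqr_ge0 ?powR_ge0.
have [ae_i _] := marginal_pythagoras e alpha_gt p0 mg gy.
have [hi _] := cintegral_marginal e (schwartz_cintegrable Sg).
have mh := cmeasurable_marginal e mg.
have Fh x : fourier_sign 1 (marginal e g) x = phi (rV_cat e x 0).
  have <- : fourier_sign 1 g (rV_cat e x 0) = phi (rV_cat e x 0).
    have := @fourier_sign_inversion R n (-1) phi (rV_cat e x 0) sqrN11 Sp.
    by rewrite opprK /g fourierE.
  have Si := schwartz_expi (1 * (2 * pi)) (rV_cat e x 0) Sg.
  have [_ E] := cintegral_marginal e (schwartz_cintegrable Si).
  transitivity (cintegral mup (marginal e (fun k => g k * expi (1 * (2 * pi) * dotp k (rV_cat e x 0))))); last exact: E.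
  apply: ae_eq_cintegral.
  - apply: cmeasurableM => //; apply: cmeasurable_expi; apply: measurable_funM => //.
    by apply: continuous_measurable_rV; exact: continuous_dotp.
  - by apply: cmeasurable_marginal; exact: ccontinuous_cmeasurable (schwartz_ccontinuous Si).
  apply: filterS ae_i => x1 i1; rewrite mulrC /marginal -cintegralZ//.
  congr cintegral; apply/funext => y; rewrite dotp_rV_cat mulrC; congr (_ * expi (_ * _)).
  by rewrite [X in _ + X](_ : _ = 0) ?addr0// /dotp big1// => i _; rewrite mxE mulr0.
apply/funext => chi; have [Sc|nSc] := pselect (schwartz chi); last first.
  by rewrite /ift_dist /dist_of; case: asboolP.
rewrite ift_distE// /dist_of; case: asboolP => // _.
rewrite -(fourier_sign_mul 1 mh hi (ccontinuous_cmeasurable (schwartz_ccontinuous Sc)) (schwartz_cintegrable Sc)).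
by congr cintegral; apply/funext => x; rewrite Fh.
Qed.

Lemma ae_residual_eq0 g : cmeasurable_fun g -> residual_norm2 e alpha g = 0%E ->
  {ae (mup \x mum)%E, forall z, residual e alpha g z.1 z.2 = 0}.
Proof.
move=> mg; rewrite /residual_norm2.
pose F (z : 'rV[R]_p * 'rV[R]_m) := (Normc.normc (residual e alpha g z.1 z.2) ^+ 2 * enorm (rV_cat e z.1 z.2) `^ (2 * alpha))%:E.
have mF : measurable_fun setT F by exact: measurable_residual_norm2.
have F0 z : (0 <= F z)%E by rewrite lee_fin mulr_ge0 ?sqr_ge0 ?powR_ge0.
rewrite -[X in X = _](fubini_tonelli1 F)// => h.
have : ae_eq (mup \x mum)%E setT F (cst 0%E).
  apply/ae_eq_integral_abs => //; rewrite -[RHS]h; apply: eq_integral => z _.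
  by rewrite gee0_abs.
have n0 : (0 < n)%N by rewrite -e addn_gt0 p0.
apply: filterS2 (ae_rV_cat e (@ae_enorm_gt0 R n n0)) => z z0 /(_ I) /= [] /eqP.
rewrite mulf_eq0 (gt_eqF (powR_gt0 _ z0)) orbF sqrf_eq0 => /eqP.
exact: Normc.eq0_normc.
Qed.

(* Equality in Cauchy-Schwarz: on each slice [g] is proportional to
   |k|^(-2 alpha). *)
Lemma residual_eq0_extremal : exists g : 'rV[R]_n -> R[i], [/\ cmeasurable_fun g,
  wnorm2 (2 * alpha) g = A%:E & residual_norm2 e alpha g = 0%E].
Proof.
pose pr (k : 'rV[R]_n) : 'rV[R]_p := \row_i k ord0 (cast_ord e (lshift m i)).
have prK x y : pr (rV_cat e x y) = x by apply/rowP => i; rewrite mxE rV_cat_l.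
have mpr : measurable_fun setT pr.
  apply: measurable_fun_rVP => i; under eq_fun do rewrite mxE.
  exact: measurable_rV_coord.
have b0 : 0 < beta by rewrite subr_gt0.
(* The open unit cube: volume 1 makes the squared norm exactly A, and positive coordinates keep it
   off the origin. *)
pose B : set 'rV[R]_p := obox 0 (const_mx 1).
have mB : measurable B by exact: measurable_obox.
have VB : (lebesgue_rV p B = 1)%E.
  have := @lebesgue_rV_box R p (fun=> `]0, 1[%classic : set R) (fun=> measurable_itv _).
  rewrite big1 => [<-|i _]; last by rewrite lebesgue_measure_itv/= lte_fin ltr01 oppr0 adde0.
  by congr (lebesgue_rV p _); apply/seteqP; split => x H i; have := H i; rewrite /= !mxE in_itv.
have Bgt0 x : B x -> 0 < enorm x.
  move=> /(_ (Ordinal p0)); rewrite !mxE => /andP[x0 _].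
  by apply: lt_le_trans (le_coord_enorm x (Ordinal p0)); rewrite normr_gt0 gt_eqF.
(* The square of this amplitude cancels the power [|x|^(- 2 beta)] in the slice integral of
   [|k|^(-2 alpha)], so every slice over [B] has squared norm A. *)
pose c x := \1_B x * enorm x `^ beta.
have mc : measurable_fun setT c.
  by apply: measurable_funM; [exact: measurable_indic|exact: measurable_enorm_powR].
have c0 x : enorm x = 0 -> c x = 0 by move=> x0; rewrite /c x0 powR0 ?mulr0// gt_eqF.
pose g k : R[i] := (c (pr k) * enorm k `^ (- (2 * alpha)))%:C%C.
have gE x y : g (rV_cat e x y) = (c x * enorm (rV_cat e x y) `^ (- (2 * alpha)))%:C%C by rewrite /g prK.
have mg : cmeasurable_fun g.
  split; last exact: measurable_cst.
  apply: measurable_funM; last exact: measurable_enorm_powR.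
  exact: (measurableT_comp mc mpr).
exists g; split => //.
- rewrite (wnorm2_rV_cat e)//.
  transitivity (\int[mup]_x (A%:E * (\1_B x)%:E))%E.
    apply: eq_integral => x _; have [xB|xB] := pselect (B x); last first.
      rewrite integral0_eq => [|y _]; first by rewrite indicE memNset// mule0.
      by rewrite gE /c indicE memNset// !mul0r Normc.normc0 expr0n mul0r.
    have x0 := Bgt0 _ xB.
    transitivity (\int[mum]_y ((enorm x `^ (2 * beta))%:E * (enorm (rV_cat e x y) `^ (- (2 * alpha)))%:E))%E.
      apply: eq_integral => y _; rewrite gE /c indicE mem_set// mul1r normcR real_normK ?num_real//.
      have y0 := @enorm_rV_cat_gt0 R _ _ _ e x y x0.
      rewrite exprMn -EFinM -mulrA; congr EFin; congr (_ * _).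
        by rewrite -powR_mulrn ?powR_ge0// -powRrM mulrC.
      rewrite powRN expr2 -mulrA mulVf ?mulr1//.
      by rewrite gt_eqF// powR_gt0.
    rewrite ge0_integralZl//.
    + rewrite integral_enorm_rV_cat// -!EFinM indicE mem_set// mulr1 powRN -/beta.
      by rewrite mulrCA mulfV ?mulr1// gt_eqF// powR_gt0.
    + apply/measurable_EFinP; apply: (measurableT_comp (@measurable_enorm_powR R n _)).
      exact: (measurableT_comp (@measurable_rV_cat R _ _ _ e) (pair1_measurable x)).
    + by move=> y _; rewrite lee_fin powR_ge0.
    + by rewrite lee_fin powR_ge0.
  rewrite ge0_integralZl//.
  + by rewrite integral_indic// setIT -[RHS]mule1; congr (_ * _)%E; exact: VB.
  + by apply/measurable_EFinP; exact: measurable_indic.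
  + by rewrite lee_fin ltW.
- apply: integral0_eq => x _; apply: integral0_eq => y _.
  suff -> : residual e alpha g x y = 0 by rewrite Normc.normc0 expr0n mul0r.
  (* At the origin the whole slice of [g] is 0, since [c] vanishes there. *)
  have [x0|x0] := eqVneq (enorm x) 0.
    rewrite /residual gE c0// mul0r sub0r.
    rewrite [marginal e g x](_ : _ = 0) ?mul0r ?oppr0// -[RHS](proj2 (@cintegral_0 R _ _ mum)).
    by congr cintegral; apply/funext => z; rewrite gE c0// mul0r.
  have {}x0 : 0 < enorm x by rewrite lt_neqAle eq_sym x0 enorm_ge0.
  have qi : mum.-integrable setT (EFin \o (fun y => enorm (rV_cat e x y) `^ (- (2 * alpha)))).
    apply/integrableP; split.
      apply/measurable_EFinP; apply: (measurableT_comp (@measurable_enorm_powR R n _)).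
      exact: (measurableT_comp (@measurable_rV_cat R _ _ _ e) (pair1_measurable x)).
    under eq_integral do rewrite /= ger0_norm ?powR_ge0//.
    by rewrite integral_enorm_rV_cat// ltry.
  (* The slice integral of [g] in closed form, [c x] times the beta integral; the subtracted
     projection then equals [g]. *)
  have -> : residual e alpha g x y = g (rV_cat e x y) - ((c x * (A * (enorm x `^ (2 * beta))^-1)) *
      ((enorm x `^ (2 * beta) / A) * enorm (rV_cat e x y) `^ (- (2 * alpha))))%:C%C.
    rewrite /residual -/beta [X in _ = _ - X]rmorphM; congr (_ - _ * _); apply/eqP; rewrite eq_complex /=; apply/andP; split.
      apply/eqP; transitivity (\int[mum]_y (c x * enorm (rV_cat e x y) `^ (- (2 * alpha)))).
        by apply: eq_Rintegral => z _; rewrite prK.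
      by rewrite RintegralZl// {1}/Rintegral integral_enorm_rV_cat//= powRN.
    by rewrite Rintegral_cst// mul0r.
  rewrite gE -rmorphB -[RHS](rmorph0 (real_complex R)); congr (_%:C%C).
  by field; rewrite (gt_eqF A0) gt_eqF ?powR_gt0.
Qed.

End marginal_linear.

(** * The trace operator *)

Lemma le_sqr_mul (R : realFieldType) (x y K : R) : 0 <= x -> x <= K * y ->
  x ^+ 2 <= K ^+ 2 * y ^+ 2.
Proof. by move=> x0 xy; rewrite -exprMn lerXn2r ?nnegrE// (le_trans x0). Qed.

(** Because the operators agree at [g], the difference of their values at [f] equals that at
    [f - g], to which both bounds apply. *)
Lemma dnorm_sub_le (R : realType) (n p : nat) (a b M N : R)
    (S T : dspaceType R n a -> dspaceType R p b) (f g : dspaceType R n a) :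
  linear S -> linear T -> (forall h, dnorm (S h) <= M * dnorm h) ->
  (forall h, dnorm (T h) <= N * dnorm h) -> S g = T g ->
  dnorm (-1 *: S f + T f) ^+ 2 <= (2 * M ^+ 2 + 2 * N ^+ 2) * dnorm (-1 *: g + f) ^+ 2.
Proof.
move=> lS lT SM TN ST; set r := -1 *: g + f.
have -> : -1 *: S f + T f = -1 *: S r + T r.
  rewrite /r lS lT ST !scaleN1r; move: (S f) (T f) (T g) => x y z.
  by rewrite opprD opprK addrACA subrr add0r.
apply: (le_trans (dnorm_lin _ _ _)).
have -> : Normc.normc (-1 : R[i]) = 1.
  by rewrite -[-1](rmorphN1 (real_complex R)) normcR normrN1.
have h1 := le_sqr_mul (dnorm_ge0 _) (SM r); have h2 := le_sqr_mul (dnorm_ge0 _) (TN r).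
rewrite expr1n mulr1 [leRHS]mulrDl; apply: lerD.
  by rewrite -[leRHS]mulrA ler_pM2l.
by rewrite -[leRHS]mulrA ler_pM2l.
Qed.

Section trace_operator.
Context {R : realType} {n m : nat} (lt_mn : (m < n)%N) (alpha : R).
Hypotheses (alpha_gt : m%:R / 2 < alpha) (alpha_lt : alpha < n%:R / 2).
Let p := (n - m)%N.
Let e : (p + m = n)%N := subnK (ltnW lt_mn).
Let beta := alpha - m%:R / 2.
Local Notation A := (@slice_cst R m alpha).

Let p0 : (0 < p)%N. Proof. by rewrite subn_gt0. Qed.

Let alpha0 : 0 < 2 * alpha.
Proof. by rewrite mulr_gt0//; apply: le_lt_trans alpha_gt; rewrite divr_ge0. Qed.

Let alphan : 2 * alpha < n%:R.
Proof. by rewrite mulrC -ltr_pdivlMr. Qed.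

Let beta0 : 0 < 2 * beta.
Proof. by rewrite mulr_gt0// subr_gt0. Qed.

Let betap : 2 * beta < p%:R.
Proof.
rewrite /p natrB ?(ltnW lt_mn)// (_ : 2 * beta = 2 * alpha - m%:R) ?ltrD2r//.
by rewrite /beta; field.
Qed.

Let A0 : 0 < A. Proof. exact: slice_cst_gt0. Qed.

Lemma dspace_trace (f : dspaceType R n alpha) :
  ift_dist (marginal e (fourier_fun f)) \in dspace_pred beta.
Proof.
apply/asboolP; apply: dspace_ift => //.
  by apply: cmeasurable_marginal; exact: cmeasurable_fourier_fun.
apply: wnorm2_marginal_lty => //; first exact: cmeasurable_fourier_fun.
exact: wnorm2_fourier_fun.
Qed.

(** Built from the chosen representative [fourier_fun f]; [is_fourier_of_trace] removes the
    choice. *)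
Definition trace_op (f : dspaceType R n alpha) : dspaceType R p beta := DSpace (dspace_trace f).

Let mF (f : dspaceType R n alpha) : cmeasurable_fun (fourier_fun f).
Proof. exact: cmeasurable_fourier_fun. Qed.

Let Fy (f : dspaceType R n alpha) : (wnorm2 (2 * alpha) (fourier_fun f) < +oo)%E.
Proof. exact: wnorm2_fourier_fun. Qed.

(** Representatives that agree almost everywhere have slice integrals that agree almost everywhere,
    hence the same inverse transform. *)
Lemma is_fourier_of_trace (f : dspaceType R n alpha) u : is_fourier_of f u ->
  is_fourier_of (trace_op f) (marginal e u).
Proof.
move=> fu; have [mu_ _] := fu; have fae := is_fourier_of_ae (fourier_funP f) fu.
have uy : (wnorm2 (2 * alpha) u < +oo)%E by rewrite -(wnorm2_ae _ (mF f) mu_ fae).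
have mh := cmeasurable_marginal e mu_.
rewrite /= (ift_dist_ae (cmeasurable_marginal e (mF f)) mh (marginal_ae e alpha_gt p0 (mF f) mu_ (Fy f) fae)).
apply: is_fourier_of_ift; apply: (tame_weight beta0 betap mh).
exact: (wnorm2_marginal_lty e alpha_gt p0 mu_ uy).
Qed.

Lemma trace_op_linear : linear trace_op.
Proof.
move=> a f g; apply: val_inj => /=.
have h : is_fourier_of (a *: trace_op f + trace_op g : dspaceType R p beta)
    (fun k => a * marginal e (fourier_fun f) k + marginal e (fourier_fun g) k).
  by rewrite dspace_val_lin; apply: is_fourier_of_lin; apply: is_fourier_of_trace; exact: fourier_funP.
rewrite -[RHS]/(dspace_val (a *: trace_op f + trace_op g)) (dspace_valE h).
pose u k := a * fourier_fun f k + fourier_fun g k.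
have mu_ : cmeasurable_fun u by exact: cmeasurable_lin.
have hu : is_fourier_of (a *: f + g : dspaceType R n alpha) u.
  by rewrite dspace_val_lin; apply: is_fourier_of_lin; exact: fourier_funP.
rewrite -[LHS]/(dspace_val (trace_op (a *: f + g))) (dspace_valE (is_fourier_of_trace hu)).
apply: ift_dist_ae.
- exact: cmeasurable_marginal.
- by apply: cmeasurable_lin; exact: cmeasurable_marginal.
- exact: (marginal_lin e alpha_gt p0 a (mF f) (mF g) (Fy f) (Fy g)).
Qed.

Definition trace_const : R := (2 ^+ m * pi `^ (m%:R / 2))^-1 *
  (Gamma ((2 * alpha - m%:R) / 2) / Gamma alpha).

(** As [2 alpha - 2 beta = m], the powers of [2 pi] differ by [2^m pi^m], and A supplies a factor
    [pi^(m/2)] that cancels half of [pi^m]. *)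
Lemma trace_constE : trace_const * (2 * pi) `^ (2 * alpha) = (2 * pi) `^ (2 * beta) * A.
Proof.
have p_gt0 : 0 < pi :> R by exact: pi_gt0.
have tp0 : 0 < 2 * pi :> R by rewrite mulr_gt0.
have pm : pi `^ (m%:R / 2) ^+ 2 = pi ^+ m :> R.
  by rewrite -powR_mulrn ?powR_ge0// -powRrM divfK// powR_mulrn// ltW.
have -> : (2 * pi) `^ (2 * alpha) = (2 * pi) `^ (2 * beta) * (2 ^+ m * pi `^ (m%:R / 2) ^+ 2).
  rewrite pm -exprMn -powR_mulrn ?(ltW tp0)// -powRD ?(gt_eqF tp0) ?implybT//.
  by congr (_ `^ _); rewrite /beta; field.
rewrite /trace_const /slice_cst (_ : (2 * alpha - m%:R) / 2 = alpha - m%:R / 2); last by field.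
have G0 : Gamma alpha != 0.
  by rewrite gt_eqF// Gamma_gt0//; apply: le_lt_trans alpha_gt; rewrite divr_ge0.
have q0 : pi `^ (m%:R / 2) != 0 :> R by rewrite gt_eqF// powR_gt0.
move: (Gamma alpha) (Gamma (alpha - m%:R / 2)) (pi `^ (m%:R / 2)) ((2 * pi) `^ (2 * beta)) G0 q0 => a b q t a0 q0.
by field; rewrite a0 q0 expf_neq0.
Qed.

Lemma trace_const_gt0 : 0 < trace_const.
Proof.
have c0 (s : R) : 0 < (2 * pi) `^ s by rewrite powR_gt0 ?mulr_gt0 ?pi_gt0.
by rewrite -(pmulr_lgt0 _ (c0 (2 * alpha))) trace_constE mulr_gt0.
Qed.

(** The defect in the trace inequality is a positive multiple of the residual norm. *)
Lemma trace_identity (f : dspaceType R n alpha) u : is_fourier_of f u ->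
  ((trace_const * dnorm f ^+ 2)%:E = (dnorm (trace_op f) ^+ 2)%:E +
   (trace_const * (2 * pi) `^ (2 * alpha))%:E * residual_norm2 e alpha u)%E.
Proof.
move=> fu; have [mu_ _] := fu.
have uy : (wnorm2 (2 * alpha) u < +oo)%E.
  by rewrite -(wnorm2_ae _ (mF f) mu_ (is_fourier_of_ae (fourier_funP f) fu)).
rewrite EFinM (dnorm_sqr fu) (dnorm_sqr (is_fourier_of_trace fu)) muleA -EFinM trace_constE.
have c0 : 0 <= (2 * pi) `^ (2 * beta) :> R by exact: powR_ge0.
rewrite EFinM -!muleA (wnorm2_marginal e alpha_gt p0 mu_ uy) ge0_muleDr ?wnorm2_ge0//.
by rewrite mule_ge0 ?residual_norm2_ge0// lee_fin ltW.
Qed.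

Lemma trace_le (f : dspaceType R n alpha) : dnorm (trace_op f) ^+ 2 <= trace_const * dnorm f ^+ 2.
Proof.
rewrite -lee_fin (trace_identity (fourier_funP f)) leeDl// mule_ge0 ?residual_norm2_ge0//.
by rewrite lee_fin mulr_ge0 ?powR_ge0// ltW// trace_const_gt0.
Qed.

Lemma trace_op_schwartz phi : schwartz phi -> exists2 f : dspaceType R n alpha,
  f = dist_of phi :> functional R n &
  trace_op f = dist_of (trace (ltnW lt_mn) phi) :> functional R p.
Proof.
move=> Sp; have /asboolP D := dspace_schwartz alpha0 alphan Sp.
exists (DSpace D) => //=.
have Sf : schwartz (fourier phi) by rewrite fourierE; exact: schwartz_fourier_sign (sqrN11) Sp.
have hu : is_fourier_of (DSpace D) (fourier phi).
  by rewrite /= dist_of_schwartz//; apply: is_fourier_of_ift; exact: tame_of_schwartz.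
rewrite -[LHS]/(dspace_val (trace_op (DSpace D))) (dspace_valE (is_fourier_of_trace hu)).
exact: (marginal_fourier e alpha_gt p0 alpha0 Sp).
Qed.

Lemma dnorm_trace_le (f : dspaceType R n alpha) :
  dnorm (trace_op f) <= Num.sqrt trace_const * dnorm f.
Proof.
rewrite -(ler_pXn2r (ltn0Sn 1)) ?nnegrE ?dnorm_ge0 ?mulr_ge0 ?sqrtr_ge0 ?dnorm_ge0//.
by rewrite exprMn (sqr_sqrtr (ltW trace_const_gt0)) trace_le.
Qed.

Lemma trace_op_extension : bounded_trace_extension (ltnW lt_mn) trace_op.
Proof.
split; first exact: trace_op_linear.
  by exists (Num.sqrt trace_const); exact: dnorm_trace_le.
exact: trace_op_schwartz.
Qed.

(** Both operators take the same value at every Schwartz function, so at [f] they differ by at most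
    a constant times the distance from [f] to an arbitrarily close one. *)
Lemma trace_op_unique tau : bounded_trace_extension (ltnW lt_mn) tau -> trace_op = tau.
Proof.
move=> [tl [M tM] tS]; apply/funext => f.
have [ol [N oN] oS] := trace_op_extension.
pose d := -1 *: tau f + trace_op f.
suff d0 : d = 0.
  by move/eqP: d0; rewrite /d scaleN1r addrC subr_eq0 => /eqP.
apply: dnorm_eq0 => //; apply/eqP; rewrite -sqrf_eq0; apply/eqP; apply/le_anti.
rewrite sqr_ge0 andbT; apply/ler_addgt0Pr => eps eps0; rewrite add0r.
pose c : R := 2 * M ^+ 2 + 2 * N ^+ 2 + 1.
have c0 : 0 < c by rewrite ltr_wpDl// addr_ge0// mulr_ge0// sqr_ge0.
have [phi Sp Hphi] := dist_of_dense f alpha0 alphan (divr_gt0 eps0 c0).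
have [g1 g1E t1E] := tS _ Sp; have [g2 g2E t2E] := oS _ Sp.
have g12 : g1 = g2 by apply: val_inj => /=; rewrite g1E g2E.
have T12 : tau g1 = trace_op g1.
  by rewrite -g12 in t2E; apply: val_inj; exact: etrans t1E (esym t2E).
apply: (le_trans (dnorm_sub_le f tl ol tM oN T12)).
have rlt := Hphi _ g1E; have r0 := sqr_ge0 (dnorm (-1 *: g1 + f)).
apply: (@le_trans _ _ (c * dnorm (-1 *: g1 + f) ^+ 2)).
  by rewrite ler_wpM2r// lerDl.
by rewrite mulrC -ler_pdivlMr// ltW.
Qed.

(** For the extremal function the residual is 0 and the norm is not, so the identity becomes an
    equality by which one can divide. *)
Lemma trace_const_best (K : R) :
  (forall f, dnorm (trace_op f) ^+ 2 <= K * dnorm f ^+ 2) -> trace_const <= K.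
Proof.
move=> H; have [g [mg gA gr]] := residual_eq0_extremal e alpha_gt p0.
have gy : (wnorm2 (2 * alpha) g < +oo)%E by rewrite gA ltry.
have /asboolP D := dspace_ift alpha0 alphan mg gy.
pose f : dspaceType R n alpha := DSpace D.
have fg : is_fourier_of f g by apply: is_fourier_of_ift; exact: tame_weight gy.
have f0 : 0 < dnorm f ^+ 2.
  by rewrite -lte_fin (dnorm_sqr fg) gA -EFinM lte_fin mulr_gt0// powR_gt0// mulr_gt0// pi_gt0.
have := trace_identity fg; rewrite gr mule0 adde0 => -[E].
by rewrite -(ler_pM2r f0) E H.
Qed.

Lemma trace_eq_case (f : dspaceType R n alpha) : dnorm (trace_op f) ^+ 2 = trace_const * dnorm f ^+ 2 ->
  exists (C : R[i]) (ghat : 'rV[R]_p -> R[i]),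
    [/\ cmeasurable_fun ghat,
        (\int[lebesgue_rV p]_k1 (Normc.normc (ghat k1) ^+ 2 /
            enorm k1 `^ (2 * alpha - m%:R))%:E < +oo)%E &
        {ae (lebesgue_rV p \x lebesgue_rV m)%E, forall k : 'rV[R]_p * 'rV[R]_m,
          fourier_fun f (join_rV (ltnW lt_mn) k.1 k.2) =
          C * (ghat k.1 / ((enorm k.1 ^+ 2 + enorm k.2 ^+ 2) `^ alpha)%:C%C)}].
Proof.
move=> fE; pose g := fourier_fun f; pose h := marginal e g.
have mh : cmeasurable_fun h := cmeasurable_marginal e (mF f).
have hy : (wnorm2 (2 * beta) h < +oo)%E := wnorm2_marginal_lty e alpha_gt p0 (mF f) (Fy f).
have r0 : residual_norm2 e alpha g = 0%E.
  have := trace_identity (fourier_funP f); rewrite fE => h0.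
  have c0 : 0 < trace_const * (2 * pi) `^ (2 * alpha).
    by rewrite mulr_gt0 ?trace_const_gt0// powR_gt0// mulr_gt0// pi_gt0.
  have : ((trace_const * (2 * pi) `^ (2 * alpha))%:E * residual_norm2 e alpha g = 0)%E.
    (* Cancellation in the extended reals: the finite left-hand side rules out infinite values of
       the residual term. *)
    move: h0; rewrite -/g; case: (_ * residual_norm2 _ _ _)%E => [r [h0]| |]//; congr EFin.
    by have := congr1 (fun x => x - trace_const * dnorm f ^+ 2) h0; rewrite subrr addrAC subrr add0r.
  by move/eqP; rewrite mule_eq0 eqe gt_eqF//= => /eqP.
(* The coefficient of [|k|^(-2 alpha)] in the projection of the slice, with all constants put into
   it so that [C = 1]. Its squared modulus over [|k1|^(2 beta)] is [A^(-2) |h|^2 |k1|^(2 beta)], of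
   finite integral. *)
exists 1, (fun k1 => h k1 * (enorm k1 `^ (2 * beta) / A)%:C%C); split.
- apply: cmeasurableM => //; split; last exact: measurable_cst.
  by apply: measurable_funM => //; exact: measurable_enorm_powR.
- apply: (@le_lt_trans _ _ ((A^-1 ^+ 2)%:E * wnorm2 (2 * beta) h)%E); last first.
    by rewrite lte_mul_pinfty// lee_fin sqr_ge0.
  rewrite /wnorm2 -ge0_integralZl//; last 3 first.
  + by apply/measurable_EFinP; exact: measurable_normc2_enorm.
  + by move=> x _; rewrite lee_fin mulr_ge0 ?sqr_ge0 ?powR_ge0.
  + by rewrite lee_fin sqr_ge0.
  rewrite le_eqVlt; apply/orP; left; apply/eqP; apply: eq_integral => x _.
  rewrite -EFinM; congr EFin; rewrite (_ : 2 * alpha - m%:R = 2 * beta); last by rewrite /beta; field.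
  rewrite Normc.normcM normcR exprMn real_normK ?num_real//.
  (* Where the weight is 0 the quotient is 0 by convention, and so is the other side. *)
  have [->|x0] := eqVneq (enorm x `^ (2 * beta)) 0.
    by rewrite mul0r expr0n !mulr0 mul0r.
  by field; rewrite x0 gt_eqF.
- have := ae_residual_eq0 p0 (mF f) r0; apply: filterS => z /eqP.
  rewrite /residual subr_eq0 => /eqP hz; rewrite -[LHS]/(fourier_fun f (rV_cat e z.1 z.2)) hz.
  rewrite mul1r rmorphM mulrA; congr (_ * _).
  by rewrite powRN enorm_powR2 enorm_rV_cat fmorphV.
Qed.

End trace_operator.

Theorem theorem2p3 (R : realType) (n m : nat) (n_ge1 : (1 <= n)%N)
    (lt_mn : (m < n)%N) (alpha : R)
    (alpha_gt : m%:R / 2 < alpha) (alpha_lt : alpha < n%:R / 2) :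
  let K : R := (2 ^+ m * pi `^ (m%:R / 2))^-1 *
    (Gamma ((2 * alpha - m%:R) / 2) / Gamma alpha) in
  exists tau : dspaceType R n alpha ->
               dspaceType R (n - m) (alpha - m%:R / 2),
    [/\ unique (bounded_trace_extension (ltnW lt_mn)) tau,
        forall f, dnorm (tau f) ^+ 2 <= K * dnorm f ^+ 2,
        forall K' : R,
          (forall f, dnorm (tau f) ^+ 2 <= K' * dnorm f ^+ 2) -> K <= K' &
        forall f, dnorm (tau f) ^+ 2 = K * dnorm f ^+ 2 ->
          exists (C : R[i]) (ghat : 'rV[R]_(n - m) -> R[i]),
            [/\ cmeasurable_fun ghat,
                (\int[lebesgue_rV (n - m)]_k1
                  (Normc.normc (ghat k1) ^+ 2 /
                    enorm k1 `^ (2 * alpha - m%:R))%:E < +oo)%E &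
                {ae (lebesgue_rV (n - m) \x lebesgue_rV m)%E,
                  forall k : 'rV[R]_(n - m) * 'rV[R]_m,
                    fourier_fun f (join_rV (ltnW lt_mn) k.1 k.2) =
                    C * (ghat k.1 /
                      ((enorm k.1 ^+ 2 + enorm k.2 ^+ 2) `^ alpha)%:C%C)}]].
Proof.
move=> K; exists (trace_op lt_mn alpha_gt alpha_lt); split.
- by split; [exact: trace_op_extension|exact: trace_op_unique].
- exact: trace_le.
- exact: trace_const_best.
- exact: trace_eq_case.
Qed.
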